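(* Let $\mathbb P$ be the pseudoarc and let $T$ be the universal theory of unital, projectionless, abelian C$^*$-algebras. Then $C(\mathbb P)$ is the enforceable model of $T$.
   Context: A continuum is a connected compact Hausdorff space. The pseudoarc $\mathbb P$ is the unique (nondegenerate) metrizable continuum that is hereditarily indecomposable (no subcontinuum is the union of two proper subcontinua) and chainable (every finite open cover has a finite open refinement $U_1,\dots,U_n$ with $U_i\cap U_j\neq\emptyset$ iff $|i-j|\le 1$). A unital C$^*$-algebra is projectionless if its only projections are $0$ and $1$; a compact Hausdorff $X$ is a continuum iff $C(X)$ is projectionless. Unital C$^*$-algebras are regarded as structures in a many-sorted continuous language $L$: for each $k\ge1$ a sort for the closed operator-norm ball of radius $k$ with metric $\|x-y\|$, function symbols for the $*$-algebra operations (addition, multiplication, adjoint, multiplication by scalars in $\mathbb Q(i)$), constants $0,1$ and inclusion maps between balls. $T$ is a universal $L$-theory whose models are exactly the unital projectionless abelian C$^*$-algebras. Game with respect to $T$. Fix a countable set $C$ of new constant symbols, infinitely many of each sort, and set $L(C)=L\cup C$. A restricted formula is one built using a fixed countable family of continuous connectives whose compositions are uniformly dense among all continuous connectives. A condition is a finite set $p$ of expressions $\varphi<r$, with $\varphi$ a quantifier-free restricted $L(C)$-sentence and $r\in\mathbb R$, such that $T\cup p$ is satisfiable. Two players $\forall$ and $\exists$ alternately play conditions $p_0\subseteq p_1\subseteq p_2\subseteq\cdots$ ($\forall$ moves first; each move contains the previous one) for $\omega$ steps; let $\bar p=\bigcup_i p_i$. The play is definitive if for every atomic $L(C)$-sentence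 $\varphi$ there is a unique real $r$ with $T\cup\bar p\models\varphi=r$; then $\bar p$ determines a prestructure on the algebra of closed $L(C)$-terms, whose completion is the compiled structure. A property $P$ is enforceable (with respect to $T$) if $\exists$ has a strategy guaranteeing, whatever $\forall$ plays, that the play is definitive and the compiled structure has $P$. A structure $A$ is enforceable (the enforceable model of $T$) if the property ''the $L$-reduct of the compiled structure is isomorphic to $A$'' is enforceable. *)

(* Defs.v *)
From HB Require Import structures.
From Stdlib Require Import PArith.
From mathcomp Require Import all_boot all_order all_algebra.
From mathcomp Require Import all_classical all_reals all_analysis.
From mathcomp Require Import ring.
From mathcomp.real_closed Require Import complex.

Set Implicit Arguments.
Unset Strict Implicit.
Unset Printing Implicit Defensive.

Import Order.TTheory GRing.Theory Num.Theory numFieldNormedType.Exports.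

Local Open Scope classical_set_scope.
Local Open Scope ring_scope.
Local Open Scope complex_scope.

Definition dist_complete (R : realType) (T : Type) (d : T -> T -> R) : Prop :=
  forall u : nat -> T,
    (forall e : R, 0 < e -> exists N : nat, forall m n : nat,
       (N <= m)%N -> (N <= n)%N -> d (u m) (u n) < e) ->
    exists l : T, forall e : R, 0 < e -> exists N : nat, forall n : nat,
      (N <= n)%N -> d (u n) l < e.

(* The norm takes values in R, so it is not the R[i]-valued norm of a library
   normed module over R[i].  An algType is a nonzero ring, so 1 <> 0. *)
Record cstarAlgebra (R : realType) := CStarAlgebra {
  cstar_sort :> algType R[i];
  cnorm : cstar_sort -> R;
  cstar : cstar_sort -> cstar_sort;
  cnorm_eq0 : forall x, cnorm x = 0 -> x = 0;
  cnormD : forall x y, cnorm (x + y) <= cnorm x + cnorm y;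
  cnormZ : forall (a : R[i]) x, cnorm (a *: x) = Normc.normc a * cnorm x;
  cnormM : forall x y, cnorm (x * y) <= cnorm x * cnorm y;
  cstarK : forall x, cstar (cstar x) = x;
  cstarD : forall x y, cstar (x + y) = cstar x + cstar y;
  cstarZ : forall (a : R[i]) x, cstar (a *: x) = conjc a *: cstar x;
  cstarM : forall x y, cstar (x * y) = cstar y * cstar x;
  cstar_identity : forall x, cnorm (cstar x * x) = cnorm x ^+ 2;
  cstar_complete : dist_complete (fun x y => cnorm (x - y))
}.

Definition is_abelian (R : realType) (A : cstarAlgebra R) : Prop :=
  forall x y : A, x * y = y * x.

Definition is_projectionless (R : realType) (A : cstarAlgebra R) : Prop :=
  forall p : A, cstar p = p -> p * p = p -> p = 0 \/ p = 1.

Section CStarTheory.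
Context {R : realType} {A : cstarAlgebra R}.
Implicit Types x y : A.

Lemma cnorm0 : cnorm (0 : A) = 0.
Proof. by rewrite -(scale0r (0 : A)) cnormZ Normc.normc0 mul0r. Qed.

Lemma cnormN x : cnorm (- x) = cnorm x.
Proof. by rewrite -scaleN1r cnormZ normcN Normc.normc1 mul1r. Qed.

Lemma cnorm_ge0 x : 0 <= cnorm x.
Proof.
have := cnormD x (- x); rewrite subrr cnorm0 cnormN -mulr2n.
by rewrite pmulrn_lge0.
Qed.

Lemma le_cnorm_cstar x : cnorm x <= cnorm (cstar x).
Proof.
have := cnorm_ge0 x; rewrite le_eqVlt => /predU1P[<-|x0]; first exact: cnorm_ge0.
have := cnormM (cstar x) x.
by rewrite cstar_identity expr2 ler_pM2r.
Qed.

Lemma cnorm_cstar x : cnorm (cstar x) = cnorm x.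
Proof.
apply/eqP; rewrite eq_le le_cnorm_cstar andbT.
by rewrite -[leRHS]cnormN -{2}(cstarK x) cnormN le_cnorm_cstar.
Qed.

Lemma cstar1 : cstar (1 : A) = 1.
Proof.
by have := cstarM (cstar (1 : A)) 1; rewrite mulr1 cstarK mulr1 => <-.
Qed.

Lemma cnorm1_le1 : cnorm (1 : A) <= 1.
Proof.
have := cnorm_ge0 1; rewrite le_eqVlt => /predU1P[<-//|n0].
have := cstar_identity (1 : A); rewrite cstar1 mulr1 expr2.
by rewrite -{1}[cnorm 1]mulr1 => /(mulfI (lt0r_neq0 n0)) <-.
Qed.

End CStarTheory.

(* The sort k : positive is the sort of the closed ball of radius k >= 1. *)
Definition radius (R : realType) (k : positive) : R := (Pos.to_nat k)%:R.

(* For z in Q(i), multiplication by z is a symbol from sort k to sort l as soon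
   as |z| k <= l; the squared inequality keeps this a statement about rat. *)
Definition scale_fits (z : rat[i]) (k l : positive) : bool :=
  (complex.Re z ^+ 2 + complex.Im z ^+ 2) * (Pos.to_nat k)%:R ^+ 2
    <= (Pos.to_nat l)%:R ^+ 2.

Definition gauss (R : realType) (z : rat[i]) : R[i] :=
  (ratr (complex.Re z) +i* ratr (complex.Im z))%C.

Record Ldata (R : realType) := LData {
  Ldom :> positive -> Type;
  Ldist : forall k, Ldom k -> Ldom k -> R;
  Lzero : Ldom 1%positive;
  Lone : Ldom 1%positive;
  Ladd : forall k l, Ldom k -> Ldom l -> Ldom (k + l)%positive;
  Lmul : forall k l, Ldom k -> Ldom l -> Ldom (k * l)%positive;
  Lstar : forall k, Ldom k -> Ldom k;
  Lscale : forall z k l, scale_fits z k l -> Ldom k -> Ldom l;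
  Lincl : forall k l, Pos.leb k l -> Ldom k -> Ldom l
}.

(* The bounds on the metrics and the moduli of uniform continuity are part of
   the language; they are those valid in balls of normed algebras. *)
Record is_prestructure (R : realType) (M : Ldata R) : Prop := IsPrestructure {
  Ldist_refl : forall k (x : M k), Ldist x x = 0;
  Ldist_sym : forall k (x y : M k), Ldist x y = Ldist y x;
  Ldist_triangle : forall k (x y z : M k),
    Ldist x z <= Ldist x y + Ldist y z;
  Ldist_bound : forall k (x y : M k), Ldist x y <= 2 * radius R k;
  Ladd_modulus : forall k l (x x' : M k) (y y' : M l),
    Ldist (Ladd x y) (Ladd x' y') <= Ldist x x' + Ldist y y';
  Lmul_modulus : forall k l (x x' : M k) (y y' : M l),
    Ldist (Lmul x y) (Lmul x' y')
      <= radius R l * Ldist x x' + radius R k * Ldist y y';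
  Lstar_modulus : forall k (x y : M k),
    Ldist (Lstar x) (Lstar y) <= Ldist x y;
  Lscale_modulus : forall z k l (h : scale_fits z k l) (x y : M k),
    Ldist (Lscale h x) (Lscale h y) <= Normc.normc (gauss R z) * Ldist x y;
  Lincl_modulus : forall k l (h : Pos.leb k l) (x y : M k),
    Ldist (Lincl h x) (Lincl h y) <= Ldist x y
}.

Record is_structure (R : realType) (M : Ldata R) : Prop := IsStructure {
  structure_pre : is_prestructure M;
  Ldist_separated : forall k (x y : M k), Ldist x y = 0 -> x = y;
  Ldist_complete : forall k, dist_complete (@Ldist R M k)
}.

Record is_embedding (R : realType) (M N : Ldata R)
    (h : forall k, M k -> N k) : Prop := IsEmbedding {
  emb_dist : forall k (x y : M k), Ldist (h k x) (h k y) = Ldist x y;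
  emb_zero : h _ (Lzero M) = Lzero N;
  emb_one : h _ (Lone M) = Lone N;
  emb_add : forall k l (x : M k) (y : M l),
    h _ (Ladd x y) = Ladd (h _ x) (h _ y);
  emb_mul : forall k l (x : M k) (y : M l),
    h _ (Lmul x y) = Lmul (h _ x) (h _ y);
  emb_star : forall k (x : M k), h _ (Lstar x) = Lstar (h _ x);
  emb_scale : forall z k l (e : scale_fits z k l) (x : M k),
    h _ (Lscale e x) = Lscale e (h _ x);
  emb_incl : forall k l (e : Pos.leb k l) (x : M k),
    h _ (Lincl e x) = Lincl e (h _ x)
}.

Definition Lisomorphic (R : realType) (M N : Ldata R) : Prop :=
  exists h : forall k, M k -> N k,
    is_embedding h /\ forall k (y : N k), exists! x : M k, h k x = y.

Section Dissection.
Context {R : realType} (A : cstarAlgebra R).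

Definition cball (k : positive) : Type := {x : A | cnorm x <= radius R k}.

Lemma cball0_proof : cnorm (0 : A) <= radius R 1.
Proof. by rewrite cnorm0 ler01. Qed.

Lemma cball1_proof : cnorm (1 : A) <= radius R 1.
Proof. exact: cnorm1_le1. Qed.

Lemma cballD_proof k l (x : cball k) (y : cball l) :
  cnorm (sval x + sval y) <= radius R (k + l).
Proof.
rewrite /radius Pos2Nat.inj_add natrD.
exact: le_trans (cnormD _ _) (lerD (svalP x) (svalP y)).
Qed.

Lemma cballM_proof k l (x : cball k) (y : cball l) :
  cnorm (sval x * sval y) <= radius R (k * l).
Proof.
rewrite /radius Pos2Nat.inj_mul natrM.
apply: le_trans (cnormM _ _) _.
by apply: ler_pM; rewrite ?cnorm_ge0//; [exact: (svalP x)|exact: (svalP y)].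
Qed.

Lemma cballS_proof k (x : cball k) : cnorm (cstar (sval x)) <= radius R k.
Proof. by rewrite cnorm_cstar (svalP x). Qed.


Lemma cballZ_proof z k l (h : scale_fits z k l) (x : cball k) :
  cnorm (gauss R z *: sval x) <= radius R l.
Proof.
rewrite cnormZ.
have r0 m : 0 <= radius R m by exact: ler0n.
have n0 : 0 <= Normc.normc (gauss R z).
  by rewrite /gauss /Normc.normc sqrtr_ge0.
apply: (@le_trans _ _ (Normc.normc (gauss R z) * radius R k)).
  by rewrite ler_wpM2l// (svalP x).
rewrite -(@ler_pXn2r _ 2)// ?nnegrE ?mulr_ge0// exprMn.
rewrite /Normc.normc /gauss sqr_sqrtr ?addr_ge0 ?sqr_ge0//.
move: h; rewrite /scale_fits -(ler_rat R).
by rewrite rmorphM rmorphD !rmorphXn/= !ratr_nat.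
Qed.

Lemma cballI_proof k l (h : Pos.leb k l) (x : cball k) :
  cnorm (sval x) <= radius R l.
Proof.
apply: le_trans (svalP x) _; rewrite ler_nat; apply/ssrnat.leP.
by apply/Pos2Nat.inj_le/Pos.leb_le.
Qed.

Definition dissection : Ldata R := @LData R cball
  (fun k x y => cnorm (sval x - sval y))
  (exist _ 0 cball0_proof) (exist _ 1 cball1_proof)
  (fun k l x y => exist _ (sval x + sval y) (cballD_proof x y))
  (fun k l x y => exist _ (sval x * sval y) (cballM_proof x y))
  (fun k x => exist _ (cstar (sval x)) (cballS_proof x))
  (fun z k l h x => exist _ (gauss R z *: sval x) (cballZ_proof h x))
  (fun k l h x => exist _ (sval x) (cballI_proof h x)).

Lemma dissection_structure : is_structure dissection.
Proof.
have tri (x y z : A) : cnorm (x - z) <= cnorm (x - y) + cnorm (y - z).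
  by have := cnormD (x - y) (y - z); rewrite addrA subrK.
split.
- split=> /=.
  + by move=> k x; rewrite subrr cnorm0.
  + by move=> k x y; rewrite -cnormN opprB.
  + by move=> k x y z; exact: tri.
  + move=> k x y; apply: le_trans (cnormD _ _) _.
    rewrite cnormN mulr_natl mulr2n.
    exact: lerD (svalP x) (svalP y).
  + move=> k l x x' y y'; rewrite opprD addrACA; exact: cnormD.
  + move=> k l x x' y y'.
    have -> : sval x * sval y - sval x' * sval y'
        = (sval x - sval x') * sval y + sval x' * (sval y - sval y').
      by rewrite mulrBl mulrBr addrA subrK.
    apply: le_trans (cnormD _ _) (lerD _ _); apply: le_trans (cnormM _ _) _.
      by rewrite mulrC ler_wpM2r ?cnorm_ge0// (svalP y).
    by rewrite ler_wpM2r ?cnorm_ge0// (svalP x').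
  + move=> k x y.
    have cB (a b : A) : cstar (a - b) = cstar a - cstar b.
      by rewrite cstarD -scaleN1r cstarZ rmorphN rmorph1 scaleN1r.
    by rewrite -cB cnorm_cstar.
  + by move=> z k l h x y; rewrite -scalerBr cnormZ.
  + by [].
- by move=> k x y /= /cnorm_eq0/subr0_eq xy; exact: val_inj.
- move=> k u cu; have [l Hl] := cstar_complete cu.
  have lk : cnorm l <= radius R k.
    apply/ler_addgt0Pr => e e0; have [N HN] := Hl e e0.
    have -> : l = sval (u N) - (sval (u N) - l) by rewrite subKr.
    apply: le_trans (cnormD _ _) _; rewrite cnormN.
    by rewrite lerD ?(svalP (u N))// ltW// HN.
  by exists (exist _ l lk).
Qed.

End Dissection.

Record continuum := Continuum {
  continuum_space :> topologicalType;
  continuum_compact : compact [set: continuum_space];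
  continuum_hausdorff : hausdorff_space continuum_space;
  continuum_connected : connected [set: continuum_space];
  continuum_nonempty : [set: continuum_space] !=set0
}.

Record cfun (R : realType) (X : continuum) := CFun {
  cfun_val :> X -> R[i]^o;
  cfun_cont : continuous cfun_val
}.

Section ContinuousFunctions.
Context {R : realType} {X : continuum}.
Implicit Types f g h : cfun R X.

Lemma cfun_ext f g : (forall x, f x = g x) -> f = g.
Proof.
case: f g => f cf [g cg] /= /funext fg; case: _ / fg cg => cg.
by congr CFun; exact: Prop_irrelevance.
Qed.

Lemma cfun0_cont : continuous (fun _ : X => 0 : R[i]^o).
Proof. by move=> x; exact: cvg_cst. Qed.

Lemma cfun1_cont : continuous (fun _ : X => 1 : R[i]^o).
Proof. by move=> x; exact: cvg_cst. Qed.

Lemma cfunN_cont f : continuous (fun x => - f x : R[i]^o).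
Proof. by move=> x; apply: cvgN; exact: cfun_cont. Qed.

Lemma cfunD_cont f g : continuous (fun x => f x + g x : R[i]^o).
Proof. by move=> x; apply: cvgD; exact: cfun_cont. Qed.

Lemma cfunM_cont f g : continuous (fun x => f x * g x : R[i]^o).
Proof. by move=> x; apply: cvgM; exact: cfun_cont. Qed.

Lemma cfunZ_cont (a : R[i]) f : continuous (fun x => a * f x : R[i]^o).
Proof. by move=> x; apply: cvgM; [exact: cvg_cst|exact: cfun_cont]. Qed.

Lemma cfunJ_cont f : continuous (fun x => conjc (f x) : R[i]^o).
Proof.
move=> x; apply/cvgrPdist_lt => e e0.
have /cvgrPdist_lt/(_ e e0) := @cfun_cont _ _ f x.
by apply: filterS => y; rewrite -raddfB normcJ.
Qed.

Definition cfun0 := CFun cfun0_cont.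
Definition cfun1 := CFun cfun1_cont.
Definition cfunN f := CFun (@cfunN_cont f).
Definition cfunD f g := CFun (@cfunD_cont f g).
Definition cfunM f g := CFun (@cfunM_cont f g).
Definition cfunZ (a : R[i]) f := CFun (@cfunZ_cont a f).
Definition cfunJ f := CFun (@cfunJ_cont f).

Lemma cfunDA : associative cfunD.
Proof. by move=> f g h; apply: cfun_ext => x /=; rewrite addrA. Qed.
Lemma cfunDC : commutative cfunD.
Proof. by move=> f g; apply: cfun_ext => x /=; rewrite addrC. Qed.
Lemma cfun0D : left_id cfun0 cfunD.
Proof. by move=> f; apply: cfun_ext => x /=; rewrite add0r. Qed.
Lemma cfunND : left_inverse cfun0 cfunN cfunD.
Proof. by move=> f; apply: cfun_ext => x /=; rewrite addNr. Qed.
Lemma cfunMA : associative cfunM.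
Proof. by move=> f g h; apply: cfun_ext => x /=; rewrite mulrA. Qed.
Lemma cfunMC : commutative cfunM.
Proof. by move=> f g; apply: cfun_ext => x /=; rewrite mulrC. Qed.
Lemma cfun1M : left_id cfun1 cfunM.
Proof. by move=> f; apply: cfun_ext => x /=; rewrite mul1r. Qed.
Lemma cfunMDl : left_distributive cfunM cfunD.
Proof. by move=> f g h; apply: cfun_ext => x /=; rewrite mulrDl. Qed.
Lemma cfun1_neq0 : cfun1 <> cfun0.
Proof.
have [x _] := @continuum_nonempty X.
by move=> /(congr1 (fun f : cfun R X => f x)) /= /eqP; rewrite oner_eq0.
Qed.
Lemma cfunZA (a b : R[i]) f : cfunZ a (cfunZ b f) = cfunZ (a * b) f.
Proof. by apply: cfun_ext => x /=; rewrite mulrA. Qed.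
Lemma cfun1Z : left_id 1 cfunZ.
Proof. by move=> f; apply: cfun_ext => x /=; rewrite mul1r. Qed.
Lemma cfunZDr : right_distributive cfunZ cfunD.
Proof. by move=> a f g; apply: cfun_ext => x /=; rewrite mulrDr. Qed.
Lemma cfunZDl f (a b : R[i]) : cfunZ (a + b) f = cfunD (cfunZ a f) (cfunZ b f).
Proof. by apply: cfun_ext => x /=; rewrite mulrDl. Qed.
Lemma cfunZAl (a : R[i]) f g : cfunZ a (cfunM f g) = cfunM (cfunZ a f) g.
Proof. by apply: cfun_ext => x /=; rewrite mulrA. Qed.
Lemma cfunZAr (a : R[i]) f g : cfunZ a (cfunM f g) = cfunM f (cfunZ a g).
Proof. by apply: cfun_ext => x /=; rewrite mulrCA. Qed.

End ContinuousFunctions.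

HB.instance Definition _ (R : realType) (X : continuum) :=
  gen_eqMixin (cfun R X).
HB.instance Definition _ (R : realType) (X : continuum) :=
  gen_choiceMixin (cfun R X).
HB.instance Definition _ (R : realType) (X : continuum) :=
  GRing.isZmodule.Build (cfun R X) cfunDA cfunDC cfun0D cfunND.
Lemma cfun1_neq0b (R : realType) (X : continuum) :
  (cfun1 : cfun R X) != 0.
Proof. by apply/eqP; exact: cfun1_neq0. Qed.
HB.instance Definition _ (R : realType) (X : continuum) :=
  GRing.Zmodule_isComNzRing.Build (cfun R X)
    cfunMA cfunMC cfun1M cfunMDl (cfun1_neq0b R X).
HB.instance Definition _ (R : realType) (X : continuum) :=
  GRing.Zmodule_isLmodule.Build R[i] (cfun R X)
    cfunZA cfun1Z cfunZDr cfunZDl.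
HB.instance Definition _ (R : realType) (X : continuum) :=
  GRing.Lmodule_isLalgebra.Build R[i] (cfun R X) cfunZAl.
HB.instance Definition _ (R : realType) (X : continuum) :=
  GRing.Lalgebra_isAlgebra.Build R[i] (cfun R X) cfunZAr.

Section SupNorm.
Context {R : realType} {X : continuum}.
Implicit Types f g h : cfun R X.

Definition supnorm f : R := sup [set Normc.normc (f x) | x in [set: X]].

Lemma cfun_near f (x : X) (e : R) : 0 < e ->
  \forall y \near x, Normc.normc (f x - f y) < e.
Proof.
move=> e0; have /cvgrPdist_lt/(_ e%:C) := @cfun_cont _ _ f x.
rewrite ltcR => /(_ e0); apply: filterS => y.
by rewrite [`|_|](_ : _ = (Normc.normc (f x - f y))%:C)// ltcR.
Qed.

Lemma normc_ler_dist (a b : R[i]) :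
  `|Normc.normc a - Normc.normc b| <= Normc.normc (a - b).
Proof.
rewrite ler_norml lerBrDr lerBlDr; apply/andP; split.
  by have := le_normcD b (a - b); rewrite addrC subrK => _;
     rewrite addrC lerBlDr; have := le_normcD (b - a) a;
     rewrite subrK -[Normc.normc (b - a)]normcN opprB addrC.
by have := le_normcD (a - b) b; rewrite subrK.
Qed.

Lemma supnorm_has_sup f : has_sup [set Normc.normc (f x) | x in [set: X]].
Proof.
split.
  by have [x _] := @continuum_nonempty X; exists (Normc.normc (f x)), x.
have cn : continuous (fun x => Normc.normc (f x) : R).
  move=> x; apply/cvgrPdist_lt => e e0.
  apply: filterS (cfun_near f x e0) => y; apply: le_lt_trans.
  exact: normc_ler_dist.
have cK := continuous_compact (continuous_subspaceT cn) (@continuum_compact X).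
have [M [_ /(_ (M + 1))]] := compact_bounded cK.
rewrite ltrDl ltr01 => /(_ isT) b; exists (M + 1) => _ [x _ <-].
by apply: le_trans (ler_norm _) _; apply: b; exists x.
Qed.

Lemma le_supnorm f x : Normc.normc (f x) <= supnorm f.
Proof. by apply: (sup_upper_bound (supnorm_has_sup f)); exists x. Qed.

Lemma supnorm_le f (r : R) :
  (forall x, Normc.normc (f x) <= r) -> supnorm f <= r.
Proof.
move=> H; apply: ge_sup; first by case: (supnorm_has_sup f).
by move=> _ [x _ <-].
Qed.

Lemma normc_ge0 (a : R[i]) : 0 <= Normc.normc a.
Proof. by case: a => a b; rewrite sqrtr_ge0. Qed.

Lemma supnorm_ge0 f : 0 <= supnorm f.
Proof.
by have [x _] := @continuum_nonempty X; apply: le_trans (le_supnorm f x);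
  exact: normc_ge0.
Qed.

Lemma supnorm_eq0 f : supnorm f = 0 -> f = 0.
Proof.
move=> f0; apply: cfun_ext => x; apply: Normc.eq0_normc.
by apply/eqP; rewrite eq_le normc_ge0 -f0 le_supnorm.
Qed.

Lemma supnormD f g : supnorm (f + g) <= supnorm f + supnorm g.
Proof.
apply: supnorm_le => x; apply: le_trans (le_normcD _ _) _.
by rewrite lerD ?le_supnorm.
Qed.

Lemma supnormM f g : supnorm (f * g) <= supnorm f * supnorm g.
Proof.
apply: supnorm_le => x; rewrite [Normc.normc _]Normc.normcM.
by rewrite ler_pM ?normc_ge0 ?le_supnorm.
Qed.

Lemma supnormZ (a : R[i]) f : supnorm (a *: f) = Normc.normc a * supnorm f.
Proof.
have le b g : supnorm (b *: g) <= Normc.normc b * supnorm g.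
  apply: supnorm_le => x; rewrite [Normc.normc _]Normc.normcM.
  by rewrite ler_wpM2l ?normc_ge0 ?le_supnorm.
apply/eqP; rewrite eq_le le /=.
have [->|a0] := eqVneq a 0.
  by rewrite Normc.normc0 mul0r supnorm_ge0.
have na0 : 0 < Normc.normc a.
  rewrite lt_neqAle normc_ge0 andbT eq_sym; apply: contra_neq a0.
  exact: Normc.eq0_normc.
have := le a^-1 (a *: f).
by rewrite scalerA mulVf// scale1r Normc.normcV ler_pdivlMl.
Qed.

Lemma normc_conj (a : R[i]) : Normc.normc (conjc a) = Normc.normc a.
Proof. by case: a => a b /=; rewrite sqrrN. Qed.

Lemma supnorm_cstar_identity f : supnorm (cfunJ f * f) = supnorm f ^+ 2.
Proof.
apply/eqP; rewrite eq_le; apply/andP; split.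
  apply: le_trans (supnormM _ _) _; rewrite expr2 ler_wpM2r ?supnorm_ge0//.
  by apply: supnorm_le => x; rewrite /= normc_conj le_supnorm.
have s0 := supnorm_ge0 (cfunJ f * f).
rewrite -(sqr_sqrtr s0) ler_pXn2r ?nnegrE ?supnorm_ge0 ?sqrtr_ge0//.
apply: supnorm_le => x.
rewrite -(@ler_pXn2r _ 2)// ?nnegrE ?normc_ge0 ?sqrtr_ge0// sqr_sqrtr//.
have := le_supnorm (cfunJ f * f) x.
by rewrite [Normc.normc _]Normc.normcM normc_conj expr2.
Qed.

Lemma normc_complete : dist_complete (fun a b : R[i] => Normc.normc (a - b)).
Proof.
move=> u cu.
have Rele (a : R[i]) : `|complex.Re a| <= Normc.normc a.
  by case: a => a b /=; rewrite -sqrtr_sqr ler_wsqrtr// lerDl sqr_ge0.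
have Imle (a : R[i]) : `|complex.Im a| <= Normc.normc a.
  by case: a => a b /=; rewrite -sqrtr_sqr ler_wsqrtr// lerDr sqr_ge0.
have lim (p : R[i] -> R) : (forall a, `|p a| <= Normc.normc a) ->
    (forall a b, p (a - b) = p a - p b) ->
    exists l : R, forall e : R, 0 < e -> exists N : nat, forall n : nat,
      (N <= n)%N -> `|p (u n) - l| < e.
  move=> ple pB.
  have /cauchy_cvgP : cauchy ((fun n => p (u n)) @ \oo).
    apply: cauchy_exP => e e0; have [N HN] := cu e e0.
    exists (p (u N)); exists N => // n /= Nn.
    rewrite /ball/= -pB; apply: le_lt_trans (ple _) _; exact: HN.
  move=> /cvg_ex[l /cvgrPdist_lt H]; exists l => e e0.
  have [N _ HN] := H _ e0; exists N => n Nn.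
  by rewrite distrC; exact: HN.
have [a Ha] := lim _ Rele (fun a b => raddfB (@complex.Re R) a b).
have [b Hb] := lim _ Imle (fun a b => raddfB (@complex.Im R) a b).
exists (a +i* b) => e e0.
have e20 : 0 < e / 2 by rewrite divr_gt0.
have [N1 H1] := Ha _ e20; have [N2 H2] := Hb _ e20.
exists (maxn N1 N2) => n; rewrite geq_max => /andP[/H1 h1 /H2 h2].
have -> : u n - (a +i* b)
    = (complex.Re (u n) - a)%:C + 0 +i* (complex.Im (u n) - b).
  by case: (u n) => c d; apply/eqP; rewrite eq_complex/= addr0 add0r !eqxx.
apply: le_lt_trans (le_normcD _ _) _; rewrite [ltRHS](splitr e).
rewrite /= [0 ^+ 2]expr0n/= addr0 add0r !sqrtr_sqr.
exact: ltrD.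
Qed.

Lemma supnorm_complete : dist_complete (fun f g => supnorm (f - g)).
Proof.
move=> u cu.
have ptle f g x : Normc.normc (f x - g x) <= supnorm (f - g).
  exact: (le_supnorm (f - g)).
have /choice[F HF] : forall x, exists l : R[i], forall e : R, 0 < e ->
    exists N : nat, forall n : nat, (N <= n)%N ->
      Normc.normc (u n x - l) < e.
  move=> x; apply: normc_complete => e e0; have [N HN] := cu e e0.
  by exists N => m n Nm Nn; apply: le_lt_trans (ptle _ _ x) _; exact: HN.
have unif e : 0 < e -> exists N : nat, forall n : nat, (N <= n)%N ->
    forall x, Normc.normc (u n x - F x) <= e.
  move=> e0; have [N HN] := cu _ e0; exists N => n Nn x.
  apply/ler_addgt0Pr => d d0; have [N' HN'] := HF x d d0.
  set m := maxn N N'.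
  have -> : u n x - F x = (u n x - u m x) + (u m x - F x).
    by rewrite addrA subrK.
  apply: le_trans (le_normcD _ _) (lerD _ _).
    apply: le_trans (ptle _ _ x) (ltW _).
    by apply: HN => //; exact: leq_maxl.
  by apply/ltW/HN'; exact: leq_maxr.
have cF : continuous (F : X -> R[i]^o).
  move=> x; apply/cvgrPdist_lt => e' e'0.
  have [e e0 ->] : exists2 e : R, 0 < e & e' = e%:C.
    case: e' e'0 => a b; rewrite ltcE/= => /andP[/eqP-> a0].
    by exists a.
  have e30 : 0 < e / 3 by rewrite divr_gt0.
  have [N HN] := unif _ e30.
  apply: filterS (cfun_near (u N) x e30) => y uxy.
  rewrite [`|_|](_ : _ = (Normc.normc (F x - F y))%:C)// ltcR.
  have -> : F x - F y
      = (F x - u N x) + (u N x - u N y) + (u N y - F y).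
    by rewrite !addrA !subrK.
  have -> : e = e / 3 + e / 3 + e / 3 by field.
  apply: le_lt_trans (le_normcD _ _) _; apply: ltr_leD; last exact: HN.
  apply: le_lt_trans (le_normcD _ _) _; apply: ler_ltD => //.
  by rewrite -normcN opprB; exact: HN.
exists (CFun cF) => e e0.
have e20 : 0 < e / 2 by rewrite divr_gt0.
have [N HN] := unif _ e20; exists N => n Nn.
apply: (@le_lt_trans _ _ (e / 2)); last by rewrite gtr_pMr// invf_lt1// ltr1n.
by apply: supnorm_le => x; exact: HN.
Qed.

End SupNorm.

Definition C_algebra (R : realType) (X : continuum) : cstarAlgebra R.
Proof.
refine (@CStarAlgebra R (cfun R X) supnorm cfunJ
  supnorm_eq0 supnormD supnormZ supnormM _ _ _ _
  supnorm_cstar_identity supnorm_complete).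
- by move=> f; apply: cfun_ext => x /=; rewrite conjcK.
- by move=> f g; apply: cfun_ext => x /=; rewrite raddfD.
- by move=> a f; apply: cfun_ext => x /=; rewrite rmorphM.
- by move=> f g; apply: cfun_ext => x /=; rewrite rmorphM mulrC.
Defined.

Definition metrizable (R : realType) (X : topologicalType) : Prop :=
  exists (M : metricType R) (f : X -> M) (g : M -> X),
    [/\ continuous f, continuous g, cancel f g & cancel g f].

Definition nondegenerate (X : Type) : Prop := exists x y : X, x <> y.

Definition subcontinuum (X : topologicalType) (K : set X) : Prop :=
  [/\ K !=set0, compact K & connected K].

Definition decomposable (X : topologicalType) (K : set X) : Prop :=
  exists A B : set X, [/\ subcontinuum A, subcontinuum B,
    A `<` K, B `<` K & A `|` B = K].

Definition hereditarily_indecomposable (X : topologicalType) : Prop :=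
  forall K : set X, subcontinuum K -> ~ decomposable K.

Definition open_cover (X : topologicalType) n (U : 'I_n -> set X) : Prop :=
  (forall i, open (U i)) /\ \bigcup_i U i = [set: X].

Definition chainable (X : topologicalType) : Prop :=
  forall n (U : 'I_n -> set X), open_cover U ->
    exists m (V : 'I_m -> set X),
      [/\ open_cover V,
          forall i, exists j, V i `<=` U j &
          forall i j : 'I_m,
            (V i `&` V j !=set0) <-> ((i <= j.+1) && (j <= i.+1))%N].

Definition is_pseudoarc (R : realType) (X : continuum) : Prop :=
  [/\ nondegenerate X, metrizable R X,
      hereditarily_indecomposable X & chainable X].

(* Sym k n is the n-th extra symbol of sort k.  These symbols play two roles:
   free variables, when forming universal sentences, and the countably many new
   constants C, in which case the terms below are the closed L(C)-terms. *)
Inductive Lterm : positive -> Type :=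
| Sym k : nat -> Lterm k
| TZero : Lterm 1%positive
| TOne : Lterm 1%positive
| TAdd k l : Lterm k -> Lterm l -> Lterm (k + l)%positive
| TMul k l : Lterm k -> Lterm l -> Lterm (k * l)%positive
| TStar k : Lterm k -> Lterm k
| TScale z k l : scale_fits z k l -> Lterm k -> Lterm l
| TIncl k l : Pos.leb k l -> Lterm k -> Lterm l.

Inductive qfformula (R : realType) : Type :=
| Dist k : Lterm k -> Lterm k -> qfformula R
| Conn n : ('rV[R]_n -> R) -> ('I_n -> qfformula R) -> qfformula R.

(* An interpretation of the extra symbols: an assignment of the variables, or
   what turns the L-structure M into an L(C)-structure. *)
Definition valuation (R : realType) (M : Ldata R) : Type :=
  forall k : positive, nat -> M k.

Fixpoint term_val (R : realType) (M : Ldata R) (c : valuation M) k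
    (t : Lterm k) : M k :=
  match t in Lterm k return M k with
  | Sym k n => c k n
  | TZero => Lzero M
  | TOne => Lone M
  | TAdd _ _ t u => Ladd (term_val c t) (term_val c u)
  | TMul _ _ t u => Lmul (term_val c t) (term_val c u)
  | TStar _ t => Lstar (term_val c t)
  | TScale _ _ _ h t => Lscale h (term_val c t)
  | TIncl _ _ h t => Lincl h (term_val c t)
  end.

Fixpoint formula_val (R : realType) (M : Ldata R) (c : valuation M)
    (phi : qfformula R) : R :=
  match phi with
  | Dist _ t u => Ldist (term_val c t) (term_val c u)
  | Conn _ f a => f (\row_i formula_val c (a i))
  end.

Definition connectives (R : realType) : Type :=
  forall n, set ('rV[R]_n -> R).

Definition all_connectives (R : realType) : connectives R :=
  fun n => [set f : 'rV[R]_n -> R | continuous f].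

Fixpoint built_with (R : realType) (F : connectives R) (phi : qfformula R)
    : Prop :=
  match phi with
  | Dist _ _ _ => True
  | Conn n f a => F n f /\ forall i, built_with F (a i)
  end.

Inductive composition (R : realType) (F : connectives R) n
    : ('rV[R]_n -> R) -> Prop :=
| comp_proj (i : 'I_n) : composition F (fun x => x ord0 i)
| comp_app m (f : 'rV[R]_m -> R) (g : 'I_m -> 'rV[R]_n -> R) :
    F m f -> (forall j, composition F (g j)) ->
    composition F (fun x => f (\row_j g j x)).

(* Formulas take values in bounded intervals, so approximation is uniform on
   each box [-b, b]^n; a countable family cannot do better on all of R^n. *)
Definition dense_connectives (R : realType) (F : connectives R) : Prop :=
  forall n (g : 'rV[R]_n -> R), continuous g ->
  forall b e : R, 0 < e ->
  exists2 f : 'rV[R]_n -> R, composition F f &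
    forall x : 'rV[R]_n, (forall i, `|x ord0 i| <= b) -> `|f x - g x| < e.

Record restricted_family (R : realType) (F : connectives R) : Prop := {
  restricted_countable : forall n, countable (F n);
  restricted_continuous : forall n f, F n f -> continuous f;
  restricted_dense : dense_connectives F
}.

(* (phi, r) stands for the universal condition
   sup_x phi(x) <= r, with all free variables of phi quantified. *)
Definition universal_conditions (R : realType) : Type :=
  set (qfformula R * R).

Definition models (R : realType) (T : universal_conditions R) (M : Ldata R)
    : Prop :=
  is_structure M /\
  forall phi r, T (phi, r) -> forall v : valuation M, formula_val v phi <= r.

Definition universal_theory (R : realType) (K : Ldata R -> Prop)
    : universal_conditions R :=
  [set e | built_with (@all_connectives R) e.1 /\
    forall M, K M -> forall v : valuation M, formula_val v e.1 <= e.2].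

(* Over L-structures, the models of this theory are up to isomorphism the
   complete substructures of dissections of unital projectionless abelian C*-algebras
   (in which sort k may be smaller than the whole ball of radius k).  A set of
   quantifier-free conditions with constants holds in such a substructure iff it
   holds in the algebra, so satisfiability and consequence in the game are the
   same as those over the dissections themselves. *)
Definition T_projectionless_abelian (R : realType) : universal_conditions R :=
  universal_theory (fun M => exists A : cstarAlgebra R,
    [/\ is_abelian A, is_projectionless A & M = dissection A]).
Arguments T_projectionless_abelian R : clear implicits.

(* (phi, r) stands for the expression phi < r, phi being an L(C)-sentence. *)
Definition expressions (R : realType) : Type := set (qfformula R * R).

(* (M, c) is a model of T together with p. *)
Definition satisfies (R : realType) (T : universal_conditions R)
    (p : expressions R) (M : Ldata R) (c : valuation M) : Prop :=
  models T M /\ forall phi r, p (phi, r) -> formula_val c phi < r.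

Definition entails_eq (R : realType) (T : universal_conditions R)
    (p : expressions R) (phi : qfformula R) (r : R) : Prop :=
  forall (M : Ldata R) (c : valuation M),
    satisfies T p c -> formula_val c phi = r.

Definition condition (R : realType) (F : connectives R)
    (T : universal_conditions R) (p : expressions R) : Prop :=
  [/\ finite_set p,
      forall phi r, p (phi, r) -> built_with F phi &
      exists (M : Ldata R) (c : valuation M), satisfies T p c].

Definition legal_answer (R : realType) (F : connectives R)
    (T : universal_conditions R) (p q : expressions R) : Prop :=
  condition F T q /\ p `<=` q.

(* A strategy answers the sequence of moves played so far.  It must answer any
   condition legally, so that it cannot win by breaking the rules; what it does
   on sequences that are not legal partial plays is irrelevant. *)
Definition strategy (R : realType) : Type := seq (expressions R) -> expressions R.

Definition legal_strategy (R : realType) (F : connectives R)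
    (T : universal_conditions R) (sigma : strategy R) : Prop :=
  forall s p, condition F T p -> legal_answer F T p (sigma (rcons s p)).

(* The player "forall" makes the moves P 0, P 2, ..., the other one P 1, ... *)
Definition play (R : realType) (F : connectives R)
    (T : universal_conditions R) (P : nat -> expressions R) : Prop :=
  condition F T (P 0%N) /\ forall n, legal_answer F T (P n) (P n.+1).

Definition follows (R : realType) (sigma : strategy R)
    (P : nat -> expressions R) : Prop :=
  forall n, odd n -> P n = sigma (mkseq P n).

Definition definitive (R : realType) (T : universal_conditions R)
    (p : expressions R) : Prop :=
  forall k (t u : Lterm k), exists! r, entails_eq T p (Dist R t u) r.

(* The prestructure on the closed L(C)-terms determined by a definitive p. *)
Definition term_prestructure (R : realType) (T : universal_conditions R)
    (p : expressions R) : Ldata R :=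
  @LData R Lterm
    (fun k t u => get [set r | entails_eq T p (Dist R t u) r])
    TZero TOne TAdd TMul TStar TScale TIncl.

Definition is_completion (R : realType) (M0 : Ldata R) (c0 : valuation M0)
    (M : Ldata R) (c : valuation M) : Prop :=
  is_structure M /\
  exists h : forall k, M0 k -> M k,
    [/\ is_embedding h,
        forall k n, h k (c0 k n) = c k n &
        forall k (y : M k) (e : R), 0 < e ->
          exists x : M0 k, Ldist (h k x) y < e].

Definition is_compiled (R : realType) (T : universal_conditions R)
    (p : expressions R) (M : Ldata R) (c : valuation M) : Prop :=
  @is_completion R (term_prestructure T p) Sym M c.

Definition enforceable_property (R : realType) (F : connectives R)
    (T : universal_conditions R)
    (Q : forall M : Ldata R, valuation M -> Prop) : Prop :=
  exists sigma : strategy R, legal_strategy F T sigma /\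
    forall P, play F T P -> follows sigma P ->
      definitive T (\bigcup_n P n) /\
      exists (M : Ldata R) (c : valuation M),
        is_compiled T (\bigcup_n P n) c /\ Q M c.

(* The property ignores c: it is about the L-reduct of the compiled structure. *)
Definition enforceable_structure (R : realType) (F : connectives R)
    (T : universal_conditions R) (A : Ldata R) : Prop :=
  enforceable_property F T (fun M _ => Lisomorphic M A).

(* Main.v *)
(* A finite tuple of elements of an abelian projectionless algebra can be followed
   along a finite walk which comes close to all characters, hence its joint
   spectrum is nearly that of a tuple of continuous functions on an arc.  The
   pseudoarc P maps onto the arc, so every condition is satisfied in C(P).
   Conversely, P being chainable, a finite tuple in C(P) is nearly a function of one
   coordinate e from P onto [-1, 1].

   The player "exists" keeps a solution nu of the current condition in C(P), and
   adds to the condition that finitely many constants are, approximately, the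
   functions of a fresh constant d that they are of e under nu, and that d still
   has values near -1 and 1.  A later condition is again solved in C(P) by
   functions of a coordinate, of which d is a function g reaching from near -1 to
   near 1.  As P is hereditarily indecomposable, e is nearly g o V for some map V
   from P onto [-1, 1]: g is nearly a zigzag, and its folds can be undone one at a
   time.  Reading the new solution along V brings it close to nu.  So the solutions
   can be chosen to converge, and if in addition the constants are made to
   enumerate a dense subset of C(P), the compiled structure is C(P) itself. *)
From HB Require Import structures.
From Stdlib Require Import PArith.
From mathcomp Require Import all_boot all_order all_algebra.
From mathcomp Require Import all_classical all_reals all_analysis.
From mathcomp Require Import zify ring lra.
From mathcomp.real_closed Require Import complex.
Require Import Defs.

Set Implicit Arguments.
Unset Strict Implicit.
Unset Printing Implicit Defensive.

Import Order.TTheory GRing.Theory Num.Theory numFieldNormedType.Exports.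

Local Open Scope classical_set_scope.
Local Open Scope ring_scope.
Local Open Scope complex_scope.

(** * Characters of abelian algebras *)

(** A condition sees a valuation only through the set of its points, a point being the list of the
    values of all symbols at one character: distances are suprema over that set, so conditions are
    stable under small Hausdorff distance on finitely many symbols. Convergence of the solutions,
    however, needs functions on $\mathbb P$ that are uniformly close, and a solution of a later
    condition comes with its own parametrization. The way out is that a set of points indexed by an
    arc does not change when the arc is run through by another map onto it, so the parameter may be
    chosen to fit the earlier solution.

    The algebras are not represented as function spaces. Characters come from maximal preorderings,
    with sums of squares as positive elements, and projectionlessness serves to show that a
    self-adjoint element bounded away from 0 at the characters has constant sign. Two more obstacles
    lie in the language: $T$ consists of universal conditions, so algebras satisfying a condition
    are reached through one formula measuring its margin; and functions of $d$ must be terms, whence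
    polynomial approximation. *)

Lemma expr_small (R : realType) (r e : R) : 0 <= r -> r < 1 -> 0 < e ->
  exists N, forall n, (N <= n)%N -> r ^+ n < e.
Proof.
move=> r0 r1 e0.
have /cvgrPdist_lt/(_ e e0)[N _ HN] : (fun n => r ^+ n) @ \oo --> (0 : R).
  by apply: cvg_expr; rewrite ger0_norm.
by exists N => n /HN; rewrite sub0r normrN ger0_norm ?exprn_ge0.
Qed.

Lemma normc_real (R : realType) (r : R) : Normc.normc (r%:C) = `|r|.
Proof. by rewrite /= expr0n/= addr0 sqrtr_sqr. Qed.

(** A copy of the carrier indexed by the proof of commutativity, so that a commutative ring
    structure can be declared on it and [ring] works there. *)
Definition abelian_sort (R : realType) (A : cstarAlgebra R)
  (hA : is_abelian A) : Type := A.
HB.instance Definition _ (R : realType) (A : cstarAlgebra R)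
    (hA : is_abelian A) := GRing.Algebra.on (abelian_sort hA).
HB.instance Definition _ (R : realType) (A : cstarAlgebra R)
    (hA : is_abelian A) :=
  GRing.PzRing_hasCommutativeMul.Build (abelian_sort hA) hA.

Record is_character (R : realType) (A : cstarAlgebra R) (chi : A -> R[i])
    : Prop := IsCharacter {
  charD : forall x y, chi (x + y) = chi x + chi y;
  charM : forall x y, chi (x * y) = chi x * chi y;
  char1 : chi 1 = 1;
  charZ : forall a x, chi (a *: x) = a * chi x;
  charJ : forall x, chi (cstar x) = conjc (chi x)
}.

Lemma charB (R : realType) (A : cstarAlgebra R) (chi : A -> R[i]) x y :
  is_character chi -> chi (x - y) = chi x - chi y.
Proof. by case=> cD _ _ cZ _; rewrite cD -scaleN1r cZ mulN1r. Qed.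

Section Gelfand.
Variables (R : realType) (A : cstarAlgebra R) (hA : is_abelian A).
Local Notation B := (abelian_sort hA).
Implicit Types x y z a : B.

Definition nrm (x : B) : R := @cnorm R A x.
Definition st (x : B) : B := @cstar R A x.

Lemma nrmD x y : nrm (x + y) <= nrm x + nrm y. Proof. exact: cnormD. Qed.
Lemma nrmM x y : nrm (x * y) <= nrm x * nrm y. Proof. exact: cnormM. Qed.
Lemma nrmN x : nrm (- x) = nrm x. Proof. exact: cnormN. Qed.
Lemma nrmB x y : nrm (x - y) <= nrm x + nrm y.
Proof. by rewrite -(nrmN y); exact: nrmD. Qed.
Lemma nrm_ge0 x : 0 <= nrm x. Proof. exact: cnorm_ge0. Qed.
Lemma nrm0 : nrm 0 = 0. Proof. exact: cnorm0. Qed.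
Lemma nrm_st x : nrm (st x) = nrm x. Proof. exact: cnorm_cstar. Qed.
Lemma nrmC x y : nrm (x - y) = nrm (y - x).
Proof. by rewrite -nrmN opprB. Qed.
Lemma stK x : st (st x) = x. Proof. exact: cstarK. Qed.
Lemma stD x y : st (x + y) = st x + st y. Proof. exact: cstarD. Qed.
Lemma stM x y : st (x * y) = st x * st y.
Proof. by rewrite mulrC; exact: cstarM. Qed.
Lemma stZ (c : R[i]) x : st (c *: x) = conjc c *: st x. Proof. exact: cstarZ. Qed.
Lemma st1 : st 1 = 1. Proof. exact: cstar1. Qed.
Lemma stN x : st (- x) = - st x.
Proof. by rewrite -scaleN1r stZ rmorphN rmorph1 scaleN1r. Qed.
Lemma stB x y : st (x - y) = st x - st y. Proof. by rewrite stD stN. Qed.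
Lemma st0 : st 0 = 0.
Proof. by rewrite -[in LHS](subrr 0) stB subrr. Qed.
Lemma nrm_sq x : nrm (st x * x) = nrm x ^+ 2. Proof. exact: cstar_identity. Qed.

Definition rc (r : R) : B := (r%:C)%:A.
Lemma rcE r x : rc r * x = r%:C *: x. Proof. by rewrite mulr_algl. Qed.
Lemma rcD r s : rc (r + s) = rc r + rc s.
Proof. by rewrite /rc rmorphD scalerDl. Qed.
Lemma rcN r : rc (- r) = - rc r.
Proof. by rewrite /rc rmorphN scaleNr. Qed.
Lemma rcB r s : rc (r - s) = rc r - rc s. Proof. by rewrite rcD rcN. Qed.
Lemma rcM r s : rc (r * s) = rc r * rc s.
Proof. by rewrite rcE /rc scalerA rmorphM. Qed.
Lemma rc0 : rc 0 = 0. Proof. by rewrite /rc scale0r. Qed.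
Lemma rc1 : rc 1 = 1. Proof. by rewrite /rc scale1r. Qed.
Lemma rcV r : r != 0 -> rc r * rc r^-1 = 1.
Proof. by move=> r0; rewrite -rcM divff// rc1. Qed.
Lemma st_rc r : st (rc r) = rc r.
Proof. by rewrite /rc stZ conjc_real st1. Qed.
Lemma nrm_rcM r x : nrm (rc r * x) = `|r| * nrm x.
Proof. by rewrite rcE /nrm cnormZ normc_real. Qed.
Lemma nrm1 : nrm 1 <= 1. Proof. exact: cnorm1_le1. Qed.
Lemma nrm_rc r : nrm (rc r) <= `|r|.
Proof. by rewrite -(mulr1 (rc r)) nrm_rcM ler_piMr// nrm1. Qed.
Lemma rc_sqrt r : 0 <= r -> rc r = rc (Num.sqrt r) * rc (Num.sqrt r).
Proof. by move=> r0; rewrite -rcM -expr2 sqr_sqrtr. Qed.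

Lemma nrm_small x (C : R) : (forall e : R, 0 < e -> nrm x <= C * e) -> x = 0.
Proof.
move=> H; apply: cnorm_eq0; apply/eqP; rewrite eq_le nrm_ge0 andbT.
apply/ler_addgt0Pr => e e0; rewrite add0r.
have C0 : 0 < `|C| + 1 by rewrite ltr_wpDl.
have /H : 0 < e / (`|C| + 1) by rewrite divr_gt0.
move=> /le_trans; apply; rewrite mulrA ler_pdivrMr// mulrC ler_wpM2l// ?ltW//.
by rewrite (le_lt_trans (ler_norm C))// ltrDl.
Qed.

Lemma geo_cvg (u : nat -> B) (C r : R) : 0 <= r -> r < 1 ->
  (forall n, nrm (u n.+1 - u n) <= C * r ^+ n) ->
  exists l : B, forall e : R, 0 < e -> exists N, forall n, (N <= n)%N ->
    nrm (u n - l) < e.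
Proof.
move=> r0 r1 H; pose K := C / (1 - r).
have r10 : 0 < 1 - r by rewrite subr_gt0.
have C0 : 0 <= C by have := H 0%N; rewrite expr0 mulr1; apply: le_trans; exact: nrm_ge0.
have K0 : 0 <= K by rewrite divr_ge0// ltW.
have KE : C = K * (1 - r) by rewrite /K divfK// gt_eqF.
(* Keeping the difference of the two powers lets the induction on [k] close with equality. *)
have tel n k : nrm (u (n + k)%N - u n) <= K * (r ^+ n - r ^+ (n + k)).
  elim: k => [|k IH]; first by rewrite addn0 !subrr mulr0 nrm0.
  rewrite addnS.
  have -> : u (n + k).+1 - u n = (u (n + k).+1 - u (n + k)%N)
     + (u (n + k)%N - u n) by rewrite addrA subrK.
  apply: le_trans (nrmD _ _) _; apply: le_trans (lerD (H _) IH) _.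
  rewrite KE exprS; set X := r ^+ n; set Y := r ^+ (n + k).
  by rewrite -subr_ge0 [leRHS](_ : _ = 0)//; ring.
have tel2 m n : (n <= m)%N -> nrm (u m - u n) <= K * r ^+ n.
  move=> /subnKC <-; apply: le_trans (tel _ _) _.
  by rewrite ler_wpM2l// lerBlDr lerDl exprn_ge0.
apply: (@cstar_complete R A u) => e e0.
have K10 : 0 < K + 1 by rewrite ltr_wpDl.
have e20 : 0 < e / 2 / (K + 1) by rewrite !divr_gt0.
have [N HN] := expr_small r0 r1 e20; exists N => m n Nm Nn.
have h p : (N <= p)%N -> nrm (u p - u N) < e / 2.
  move=> Np; apply: le_lt_trans (tel2 _ _ Np) _.
  apply: (@le_lt_trans _ _ ((K + 1) * r ^+ N)).
    by rewrite ler_wpM2r ?exprn_ge0// lerDl.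
  by rewrite mulrC -ltr_pdivlMr// HN.
rewrite [ltRHS](splitr e).
apply: (@le_lt_trans _ _ (nrm (u m - u N) + nrm (u n - u N))).
  by rewrite (nrmC (u n)); apply: le_trans (nrmD _ _); rewrite addrA subrK.
by apply: ltrD; exact: h.
Qed.

(** * Self-adjoint elements, square roots and sums of squares *)

Definition sa x := st x = x.
Lemma saD x y : sa x -> sa y -> sa (x + y).
Proof. by rewrite /sa stD => -> ->. Qed.
Lemma saN x : sa x -> sa (- x). Proof. by rewrite /sa stN => ->. Qed.
Lemma saB x y : sa x -> sa y -> sa (x - y).
Proof. by move=> ? ?; apply: saD => //; exact: saN. Qed.
Lemma saM x y : sa x -> sa y -> sa (x * y).
Proof. by rewrite /sa stM => -> ->. Qed.
Lemma sa_rc r : sa (rc r). Proof. exact: st_rc. Qed.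
Lemma sa1 : sa 1. Proof. exact: st1. Qed.
Lemma sa0 : sa 0. Proof. exact: st0. Qed.
Lemma saX x n : sa x -> sa (x ^+ n).
Proof. by move=> hx; elim: n => [|n IH]; [exact: sa1|rewrite exprS; exact: saM]. Qed.
Lemma nrm_sa x : sa x -> nrm (x * x) = nrm x ^+ 2.
Proof. by move=> hx; rewrite -nrm_sq hx. Qed.

Lemma sa_lim (u : nat -> B) (l : B) : (forall n, sa (u n)) ->
  (forall e : R, 0 < e -> exists N, forall n, (N <= n)%N ->
    nrm (u n - l) < e) -> sa l.
Proof.
move=> su H; apply/eqP; rewrite -subr_eq0; apply/eqP.
apply: (@nrm_small _ 2) => e /H[N /(_ N (leqnn _)) h].
have -> : st l - l = (u N - l) - st (u N - l).
  by rewrite stB su; ring.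
apply: le_trans (nrmB _ _) _; rewrite nrm_st; lra.
Qed.

Definition hf : B := rc 2^-1.
Lemma hfE : hf + hf = 1.
Proof. by rewrite -rcD -[RHS]rc1; congr rc; field. Qed.
Lemma nrm_hf x : nrm (hf * x) = 2^-1 * nrm x.
Proof. by rewrite nrm_rcM ger0_norm. Qed.

Lemma sqrt_sub z : sa z -> nrm z < 1 -> exists2 w, sa w & w * w = 1 - z.
Proof.
move=> sz z1; set r := nrm z in z1 *.
(* [u] converges to 1 minus the square root. *)
pose u := fix u n := if n is n.+1 then hf * (z + u n * u n) else 0.
have su n : sa (u n).
  elim: n => [|n IH] /=; first exact: sa0.
  by apply: saM; [exact: sa_rc|apply: saD => //; exact: saM].
have ru n : nrm (u n) <= r.
  elim: n => [|n IH] /=; first by rewrite nrm0 nrm_ge0.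
  rewrite nrm_hf; have := nrmD z (u n * u n); have := nrmM (u n) (u n).
  have : nrm (u n) * nrm (u n) <= r.
    apply: le_trans (ler_pM (nrm_ge0 _) (nrm_ge0 _) IH IH) _.
    by rewrite ler_piMr ?nrm_ge0// ltW.
  rewrite -/r; lra.
have du n : nrm (u n.+1 - u n) <= 1 * r ^+ n.
  rewrite mul1r; elim: n => [|n IH].
    rewrite expr0 /= subr0 nrm_hf mulr0 addr0 -/r; lra.
  have -> : u n.+2 - u n.+1 = hf * ((u n.+1 - u n) * (u n.+1 + u n)).
    transitivity (hf * (z + u n.+1 * u n.+1) - hf * (z + u n * u n)) => //.
    by move: (u n.+1) (u n) => a b; ring.
  rewrite nrm_hf exprS.
  have h1 := nrmM (u n.+1 - u n) (u n.+1 + u n).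
  have h2 : nrm (u n.+1 + u n) <= 2 * r.
    by have := nrmD (u n.+1) (u n); have := ru n; have := ru n.+1; lra.
  have h3 := ler_pM (nrm_ge0 _) (nrm_ge0 _) IH h2.
  have := le_trans h1 h3; set X := nrm (_ * _); set Y := r ^+ n => h4.
  have : X <= 2 * (r * Y) by apply: le_trans h4 _; rewrite mulrC mulrA.
  lra.
have [p hp] := geo_cvg (nrm_ge0 z) z1 du.
have sp : sa p := sa_lim su hp.
exists (1 - p); first exact: (saB sa1 sp).
suff E : p + p = z + p * p.
  have -> : (1 - p) * (1 - p) = 1 - (p + p) + p * p by ring.
  by rewrite E; ring.
apply/eqP; rewrite -subr_eq0; apply/eqP.
apply: (@nrm_small _ (3 + (1 + r + nrm p))) => e e0.
have [N HN] := hp e e0.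
have h1 := HN N (leqnn _); have h2 := HN N.+1 (leqnSn _).
have -> : p + p - (z + p * p) = - ((u N.+1 - p) + (u N.+1 - p))
    + (u N - p) * (u N + p).
  have -> : u N.+1 = hf * (z + u N * u N) by [].
  set y := u N.
  transitivity (p + p - (hf + hf) * (z + p * p)); first by rewrite hfE mul1r.
  transitivity (p + p - (hf + hf) * (z + y * y) + (hf + hf) * (y * y - p * p)).
    by ring.
  by rewrite {2}hfE mul1r; ring.
have h3 := nrmD (- ((u N.+1 - p) + (u N.+1 - p))) ((u N - p) * (u N + p)).
apply: le_trans h3 _; rewrite nrmN.
have h4 := nrmD (u N.+1 - p) (u N.+1 - p).
have h5 := nrmM (u N - p) (u N + p).
have h6 : nrm (u N - p) * nrm (u N + p) <= e * (r + nrm p).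
  apply: ler_pM; rewrite ?nrm_ge0 ?(ltW h1)//.
  by apply: le_trans (nrmD _ _) _; rewrite lerD2r.
have h7 : e * (r + nrm p) = (r + nrm p) * e by rewrite mulrC.
lra.
Qed.

(** With [w = x + i y] one has [st w * w = x * x + y * y], and [x] is the real part of [w]; the
    C*-identity turns the claim into [nrm x <= nrm w]. *)
Lemma sqr_mono x y : sa x -> sa y -> nrm (x * x) <= nrm (x * x + y * y).
Proof.
move=> sx sy; pose I : B := 'i%:A.
have II : I * I = -1.
  rewrite mulr_algl scalerA [_ * _](_ : _ = -1) ?scaleN1r//.
  by rewrite -expr2 sqr_i.
have sI : st I = - I.
  by rewrite /I stZ st1 [conjc _](_ : _ = - 'i) ?scaleNr//; apply/eqP;
     rewrite eq_complex/= oppr0 !eqxx.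
set w := x + I * y.
have sw : st w = x - I * y by rewrite stD stM sI sx sy; ring.
have -> : x * x + y * y = st w * w.
  rewrite sw /w; transitivity (x * x - I * I * (y * y)); last by ring.
  by rewrite II; ring.
rewrite nrm_sq nrm_sa// ler_pXn2r ?nnegrE ?nrm_ge0//.
have -> : x = hf * (w + st w).
  by transitivity ((hf + hf) * x); [rewrite hfE mul1r|rewrite sw /w; ring].
rewrite nrm_hf; have := nrmD w (st w); rewrite nrm_st; lra.
Qed.

(** The element is [r] times a square [w * w], and [w * w] plus the square of [x / sqrt r] is 1, so
    [sqr_mono] bounds [nrm (w * w)] by [nrm 1]. *)
Lemma rsqr_mono x r : sa x -> nrm x ^+ 2 < r -> nrm (rc r - x * x) <= r.
Proof.
move=> sx xr; have r0 : 0 < r by apply: le_lt_trans xr; rewrite exprn_ge0 ?nrm_ge0.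
have rV := rcV (lt0r_neq0 r0).
have [||w sw ww] := @sqrt_sub (rc r^-1 * (x * x)).
- by apply: saM; [exact: sa_rc|exact: saM].
- by rewrite nrm_rcM nrm_sa// ger0_norm ?invr_ge0 ?ltW// mulrC ltr_pdivrMr ?mul1r.
have -> : rc r - x * x = rc r * (w * w).
  by rewrite ww mulrBr mulr1 (mulrA (rc r)) rV mul1r.
rewrite nrm_rcM ger0_norm ?(ltW r0)// ler_piMr ?(ltW r0)//.
have ri : 0 <= r^-1 by rewrite invr_ge0 ltW.
have := @sqr_mono w (rc (Num.sqrt r^-1) * x) sw (saM (sa_rc _) sx).
rewrite mulrACA -rc_sqrt// {2}ww subrK => /le_trans; apply; exact: nrm1.
Qed.

(** With [r] and [s] above the squared norms, the right-hand side is [M (1 - z)], where [z] is the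
    sum of [r - x * x] and [s - y * y] divided by [M = r + s + d]. The summand [d] makes
    [nrm z < 1], so [sqrt_sub] applies. *)
Lemma sum_sqr x y d : sa x -> sa y -> 0 < d ->
  exists2 w, sa w & w * w = x * x + y * y + rc d.
Proof.
move=> sx sy d0.
pose r := nrm x ^+ 2 + 1; pose s := nrm y ^+ 2 + 1; pose M := r + s + d.
have r0 : 0 < r by rewrite ltr_wpDl ?exprn_ge0 ?nrm_ge0.
have s0 : 0 < s by rewrite ltr_wpDl ?exprn_ge0 ?nrm_ge0.
have hr : nrm (rc r - x * x) <= r by apply: rsqr_mono => //; rewrite ltrDl.
have hs : nrm (rc s - y * y) <= s by apply: rsqr_mono => //; rewrite ltrDl.
have M0 : 0 < M by rewrite /M; lra.
have MV := rcV (lt0r_neq0 M0).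
have [||w sw ww] := @sqrt_sub (rc M^-1 * ((rc r - x * x) + (rc s - y * y))).
- apply: saM; first exact: sa_rc.
  by apply: saD; apply: saB; (exact: sa_rc || exact: saM).
- rewrite nrm_rcM ger0_norm ?invr_ge0 ?ltW// mulrC ltr_pdivrMr// mul1r.
  have := nrmD (rc r - x * x) (rc s - y * y); rewrite /M; lra.
exists (rc (Num.sqrt M) * w); first exact: saM (sa_rc _) sw.
rewrite mulrACA -rc_sqrt ?ltW// ww mulrBr mulr1 (mulrA (rc M)) MV mul1r.
by rewrite /M !rcD; ring.
Qed.

(** Sums of squares take the part of the positive elements, which avoids defining a spectrum: by
    [sos_root] each is a square up to an arbitrarily small constant. *)
Inductive sos : B -> Prop :=
| sos0 : sos 0
| sosS x y : sos x -> sa y -> sos (x + y * y).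

Lemma sos_sa x : sos x -> sa x.
Proof. by elim => [|{}x y _ sx sy]; [exact: sa0|exact: saD sx (saM sy sy)]. Qed.

Lemma sos_sqr x : sa x -> sos (x * x).
Proof. by move=> sx; rewrite -[_ * _]add0r; apply: sosS => //; exact: sos0. Qed.

Lemma sosD x y : sos x -> sos y -> sos (x + y).
Proof.
by move=> sx; elim => [|{}y z _ IH sz]; rewrite ?addr0// addrA; exact: sosS.
Qed.

Lemma sosM x y : sos x -> sos y -> sos (x * y).
Proof.
move=> sx; elim => [|{}y z _ IH sz]; first by rewrite mulr0; exact: sos0.
rewrite mulrDr; apply: sosD => //.
elim: sx {IH} => [|{}x w _ IH' sw]; first by rewrite mul0r; exact: sos0.
rewrite mulrDl; apply: sosD => //.
by rewrite mulrACA; apply: sos_sqr; exact: saM.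
Qed.

Lemma sos_rc r : 0 <= r -> sos (rc r).
Proof. by move=> r0; rewrite rc_sqrt//; apply: sos_sqr; exact: sa_rc. Qed.

Lemma sos_root x d : sos x -> 0 < d -> exists2 w, sa w & w * w = x + rc d.
Proof.
move=> sx; elim: sx d => [|{}x y _ IH sy] d d0.
  exists (rc (Num.sqrt d)); first exact: sa_rc.
  by rewrite add0r -rc_sqrt ?ltW.
have d20 : 0 < d / 2 by rewrite divr_gt0.
have [w sw ww] := IH _ d20; have [v sv vv] := sum_sqr sw sy d20.
exists v => //; rewrite vv ww {3}(splitr d) rcD; ring.
Qed.

(** Up to small constants both summands are squares, to which [sqr_mono] applies. The three thirds
    of [e] pay for the constant on the left and the two on the right. *)
Lemma sos_mono x y : sos x -> sos y -> nrm x <= nrm (x + y).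
Proof.
move=> sx sy; apply/ler_addgt0Pr => e e0.
have e30 : 0 < e / 3 by rewrite divr_gt0.
have [w sw ww] := sos_root sx e30; have [v sv vv] := sos_root sy e30.
have := sqr_mono sw sv; rewrite ww vv.
have -> : x + rc (e / 3) + (y + rc (e / 3)) = x + y + (rc (e / 3) + rc (e / 3)).
  by ring.
rewrite -rcD => h1.
have h2 := nrmD (x + y) (rc (e / 3 + e / 3)).
have h3 := nrm_rc (e / 3 + e / 3).
have h4 := nrmB (x + rc (e / 3)) (rc (e / 3)).
have h5 := nrm_rc (e / 3).
rewrite addrK in h4.
rewrite ger0_norm in h3; last by lra.
rewrite ger0_norm in h5; last by lra.
lra.
Qed.

Lemma sos_norm a M : sa a -> nrm a < M -> sos (rc M - a).
Proof.
move=> sx aM; have M0 : 0 < M by apply: le_lt_trans aM; exact: nrm_ge0.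
have [||w sw ww] := @sqrt_sub (rc M^-1 * a).
- exact: saM (sa_rc _) sx.
- by rewrite nrm_rcM ger0_norm ?invr_ge0 ?ltW// mulrC ltr_pdivrMr ?mul1r.
have -> : rc M - a = rc M * (w * w).
  by rewrite ww mulrBr mulr1 (mulrA (rc M)) rcV ?gt_eqF// mul1r.
by apply: sosM; [apply: sos_rc; exact: ltW|exact: sos_sqr].
Qed.

(** A proper preordering in the sense of real algebra. A maximal one plays the role of the set of
    self-adjoint elements that are nonnegative at one character. *)
Record preordering (Q : B -> Prop) : Prop := Preordering {
  poS : forall x, Q x -> sa x;
  poD : forall x y, Q x -> Q y -> Q (x + y);
  poM : forall x y, Q x -> Q y -> Q (x * y);
  poX : forall x, sa x -> Q (x * x);
  poN1 : ~ Q (-1)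
}.

Lemma sos_preordering : preordering sos.
Proof.
split; [exact: sos_sa|exact: sosD|exact: sosM|exact: sos_sqr|move=> s1].
have := sos_mono (sos_sqr sa1) s1.
rewrite mulr1 subrr nrm0 => h.
have : (1 : A) = 0 by apply: cnorm_eq0; apply/eqP; rewrite eq_le h nrm_ge0.
by move/eqP; rewrite oner_eq0.
Qed.

Lemma po_sos Q x : preordering Q -> sos x -> Q x.
Proof.
move=> [_ QD _ QX _]; elim=> [|{}x y _ Qx sy].
  by rewrite -(mulr0 0); exact: QX sa0.
by apply: QD => //; exact: QX.
Qed.

Definition adjoined (Q : B -> Prop) g : B -> Prop :=
  fun x => exists s t, [/\ Q s, Q t & x = s + t * g].

Lemma adjoinedP Q g : preordering Q -> sa g -> ~ adjoined Q g (-1) ->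
  [/\ preordering (adjoined Q g), forall x, Q x -> adjoined Q g x
    & adjoined Q g g].
Proof.
move=> PQ sg nQ; have [QS QD QM QX _] := PQ.
have Q0 : Q 0 by apply: po_sos => //; exact: sos0.
have Q1 : Q 1 by rewrite -(mulr1 1); exact: QX sa1.
have sub x : Q x -> adjoined Q g x.
  by move=> Qx; exists x, 0; split; rewrite // mul0r addr0.
split=> //; last by exists 0, 1; split; rewrite // mul1r add0r.
split=> //.
- by move=> _ [s [t [/QS ? /QS ? ->]]]; apply: saD => //; exact: saM.
- move=> _ _ [s [t [Qs Qt ->]]] [s' [t' [Qs' Qt' ->]]].
  by exists (s + s'), (t + t'); split; [exact: QD|exact: QD|ring].
- move=> _ _ [s [t [Qs Qt ->]]] [s' [t' [Qs' Qt' ->]]].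
  exists (s * s' + t * t' * (g * g)), (s * t' + t * s'); split; last by ring.
    by apply: (QD); [exact: QM|apply: (QM); [exact: QM|exact: QX]].
  by apply: QD; exact: QM.
- by move=> x /QX; exact: sub.
Qed.

Definition maximal_preordering (Q : B -> Prop) : Prop :=
  preordering Q /\ forall Q', preordering Q' ->
    (forall x, Q x -> Q' x) -> forall x, Q' x -> Q x.

Lemma exists_maximal Q0 : preordering Q0 ->
  exists2 Q, maximal_preordering Q & forall x, Q0 x -> Q x.
Proof.
(* Adding [Q0] inside the predicate takes care of the empty chain, whose union is empty. *)
move=> P0; pose P := [set X : set B | preordering (Q0 `|` X)].
have [|X [PX maxX]] := @Zorn_bigcup B P.
  move=> F FP totF.
  have dir x y : (Q0 `|` \bigcup_(X in F) X) x ->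
      (Q0 `|` \bigcup_(X in F) X) y ->
      exists X, [/\ P X, (Q0 `|` X) x, (Q0 `|` X) y &
        Q0 `|` X `<=` Q0 `|` \bigcup_(X in F) X].
    have one X : F X -> Q0 `|` X `<=` Q0 `|` \bigcup_(X in F) X.
      by move=> FX z [?|Xz]; [left|right; exists X].
    have p0 : P set0 by rewrite /P/= setU0.
    move=> [x0|[X FX Xx]] [y0|[Y FY Yy]].
    - by exists set0; split=> //; [left|left|rewrite setU0; left].
    - by exists Y; split; [exact: FP|left|right|exact: one].
    - by exists X; split; [exact: FP|right|left|exact: one].
    have [XY|YX] := totF _ _ FX FY.
      by exists Y; split; [exact: FP|right; exact: XY|right|exact: one].
    by exists X; split; [exact: FP|right|right; exact: YX|exact: one].
  split.
  - by move=> x /[dup] /dir /[apply] -[X [PX + _ _]]; exact: (poS PX).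
  - move=> x y /dir /[apply] -[X [PX h1 h2]]; apply; exact: (poD PX).
  - move=> x y /dir /[apply] -[X [PX h1 h2]]; apply; exact: (poM PX).
  - by move=> x sx; left; exact: (poX P0).
  - by move=> /[dup] /dir /[apply] -[X [PX + _ _]]; exact: (poN1 PX).
exists (Q0 `|` X); last by move=> x; left.
split=> // Q' PQ' sub x Q'x.
have [XQ'|nXQ'] := pselect (X = Q'); first by right; rewrite XQ'.
exfalso; apply: (maxX Q').
  split; first by move=> y Xy; apply: sub; right.
  by move=> Q'X; apply: nXQ'; apply/seteqP; split=> // y Xy; apply: sub; right.
rewrite /P/= (_ : Q0 `|` Q' = Q')//; apply/seteqP; split=> [y [Qy|//]|y]; last by right.
by apply: sub; left.
Qed.

(** * Values of self-adjoint elements at a maximal preordering *)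

Section MaximalPreordering.
Variables (Q : B -> Prop) (mQ : maximal_preordering Q).

Lemma mposos x : sos x -> Q x.
Proof. by move=> sx; apply: po_sos => //; exact: mQ.1. Qed.
Lemma mpoD x y : Q x -> Q y -> Q (x + y). Proof. exact: (poD mQ.1). Qed.
Lemma mpoM x y : Q x -> Q y -> Q (x * y). Proof. exact: (poM mQ.1). Qed.

Lemma mpo_rc r : 0 <= r -> Q (rc r).
Proof. by move=> r0; apply: mposos; exact: sos_rc. Qed.

Lemma mpo_rc_ge0 r : Q (rc r) -> 0 <= r.
Proof.
move=> Qr; rewrite leNgt; apply/negP => r0; apply: (poN1 mQ.1).
have r0' : 0 <= - r^-1 by rewrite oppr_ge0 invr_le0 ltW.
have := mpoM Qr (mpo_rc r0').
by rewrite rcN mulrN rcV// lt_eqF.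
Qed.

(** If neither [a] nor [- a] could be adjoined, then [-1 = s1 + t1 a = s2 - t2 a]; multiplying
    [1 + s1 = - t1 a] by [1 + s2 = t2 a] exhibits -1 as an element of [Q]. *)
Lemma mpo_total a : sa a -> Q a \/ Q (- a).
Proof.
move=> sx; have [PQ maxQ] := mQ.
have [h1|h1] := pselect (adjoined Q a (-1)); last first.
  have [PQ' sub aa] := adjoinedP PQ sx h1.
  by left; apply: maxQ aa.
have [h2|h2] := pselect (adjoined Q (- a) (-1)); last first.
  have [PQ' sub aa] := adjoinedP PQ (saN sx) h2.
  by right; apply: maxQ aa.
exfalso; apply: (poN1 PQ).
have [s1 [t1 [Qs1 Qt1 e1]]] := h1; have [s2 [t2 [Qs2 Qt2 e2]]] := h2.
have -> : -1 = s1 + s2 + s1 * s2 + t1 * t2 * (a * a).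
  have e1' : 1 + s1 = - (t1 * a).
    by transitivity (1 + (-1) + - (t1 * a)); [rewrite e1|]; ring.
  have e2' : 1 + s2 = t2 * a.
    by transitivity (1 + (-1) + t2 * a); [rewrite e2|]; ring.
  transitivity ((1 + s1) * (1 + s2) - 1 + t1 * t2 * (a * a)); last by ring.
  by rewrite e1' e2'; ring.
apply: mpoD; last by apply: mpoM; [exact: mpoM|exact: (poX PQ)].
by apply: mpoD; [exact: mpoD|exact: mpoM].
Qed.

(* [r] is the value at [a] of the character whose nonnegative elements form [Q]. *)
Definition value_at a (r : R) : Prop := forall e : R, 0 < e ->
  Q (a - rc r + rc e) /\ Q (rc r - a + rc e).

Lemma mpo_bound a : sa a -> exists2 M : R, 0 < M & Q (rc M - a) /\ Q (rc M + a).
Proof.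
move=> sx; exists (nrm a + 1); first by rewrite ltr_wpDl ?nrm_ge0.
split; apply: mposos; first by apply: sos_norm => //; rewrite ltrDl.
by rewrite -[X in _ + X]opprK; apply: sos_norm; [exact: saN|rewrite nrmN ltrDl].
Qed.

(** The value is the supremum of the [s] with [a - rc s] in [Q]; totality of [Q] gives the estimate
    from above. *)
Lemma exists_value a : sa a -> exists r, value_at a r.
Proof.
move=> sx; pose S := [set s | Q (a - rc s)].
have [M M0 [QM1 QM2]] := mpo_bound sx.
have hS : has_sup S.
  split; first by exists (- M); rewrite /S/= rcN opprK addrC.
  exists M => s /= Qs; rewrite -subr_ge0; apply: mpo_rc_ge0.
  by rewrite rcB (_ : _ - _ = (rc M - a) + (a - rc s)); [exact: mpoD|ring].
exists (sup S) => e e0; split.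
  have [s Ss hs] := sup_adherent e0 hS.
  have -> : a - rc (sup S) + rc e = (a - rc s) + rc (s - (sup S - e)).
    by rewrite !rcB; ring.
  by apply: mpoD => //; apply: mpo_rc; rewrite subr_ge0 ltW.
have [h|h] := mpo_total (saB sx (sa_rc (sup S + e))).
  have /(sup_upper_bound hS) : S (sup S + e) by [].
  by rewrite gerDl leNgt e0.
by move: h; rewrite rcD (_ : - _ = rc (sup S) - a + rc e)//; ring.
Qed.

Lemma value_unique a r s : value_at a r -> value_at a s -> r = s.
Proof.
suff le r' s' : value_at a r' -> value_at a s' -> r' <= s'.
  by move=> h1 h2; apply/eqP; rewrite eq_le !le.
move=> h1 h2; apply/ler_addgt0Pr => e e0.
have e20 : 0 < e / 2 by rewrite divr_gt0.
have [_ q1] := h2 _ e20; have [q2 _] := h1 _ e20.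
rewrite -subr_ge0; apply: mpo_rc_ge0.
rewrite {1}(splitr e) !rcB !rcD.
by have := mpoD q1 q2; congr Q; ring.
Qed.

Lemma value_rc r : value_at (rc r) r.
Proof. by move=> e e0; rewrite subrr add0r; split; exact: mpo_rc (ltW e0). Qed.

Lemma valueD a b r s : value_at a r -> value_at b s -> value_at (a + b) (r + s).
Proof.
move=> ha hb e e0; have e20 : 0 < e / 2 by rewrite divr_gt0.
have [a1 a2] := ha _ e20; have [b1 b2] := hb _ e20.
split; [have := mpoD a1 b1|have := mpoD a2 b2]; congr Q;
  by rewrite [in RHS](splitr e) !rcD; ring.
Qed.

Lemma valueN a r : value_at a r -> value_at (- a) (- r).
Proof.
move=> ha e e0; have [a1 a2] := ha _ e0.
by split; [move: a2|move: a1]; congr Q; rewrite rcN; ring.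
Qed.

(** Twice [a b + d M] is [(a + d)(M + b) + (d - a)(M - b)], a sum of products of elements of [Q]
    when [M] bounds [b] and [a] has value 0; [d = e / M] makes the error [e]. *)
Lemma value0M a b : sa b -> value_at a 0 -> value_at (a * b) 0.
Proof.
move=> sb ha e e0; have [M M0 [b1 b2]] := mpo_bound sb.
pose d := e / M; have d0 : 0 < d by rewrite divr_gt0.
have eE : rc e = rc d * rc M by rewrite -rcM divfK// gt_eqF.
have [] := ha _ d0; rewrite rc0 subr0 add0r => a1 a2.
have h : Q hf by apply: mpo_rc; rewrite invr_ge0.
have half x y : x + x = y -> x = hf * y.
  by move=> <-; rewrite mulrDr -mulrDl hfE mul1r.
rewrite subr0 sub0r eE; split.
  rewrite (half (a * b + rc d * rc M) ((a + rc d) * (rc M + b) + (- a + rc d) * (rc M - b))).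
    by apply: mpoM => //; apply: mpoD; exact: mpoM.
  by ring.
rewrite (half (- (a * b) + rc d * rc M) ((a + rc d) * (rc M - b) + (- a + rc d) * (rc M + b))).
  by apply: mpoM => //; apply: mpoD; exact: mpoM.
by ring.
Qed.

Lemma valueM a b r s : sa b -> value_at a r -> value_at b s ->
  value_at (a * b) (r * s).
Proof.
move=> sb ha hb.
have h1 : value_at ((a - rc r) * b) 0.
  by apply: value0M => //; rewrite -(subrr r); apply: valueD => //;
     apply: valueN; exact: value_rc.
have h2 : value_at ((b - rc s) * rc r) 0.
  by apply: value0M; [exact: sa_rc|]; rewrite -(subrr s); apply: valueD => //;
     apply: valueN; exact: value_rc.
have := valueD (valueD h1 h2) (value_rc (r * s)).
by rewrite !add0r rcM; congr value_at; ring.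
Qed.

Lemma value_ge0 a r : Q a -> value_at a r -> 0 <= r.
Proof.
move=> Qa ha; apply/ler_addgt0Pr => e e0; apply: mpo_rc_ge0.
have [_ h] := ha _ e0; have := mpoD Qa h.
by rewrite rcD; congr Q; ring.
Qed.

End MaximalPreordering.

(** * From values to characters *)

Definition reB x : B := hf * (x + st x).
Definition imB x : B := hf * (- ('i%:A : B) * (x - st x)).

Lemma iBE : ('i%:A : B) * 'i%:A = -1.
Proof.
rewrite mulr_algl scalerA [_ * _](_ : _ = -1) ?scaleN1r//.
by rewrite -expr2 sqr_i.
Qed.

Lemma st_iB : st ('i%:A : B) = - 'i%:A.
Proof.
rewrite stZ st1 [conjc _](_ : _ = - 'i) ?scaleNr//; apply/eqP.
by rewrite eq_complex/= oppr0 !eqxx.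
Qed.

Lemma sa_reB x : sa (reB x).
Proof. by rewrite /sa /reB stM stD stK st_rc addrC. Qed.

Lemma sa_imB x : sa (imB x).
Proof. by rewrite /sa /imB !stM stB stN st_iB stK st_rc; ring. Qed.

Lemma reimE x : x = reB x + 'i%:A * imB x.
Proof.
rewrite /reB /imB.
transitivity (hf * (x + st x) - 'i%:A * 'i%:A * (hf * (x - st x))); last by ring.
by rewrite iBE; transitivity ((hf + hf) * x); [rewrite hfE mul1r|ring].
Qed.

Lemma re_unique p q : sa p -> sa q -> reB (p + 'i%:A * q) = p.
Proof.
move=> sp sq; rewrite /reB stD stM st_iB sp sq.
by transitivity ((hf + hf) * p); [ring|rewrite hfE mul1r].
Qed.

Lemma maximal_character Q : maximal_preordering Q ->
  exists2 chi : B -> R[i], @is_character R A chi &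
    forall x, Q x -> 0 <= complex.Re (chi x).
Proof.
move=> mQ; have /choice[v hv] : forall x, exists r, value_at Q (reB x) r.
  by move=> x; exact: (exists_value mQ (sa_reB x)).
(* The real part of [- i x] is the imaginary part of [x], so this is the complex-linear functional
   with real part [v]. *)
pose chi x := (v x +i* v (- ('i%:A : B) * x))%C.
have vE x r : value_at Q (reB x) r -> v x = r.
  by move=> h; exact: (value_unique mQ (hv x) h).
have vS p : sa p -> value_at Q p (v p).
  move=> sp; have rep : reB p = p.
    by rewrite -[X in reB X]addr0 -(mulr0 ('i%:A : B)) re_unique//; exact: sa0.
  by have := hv p; rewrite rep.
have chiE p q : sa p -> sa q -> chi (p + 'i%:A * q) = (v p +i* v q)%C.
  move=> sp sq; apply/eqP; rewrite eq_complex/=; apply/andP; split; apply/eqP.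
    by apply: vE; rewrite re_unique//; exact: vS.
  apply: vE; rewrite (_ : - _ * _ = q + 'i%:A * (- p)).
    by rewrite re_unique//; [exact: vS|exact: saN].
  transitivity (- ('i%:A * 'i%:A) * q + 'i%:A * (- p)); first by ring.
  by rewrite iBE opprK mul1r.
have chi_sa p : sa p -> chi p = (v p)%:C.
  move=> sp; rewrite -[p in LHS]addr0 -(mulr0 'i%:A) chiE//; last exact: sa0.
  suff -> : v 0 = 0 by [].
  by apply: (value_unique mQ (vS _ sa0)); rewrite -rc0; exact: value_rc.
have vU p r : sa p -> value_at Q p r -> v p = r.
  by move=> sp h; apply: (value_unique mQ (vS _ sp)).
have vD p q : sa p -> sa q -> v (p + q) = v p + v q.
  move=> sp sq; apply: vU; first exact: saD.
  by apply: valueD => //; exact: vS.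
have vN p : sa p -> v (- p) = - v p.
  by move=> sp; apply: vU; [exact: saN|apply: valueN; exact: vS].
have vM p q : sa p -> sa q -> v (p * q) = v p * v q.
  by move=> sp sq; apply: vU; [exact: saM|apply: valueM => //; exact: vS].
have vrc r : v (rc r) = r by apply: vU; [exact: sa_rc|exact: value_rc].
have chiD x y : chi (x + y) = chi x + chi y.
  rewrite (reimE x) (reimE y).
  move: (sa_reB x) (sa_reB y) (sa_imB x) (sa_imB y).
  move: (reB x) (reB y) (imB x) (imB y) => p p' q q' sp sp' sq sq'.
  rewrite !chiE// (_ : _ + _ = p + p' + 'i%:A * (q + q')); last by ring.
  by rewrite chiE ?vD//; exact: saD.
have chiM x y : chi (x * y) = chi x * chi y.
  rewrite (reimE x) (reimE y).
  move: (sa_reB x) (sa_reB y) (sa_imB x) (sa_imB y).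
  move: (reB x) (reB y) (imB x) (imB y) => p p' q q' sp sp' sq sq'.
  rewrite (_ : _ * _ = (p * p' - q * q') + 'i%:A * (p * q' + p' * q)); last first.
    transitivity (p * p' + ('i%:A * 'i%:A) * (q * q') + 'i%:A * (p * q' + p' * q)).
      by ring.
    by rewrite iBE mulN1r.
  rewrite !chiE//; [|by apply: saB; exact: saM|by apply: saD; exact: saM].
  rewrite !vD ?vN ?vM//; try exact: saM; last by apply: saN; exact: saM.
  by congr Complex; ring.
exists chi; last first.
  move=> x Qx /=; have sx := poS mQ.1 Qx.
  exact: (value_ge0 mQ Qx (vS _ sx)).
have chi1 : chi 1 = 1.
  by rewrite (chi_sa _ sa1) -[X in v X]rc1 vrc.
split=> //.
- move=> [a b] x.
  rewrite (_ : _ *: x = (rc a + 'i%:A * rc b) * x).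
    by rewrite chiM chiE ?vrc//; exact: sa_rc.
  rewrite mulr_algl /rc scalerA -scalerDl -mulr_algl; congr (_ *: 1 * x).
  by apply/eqP; rewrite eq_complex/=; apply/andP; split; apply/eqP; ring.
- move=> x; rewrite -[cstar x]/(st x) (reimE x).
  move: (sa_reB x) (sa_imB x); move: (reB x) (imB x) => p q sp sq.
  rewrite stD stM st_iB sp sq mulNr -mulrN !chiE ?vN//; exact: saN.
Qed.

(** For [e > 0] the element [nrm (st x * x) + e - st x * x] is a sum of squares by [sos_norm], and a
    character is nonnegative on sums of squares. *)
Lemma character_le (chi : A -> R[i]) x : is_character chi ->
  Normc.normc (chi x) <= nrm x.
Proof.
move=> [cD cM c1 cZ cJ].
have crc r : chi (rc r) = r%:C by rewrite [chi _]cZ c1 mulr1.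
have csos (y : B) : sos y -> 0 <= chi y.
  elim=> [|{}y w _ IH sw].
    by have := crc 0; rewrite rc0 => ->; rewrite lexx.
  rewrite [chi _]cD addr_ge0// [chi _]cM -{1}sw [X in X * _]cJ mulrC.
  exact: mulcJ_ge0.
rewrite -(@ler_pXn2r _ 2) ?nnegrE ?nrm_ge0 ?normc_ge0//.
have E : (Normc.normc (chi x) ^+ 2)%:C = chi (st x * x).
  rewrite (cM (st x) x) (cJ x) mulrC -sqr_normc rmorphXn.
  by case: (chi x).
rewrite -nrm_sq; apply/ler_addgt0Pr => e e0; rewrite -lecR E.
have s1 : sos (rc (nrm (st x * x) + e) - st x * x).
  apply: sos_norm; last by rewrite ltrDl.
  by rewrite /sa stM stK mulrC.
have := csos _ s1; rewrite [chi _]cD crc.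
have -> : chi (- (st x * x)) = - chi (st x * x).
  by rewrite -[X in chi X]scaleN1r [chi _]cZ mulN1r.
by rewrite subr_ge0.
Qed.

Lemma nrm_pow2 a k : sa a -> nrm (a ^+ (2 ^ k)) = nrm a ^+ (2 ^ k).
Proof.
move=> sx; elim: k => [|k IH]; first by rewrite !expr1.
by rewrite expnS mulnC !exprM expr2 nrm_sa ?IH//; exact: saX.
Qed.

Lemma bernoulli_unbounded (q M : R) : 1 < q ->
  exists k, M < q ^+ (2 ^ k).
Proof.
move=> q1; have q0 : 0 < q by apply: lt_trans q1.
have i0 : 0 <= q^-1 by rewrite invr_ge0 ltW.
have i1 : q^-1 < 1 by rewrite invf_lt1.
have M0 : 0 < (`|M| + 1)^-1 by rewrite invr_gt0 ltr_wpDl.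
have [N HN] := expr_small i0 i1 M0; exists N.
have := HN (2 ^ N)%N (ltnW (ltn_expl N (ltnSn 1))).
rewrite exprVn ltf_pV2 ?posrE ?exprn_gt0 ?ltr_wpDl//.
by apply: lt_trans; apply: le_lt_trans (ler_norm M) _; rewrite ltrDl.
Qed.

(** If [a * a - rc t] can be adjoined to the sums of squares, a maximal extension gives the
    character. Otherwise [t u = 1 + s + u c] with [c = a * a], and substituting this into itself
    makes [u] the sum of [t^-(n+1) c^n] and a sum of squares, for every [n]. By [sos_mono] the norms
    of these multiples of [c^n] stay bounded, which fails along [n = 2^k], where [nrm (c^n)] is
    [(nrm c)^n] and [nrm c > t]. *)
Lemma character_sqr_ge a (t : R) : sa a -> 0 < t -> t < nrm a ^+ 2 ->
  exists2 chi, @is_character R A chi & t <= complex.Re (chi (a * a)).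
Proof.
move=> sx t0 ta; have tV := rcV (lt0r_neq0 t0).
have sg : sa (a * a - rc t) by apply: saB; [exact: saM|exact: sa_rc].
have [h|h] := pselect (adjoined sos (a * a - rc t) (-1)); last first.
  have [PQ _ Qg] := adjoinedP sos_preordering sg h.
  have [Q mQ sub] := exists_maximal PQ.
  have [chi cchi pos] := maximal_character mQ; exists chi => //.
  have := pos _ (sub _ Qg); case: cchi => cD _ c1 cZ _.
  rewrite -rcN [chi _]cD.
  by rewrite [X in _ + X]cZ c1 mulr1 raddfD/= subr_ge0.
exfalso; have [s [u [ss su e]]] := h.
pose c := a * a; pose q := t^-1; have q0 : 0 <= q by rewrite invr_ge0 ltW.
have sc : sos c by exact: sos_sqr.
have sq : sos (rc q) by exact: sos_rc.
have uE : u = rc q + rc q * s + rc q * u * c.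
  transitivity (rc q * (rc t * u)).
    by rewrite mulrA -rcM mulVf ?rc1 ?mul1r// gt_eqF.
  transitivity (rc q * (1 + s + u * c)); last by ring.
  congr (_ * _); transitivity (1 + (-1) + rc t * u); first by ring.
  by rewrite {1}e /c; ring.
have key n : exists2 y, sos y & u = rc (q ^+ n.+1) * c ^+ n + y.
  elim: n => [|n [y sy IH]].
    exists (rc q * s + rc q * u * c); last by rewrite expr1 expr0 mulr1 addrA -uE.
    by apply: sosD; [exact: sosM|apply: sosM => //; exact: sosM].
  exists (rc q + rc q * s + rc q * c * y).
    apply: sosD; first by apply: sosD => //; exact: sosM.
    by apply: sosM => //; exact: sosM.
  transitivity (rc q + rc q * s + rc q * (rc (q ^+ n.+1) * c ^+ n + y) * c).
    by rewrite -IH.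
  by rewrite (exprS q n.+1) (exprS c) [rc (q * _)]rcM; ring.
have bd n : q ^+ n.+1 * nrm (c ^+ n) <= nrm u.
  have [y sy ->] := key n.
  rewrite -[X in X * _]ger0_norm ?exprn_ge0// -nrm_rcM; apply: sos_mono => //.
  apply: sosM; first by apply: sos_rc; rewrite exprn_ge0.
  elim: n {y sy} => [|n IH]; last by rewrite exprS; exact: sosM.
  by rewrite expr0 -rc1; exact: sos_rc.
have qc1 : 1 < q * nrm c.
  by rewrite /q mulrC ltr_pdivlMr// mul1r nrm_sa.
have [k] := bernoulli_unbounded (nrm u / q) qc1.
apply/negP; rewrite -leNgt ler_pdivlMr ?invr_gt0//.
have := bd (2 ^ k)%N; rewrite nrm_pow2; last exact: saM.
by rewrite exprS exprMn => h1; rewrite mulrC mulrA.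
Qed.

Lemma character_attains x (e : R) : 0 < e ->
  exists2 chi, @is_character R A chi & nrm x - e <= Normc.normc (chi x).
Proof.
move=> e0; have [x0|x0] := leP (nrm x - e) 0.
  have [Q mQ _] := exists_maximal sos_preordering.
  have [chi cchi _] := maximal_character mQ; exists chi => //.
  by apply: le_trans x0 _; exact: normc_ge0.
set r := nrm x - e in x0 *.
have rx : r < nrm x by rewrite /r ltrBlDr ltrDl.
pose a := st x * x.
have sxx : sa a by rewrite /sa /a stM stK mulrC.
(* The square of the self-adjoint element [a] has the fourth power of the modulus of [chi x] as its
   value; hence the fourth power of [r]. *)
have ta : (r ^+ 2) ^+ 2 < nrm a ^+ 2.
  by rewrite ltr_pXn2r ?nnegrE ?exprn_ge0 ?nrm_ge0 ?ltW// /a nrm_sq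
     ltr_pXn2r ?nnegrE ?nrm_ge0// ltW.
have t0 : 0 < (r ^+ 2) ^+ 2 by rewrite !exprn_gt0.
have [chi cchi h] := character_sqr_ge sxx t0 ta; exists chi => //.
have E : chi a = (Normc.normc (chi x) ^+ 2)%:C.
  rewrite [LHS](charM cchi) [X in X * _](charJ cchi) mulrC -sqr_normc rmorphXn.
  by case: (chi x).
move: h; rewrite [chi _](charM cchi) E -rmorphM/= -expr2.
by rewrite !ler_pXn2r ?nnegrE ?exprn_ge0 ?normc_ge0// ltW.
Qed.

Lemma char_rc chi r : @is_character R A chi -> chi (rc r) = r%:C.
Proof. by case=> _ _ c1 cZ _; rewrite [LHS]cZ c1 mulr1. Qed.

Lemma char_sa chi x : @is_character R A chi -> sa x ->
  chi x = (complex.Re (chi x))%:C.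
Proof.
move=> cchi sx; have := charJ cchi x; rewrite -[cstar x]/(st x) sx.
by case: (chi x) => p q [] /eqP; rewrite -subr_eq0 opprK -mulr2n mulrn_eq0 => /eqP ->.
Qed.

Lemma sign_dichotomy y (k : R) : is_projectionless A -> sa y -> 0 < k ->
  (forall chi, @is_character R A chi -> k <= `|complex.Re (chi y)|) ->
  (forall chi, @is_character R A chi -> 0 < complex.Re (chi y)) \/
  (forall chi, @is_character R A chi -> complex.Re (chi y) < 0).
Proof.
move=> noproj sy k0 ky; pose M := nrm y + 1.
have M0 : 0 < M by rewrite ltr_wpDl ?nrm_ge0.
(* Newton's iteration s (3 - s^2) / 2 for the sign of [y]; its limit [s]
   satisfies s^2 = 1, so that (1 + s) / 2 is a projection. *)
pose s := fix s n : B := if n is n.+1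
  then hf * (s n * (1 + 1 + (1 - s n * s n))) else rc M^-1 * y.
pose q n := 1 - s n * s n.
have sS n : s n.+1 = hf * (s n * (1 + 1 + q n)) by [].
have ss n : sa (s n).
  elim: n => [|n IH]; first exact: saM (sa_rc _) sy.
  rewrite sS; apply: saM; first exact: sa_rc.
  apply: saM => //; apply: saD; first exact: saD sa1 sa1.
  by apply: saB; [exact: sa1|exact: saM].
have sq n : sa (q n) by apply: saB; [exact: sa1|exact: saM].
pose r := Num.max 0 (1 - k ^+ 2 / M ^+ 2).
have r0 : 0 <= r by rewrite le_max lexx.
have r1 : r < 1 by rewrite gt_max ltr01 gtrDl oppr_lt0 divr_gt0 ?exprn_gt0.
(* Characters attain the norm, and at each of them [q 0] is [1 - chi(y)^2 / M^2], which lies between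
   0 and [1 - k^2 / M^2]. *)
have q0 : nrm (q 0%N) <= r.
  apply/ler_addgt0Pr => e e0; rewrite -lerBlDr.
  have [chi cchi h] := character_attains (q 0%N) e0; apply: le_trans h _.
  have -> : chi (q 0%N) = (1 - complex.Re (chi y) ^+ 2 / M ^+ 2)%:C.
    rewrite /q /= [LHS](charD cchi) (char1 cchi) -[X in chi X]scaleN1r.
    rewrite (charZ cchi) (charM cchi) (charM cchi) (char_rc _ cchi).
    rewrite (char_sa cchi sy) mulN1r -!rmorphM -[1]/(1%:C) -rmorphB/=; congr (_%:C).
    by field; rewrite gt_eqF.
  rewrite normc_real le_max; apply/orP; right.
  have h1 := ky _ cchi.
  have h2 : `|complex.Re (chi y)| <= M.
    have := character_le y cchi; rewrite {1}(char_sa cchi sy) normc_real.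
    by move=> /le_trans; apply; rewrite lerDl.
  have h3 : complex.Re (chi y) ^+ 2 / M ^+ 2 <= 1.
    by rewrite ler_pdivrMr ?exprn_gt0// mul1r -real_normK ?num_real// ler_pXn2r
       ?nnegrE// ltW.
  rewrite ger0_norm ?subr_ge0// lerD2l lerN2 ler_pM2r ?invr_gt0 ?exprn_gt0//.
  by rewrite -[leRHS]real_normK ?num_real// ler_pXn2r ?nnegrE// ltW.
(* The error of the iteration satisfies [q' = q^2 (3 + q) / 4], so it decreases geometrically from
   any start below 1. *)
have qS n : q n.+1 = hf * (hf * (q n * q n * (1 + 1 + 1 + q n))).
  have -> : q n.+1 = 1 - hf * hf * ((1 - q n) * (1 + 1 + q n) * (1 + 1 + q n)).
    by rewrite {1}/q sS {3}/q; ring.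
  transitivity ((hf + hf) * (hf + hf) - hf * hf *
    ((1 - q n) * (1 + 1 + q n) * (1 + 1 + q n))); first by rewrite hfE mulr1.
  by ring.
have nq n : nrm (q n) <= r ^+ n.+1.
  elim: n => [|n IH]; first by rewrite expr1.
  have qr : nrm (q n) <= r.
    by apply: le_trans IH _; rewrite exprS ler_piMr// exprn_ile1// ltW.
  rewrite qS !nrm_hf exprS.
  have h1 := nrmM (q n * q n) (1 + 1 + 1 + q n).
  have h2 := nrmM (q n) (q n).
  have h3 : nrm (1 + 1 + 1 + q n) <= 4.
    have := nrmD (1 + 1 + 1) (q n); have := nrmD (1 + 1) 1.
    by have := nrmD 1 1; have := nrm1; lra.
  have h4 : nrm (q n) * nrm (q n) <= r * r ^+ n.+1 by rewrite ler_pM ?nrm_ge0.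
  have h5 := ler_pM (nrm_ge0 _) (nrm_ge0 _) (le_trans h2 h4) h3.
  have := le_trans h1 h5; lra.
have qle n : nrm (q n) <= 1.
  by apply: le_trans (nq n) _; rewrite exprn_ile1// ltW.
have ns n : nrm (s n) <= 2.
  rewrite -(@ler_pXn2r _ 2) ?nnegrE ?nrm_ge0// -nrm_sa//.
  have -> : s n * s n = 1 - q n by rewrite /q; ring.
  by have := nrmB 1 (q n); have := qle n; have := nrm1; rewrite expr2; lra.
have ds n : nrm (s n.+1 - s n) <= 1 * r ^+ n.
  have -> : s n.+1 - s n = hf * (s n * q n).
    transitivity (s n.+1 - (hf + hf) * s n); first by rewrite hfE mul1r.
    by rewrite sS; ring.
  rewrite nrm_hf mul1r; have h1 := nrmM (s n) (q n).
  have h2 := ler_pM (nrm_ge0 _) (nrm_ge0 _) (ns n) (nq n).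
  have h3 : r ^+ n.+1 <= r ^+ n by rewrite exprS ler_piMl ?exprn_ge0// ltW.
  have := le_trans h1 h2; lra.
have [l hl] := geo_cvg r0 r1 ds.
have sl : sa l := sa_lim ss hl.
have ll : l * l = 1.
  apply/eqP; rewrite -subr_eq0; apply/eqP.
  apply: (@nrm_small _ (1 + (2 + nrm l))) => e e0.
  have [N HN] := hl e e0; have [N' HN'] := expr_small r0 r1 e0.
  pose n := maxn N N'; have h1 := HN n (leq_maxl _ _).
  have h2 : nrm (q n) <= e.
    by apply: le_trans (nq n) _; apply/ltW/HN'; rewrite (leq_trans (leq_maxr N N')).
  have -> : l * l - 1 = - (s n - l) * (s n + l) - q n by rewrite /q; ring.
  have h3 := nrmB (- (s n - l) * (s n + l)) (q n).
  have h4 := nrmM (- (s n - l)) (s n + l); rewrite nrmN in h4.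
  have h5 : nrm (s n - l) * nrm (s n + l) <= e * (2 + nrm l).
    apply: ler_pM; rewrite ?nrm_ge0 ?(ltW h1)//.
    by apply: le_trans (nrmD _ _) _; rewrite lerD2r.
  have h6 : e * (2 + nrm l) = (2 + nrm l) * e by rewrite mulrC.
  lra.
(* Each iteration multiplies by [(2 + q) / 2], positive at every character, so the sign at [chi]
   remains that of [y]. In the limit it is read off from [l], which is 1 or -1 because its
   projection is trivial. *)
have sgn n chi : @is_character R A chi ->
    0 < complex.Re (chi (s n)) * complex.Re (chi y).
  move=> cchi; elim: n => [|n IH].
    rewrite /= (charM cchi) (char_rc _ cchi) (char_sa cchi sy) -rmorphM/=.
    rewrite -mulrA mulr_gt0 ?invr_gt0// -expr2 lt_neqAle sqr_ge0 andbT eq_sym sqrf_eq0.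
    by have := lt_le_trans k0 (ky _ cchi); rewrite normr_gt0.
  rewrite sS.
  have -> : chi (hf * (s n * (1 + 1 + q n))) = (2^-1 * (complex.Re (chi (s n)) *
      (2 + complex.Re (chi (q n)))))%:C.
    rewrite [LHS](charM cchi) [X in _ * X](charM cchi) (char_rc _ cchi).
    rewrite [X in _ * (_ * X)](charD cchi) [X in _ * (_ * (X + _))](charD cchi).
    rewrite !(char1 cchi) {1}(char_sa cchi (ss n)) {1}(char_sa cchi (sq n)).
    by rewrite -(rmorph1 (real_complex R)) -!rmorphD -!rmorphM.
  rewrite /= -!mulrA mulr_gt0 ?invr_gt0// mulrCA mulr_gt0//.
  have := le_trans (character_le (q n) cchi) (qle n).
  rewrite (char_sa cchi (sq n)) normc_real ler_norml => /andP[h _]; lra.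
pose p : B := hf * (1 + l).
have pp : p * p = p.
  rewrite /p; transitivity (hf * hf * (1 + l + l + l * l)); first by ring.
  by rewrite ll; transitivity ((hf + hf) * hf * (1 + l)); [ring|rewrite hfE mul1r].
have sp : cstar (p : A) = p.
  by apply: (@saM hf (1 + l)); [exact: sa_rc|exact: saD sa1 sl].
have lp : l = p + p - 1.
  by rewrite /p; transitivity ((hf + hf) * (1 + l) - 1); [rewrite hfE; ring|ring].
have near chi : @is_character R A chi -> exists n,
    `|complex.Re (chi (s n)) - complex.Re (chi l)| < 1.
  move=> cchi; have [N HN] := hl 1 ltr01; exists N.
  have := le_lt_trans (character_le (s N - l) cchi) (HN N (leqnn _)).
  rewrite (char_sa cchi (saB (ss N) sl)) normc_real.
  by rewrite [X in complex.Re X](charB (s N : A) l cchi) raddfB.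
have [p0|p1] := noproj p sp pp.
- right => chi cchi; have [n] := near chi cchi; have := sgn n chi cchi.
  have -> : l = rc (-1) by rewrite lp [p]p0 rcN rc1; ring.
  rewrite (char_rc _ cchi)/=.
  rewrite opprK => h1; rewrite ltr_norml => /andP[_ h2].
  have h3 : complex.Re (chi (s n)) < 0 by lra.
  by move: h1; rewrite nmulr_rgt0.
left => chi cchi; have [n] := near chi cchi; have := sgn n chi cchi.
have -> : l = rc 1 by rewrite lp [p]p1 rc1; ring.
rewrite (char_rc _ cchi)/= => h1; rewrite ltr_norml => /andP[h2 _].
have h3 : 0 < complex.Re (chi (s n)) by lra.
by move: h1; rewrite pmulr_rgt0.
Qed.

(** * Finite nets and walks of characters *)

Lemma grid (M h : R) : 0 < h -> exists K, exists g : R -> 'I_K.+1,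
  forall t t', `|t| <= M -> `|t'| <= M -> g t = g t' -> `|t - t'| < h.
Proof.
move=> h0; exists (Num.truncn ((M + M) / h)).
exists (fun t => inord (Num.truncn ((t + M) / h))) => t t' ht ht' /(congr1 val).
have tr u : `|u| <= M -> 0 <= (u + M) / h /\
    (Num.truncn ((u + M) / h) < (Num.truncn ((M + M) / h)).+1)%N.
  rewrite ler_norml => /andP[u1 u2]; split.
    by rewrite divr_ge0 ?(ltW h0)//; lra.
  by rewrite ltnS; apply: le_truncn; rewrite ler_pM2r ?invr_gt0// lerD2r.
have [t0 tK] := tr _ ht; have [t0' tK'] := tr _ ht'.
rewrite /= !inordK// => E.
have := truncn_itv t0; have := truncn_itv t0'; rewrite E => /andP[h1 h2] /andP[h3 h4].
set T := Num.truncn _ in h1 h2 h3 h4; move: h1 h2 h3 h4.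
rewrite !ler_pdivlMr// !ltr_pdivrMr// -natr1 mulrDl mul1r ltr_norml => *; lra.
Qed.

(** The squared Euclidean distance, because for a fixed [g] it is the value at a character [f] of an
    element of the algebra, the sum of the [st (a i - g (a i)) * (a i - g (a i))]. The price is a
    factor 2 in the triangle inequality. *)
Definition char_dist n (a : 'I_n -> A) (f g : A -> R[i]) : R :=
  \sum_i Normc.normc (f (a i) - g (a i)) ^+ 2.

Lemma char_distC n (a : 'I_n -> A) f g : char_dist a f g = char_dist a g f.
Proof. by apply: eq_bigr => i _; rewrite -normcN opprB. Qed.

Lemma char_dist_tri n (a : 'I_n -> A) f g h :
  char_dist a f h <= 2 * char_dist a f g + 2 * char_dist a g h.
Proof.
rewrite !mulr_sumr -big_split/=; apply: ler_sum => i _.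
have -> : f (a i) - h (a i) = (f (a i) - g (a i)) + (g (a i) - h (a i)).
  by rewrite addrA subrK.
set u := f _ - g _; set v := g _ - h _.
have := le_normcD u v; have := normc_ge0 u; have := normc_ge0 v.
have := normc_ge0 (u + v).
move: (Normc.normc u) (Normc.normc v) (Normc.normc (u + v)) => p q w w0 q0 p0 le.
apply: (@le_trans _ _ ((p + q) ^+ 2)); first by rewrite ler_pXn2r ?nnegrE ?addr_ge0.
by have := sqr_ge0 (p - q); nra.
Qed.

(** Characters are sorted by the grid cells of their values at the [a i], and one representative is
    kept for each combination of cells that occurs. *)
Lemma finite_net n (a : 'I_n -> A) (r : R) : 0 < r ->
  exists (T : finType) (rep : T -> A -> R[i]) (code : (A -> R[i]) -> T),
    (forall t, is_character (rep t)) /\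
    (forall chi, is_character chi -> char_dist a chi (rep (code chi)) <= r).
Proof.
move=> r0; pose M := \sum_i nrm (a i).
have aM i : nrm (a i) <= M.
  by rewrite /M (bigD1 i)//= lerDl sumr_ge0// => *; exact: nrm_ge0.
(* Each index contributes [h ^+ 2] for the real and for the imaginary part, together [r / n.+1]; the
   successor covers [n = 0]. *)
pose h := Num.sqrt (r / (2 * n.+1%:R)).
have h0 : 0 < h by rewrite sqrtr_gt0 divr_gt0// mulr_gt0.
have [K [g hg]] := grid M h0.
pose T : finType := {ffun 'I_n -> 'I_K.+1 * 'I_K.+1}.
pose code (chi : A -> R[i]) : T :=
  [ffun i => (g (complex.Re (chi (a i))), g (complex.Im (chi (a i))))].
have [chi0 cchi0 _] := character_attains 1 ltr01.
have /choice[rep hrep] : forall t : T, exists chi, @is_character R A chi /\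
    ((exists2 chi', @is_character R A chi' & code chi' = t) -> code chi = t).
  move=> t; have [[chi c1 c2]|h'] := pselect (exists2 chi', @is_character R A chi' & code chi' = t).
    by exists chi.
  by exists chi0; split=> // /h'.
exists T, rep, code; split; first by move=> t; exact: (hrep t).1.
move=> chi cchi; have [crep hcode] := hrep (code chi).
have {}hcode : code (rep (code chi)) = code chi by apply: hcode; exists chi.
move: (rep _) crep hcode => psi cpsi E.
apply: (@le_trans _ _ (\sum_(i < n) r / n.+1%:R)); last first.
  rewrite sumr_const card_ord -[leLHS]mulr_natr mulrAC ler_pdivrMr//.
  by rewrite ler_wpM2l ?(ltW r0)// ler_nat.
apply: ler_sum => i _.
have := congr1 (fun f : T => f i) E; rewrite !ffunE => -[E1 E2].
have bd f : @is_character R A f -> `|complex.Re (f (a i))| <= M /\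
    `|complex.Im (f (a i))| <= M.
  move=> cf; have := le_trans (character_le (a i) cf) (aM i).
  case: (f (a i)) => p q /= pq; split; apply: le_trans pq;
    by rewrite -sqrtr_sqr ler_wsqrtr// ?lerDl ?lerDr sqr_ge0.
have [b1 b2] := bd _ cchi; have [b3 b4] := bd _ cpsi.
have := hg _ _ b1 b3 (esym E1); have := hg _ _ b2 b4 (esym E2).
case: (chi (a i)) => p q; case: (psi (a i)) => p' q' /= hq hp.
rewrite sqr_sqrtr ?addr_ge0 ?sqr_ge0//.
have -> : r / n.+1%:R = h ^+ 2 + h ^+ 2.
  rewrite sqr_sqrtr; last by rewrite divr_ge0 ?ltW// mulr_gt0.
  have : (n.+1%:R : R) != 0 by rewrite pnatr_eq0.
  by move: (n.+1%:R : R) => m m0; field.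
by apply: lerD; rewrite -[leLHS]real_normK ?num_real// ler_pXn2r ?nnegrE ?(ltW h0) ?(ltW hp) ?(ltW hq).
Qed.

Section Walk.
Hypothesis noproj : is_projectionless A.
Variables (n : nat) (a : 'I_n -> A) (r : R) (r0 : 0 < r).
Variables (T : finType) (rep : T -> A -> R[i]).
Hypothesis crep : forall t, is_character (rep t).
Hypothesis net : forall chi, is_character chi ->
  exists t, char_dist a chi (rep t) <= r.

(** With the constant 10, a character within [r] of one end of a missing edge is at distance
    [D >= 4 * r] from the other end: the triangle inequality gives [10 r < 2 D + 2 r]. *)
Let edge (t t' : T) : bool := char_dist a (rep t) (rep t') <= 10 * r.

(** Otherwise some self-adjoint element is bounded away from 0 at all characters, yet positive at
    [rep t0] and negative at [rep t1], against [sign_dichotomy]. *)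
Lemma net_connected t0 t1 : connect edge t0 t1.
Proof.
apply/negPn/negP => nc.
pose N1 := [set t | connect edge t0 t]%SET.
pose b := \sum_i (2 * nrm (a i)) ^+ 2 + 4 * r + 1.
have b0 : 0 < b.
  by rewrite ltr_wpDl// addr_ge0 ?mulr_ge0 ?(ltW r0)// sumr_ge0// => i _; exact: sqr_ge0.
have db f g : @is_character R A f -> @is_character R A g -> char_dist a f g <= b.
  move=> cf cg; rewrite /b -addrA ler_wpDr ?addr_ge0 ?mulr_ge0 ?(ltW r0)//.
  apply: ler_sum => i _; rewrite ler_pXn2r ?nnegrE ?normc_ge0 ?mulr_ge0 ?nrm_ge0//.
  apply: le_trans (le_normcD _ _) _; rewrite normcN.
  by have := character_le (a i) cf; have := character_le (a i) cg; lra.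
pose dB t : B := \sum_i (st (a i - (rep t (a i))%:A) * (a i - (rep t (a i))%:A)).
have chi_sum chi m (F : 'I_m -> B) : @is_character R A chi ->
    chi (\sum_i F i) = \sum_i chi (F i).
  move=> cchi; elim: m F => [|m IH] F.
    by rewrite !big_ord0 -[X in chi X](scale0r (1 : A)) (charZ cchi) mul0r.
  by rewrite !big_ord_recl [LHS](charD cchi) IH.
have sdB t : sa (dB t).
  rewrite /dB; apply: big_ind => //; first exact: sa0.
    by move=> x y; exact: saD.
  by move=> i _; rewrite /sa stM stK mulrC.
have chi_dB chi t : @is_character R A chi -> chi (dB t) = (char_dist a chi (rep t))%:C.
  move=> cchi; rewrite /dB chi_sum// /char_dist rmorph_sum/=; apply: eq_bigr => i _.
  rewrite [LHS](charM cchi) [X in X * _](charJ cchi).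
  have -> : chi (a i - (rep t (a i))%:A) = chi (a i) - rep t (a i).
    by rewrite [LHS](charD cchi) -scaleN1r scalerA [X in _ + X](charZ cchi)
      (char1 cchi) mulr1 mulN1r.
  rewrite mulrC -sqr_normc rmorphXn.
  by case: (_ - _).
(* The bump [1 - dist / b] is at least [al] within distance [r], and at most [be < al] from distance
   [4 * r] on. The power [N] makes even [#|T|] far bumps negligible against a near one. *)
pose al := 1 - r / b; pose be := 1 - 4 * r / b.
have b4r : 4 * r < b.
  rewrite /b -addrA ltr_wpDl ?ltrDl// sumr_ge0// => i _; exact: sqr_ge0.
have be0 : 0 <= be by rewrite /be subr_ge0 ler_pdivrMr// mul1r ltW.
have beal : be < al by rewrite /be /al ltrD2l ltrN2 ltr_pM2r ?invr_gt0// ltr_pMl ?ltr1n.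
have al0 : 0 < al by apply: le_lt_trans beal.
have [N HN] : exists N, #|T|%:R * be ^+ N < al ^+ N / 4.
  have q0 : 0 <= be / al by rewrite divr_ge0// ltW.
  have q1 : be / al < 1 by rewrite ltr_pdivrMr// mul1r.
  have e0 : 0 < (4 * (#|T|%:R + 1))^-1 :> R by rewrite invr_gt0 mulr_gt0// ltr_wpDl.
  have [N HN] := expr_small q0 q1 e0; exists N.
  have := HN N (leqnn _); rewrite expr_div_n ltr_pdivrMr ?exprn_gt0//.
  rewrite mulrC ltr_pdivlMr ?mulr_gt0 ?ltr_wpDl// => h.
  rewrite ltr_pdivlMr//; apply: le_lt_trans h.
  have := exprn_ge0 N be0; set X := be ^+ N; set Y := (#|T|%:R : R) => X0; nra.
(* For [N] large, [y] is positive at the characters near the component [N1] of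
   the graph and negative at those near the other components. *)
pose y := \sum_(t in N1) (1 - rc b^-1 * dB t) ^+ N - rc (al ^+ N / 2).
have sy : sa y.
  apply: saB; last exact: sa_rc.
  apply: big_ind => //; first exact: sa0; first by move=> u v; exact: saD.
  move=> t _; apply: saX; apply: saB; first exact: sa1.
  by apply: saM; [exact: sa_rc|exact: sdB].
pose w chi t := (1 - char_dist a chi (rep t) / b) ^+ N.
have chi_y chi : @is_character R A chi ->
    complex.Re (chi y) = \sum_(t in N1) w chi t - al ^+ N / 2.
  move=> cchi.
  have chiX (x : B) m : chi (x ^+ m) = chi x ^+ m.
    elim: m => [|m IH]; first by rewrite !expr0 (char1 cchi).
    by rewrite !exprS [LHS](charM cchi) IH.
  rewrite /y -rcN [X in complex.Re X](charD cchi) (char_rc _ cchi) raddfD/=.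
  congr (_ - _).
  rewrite big_mkcond/= [RHS]big_mkcond/=.
  elim: (index_enum T) => [|t s IH].
    by rewrite !big_nil -[X in chi X](scale0r (1 : A)) (charZ cchi) mul0r.
  rewrite !big_cons [X in complex.Re X](charD cchi) raddfD/= IH; congr (_ + _).
  case: ifP => _; last by rewrite -[X in chi X](scale0r (1 : A)) (charZ cchi) mul0r.
  rewrite chiX [X in X ^+ N](charD cchi) (char1 cchi) -[X in 1 + chi X]scaleN1r.
  rewrite [X in 1 + X](charZ cchi) [X in -1 * X](charM cchi) (char_rc _ cchi) chi_dB//.
  by rewrite mulN1r -rmorphM -[1]/(1%:C) -rmorphB -rmorphXn/= mulrC.
have w0 chi t : @is_character R A chi -> 0 <= 1 - char_dist a chi (rep t) / b.
  by move=> cchi; rewrite subr_ge0 ler_pdivrMr// mul1r; exact: db.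
have hi chi t : @is_character R A chi -> t \in N1 -> char_dist a chi (rep t) <= r ->
    al ^+ N / 2 <= complex.Re (chi y).
  move=> cchi tN dr; rewrite chi_y// (bigD1 t)//=.
  have h1 : al ^+ N <= w chi t.
    apply: lerXn2r; rewrite ?nnegrE ?(ltW al0) ?w0// lerD2l lerN2.
    by rewrite ler_pM2r ?invr_gt0.
  have h2 : 0 <= \sum_(i in N1 | i != t) w chi i.
    by apply: sumr_ge0 => i _; rewrite exprn_ge0 ?w0.
  lra.
have lo chi : @is_character R A chi ->
    (forall t, t \in N1 -> 4 * r <= char_dist a chi (rep t)) ->
    complex.Re (chi y) <= - (al ^+ N / 4).
  move=> cchi far; rewrite chi_y//.
  have h1 : \sum_(t in N1) w chi t <= #|T|%:R * be ^+ N.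
    apply: (@le_trans _ _ (\sum_(t in N1) be ^+ N)).
      apply: ler_sum => t tN; apply: lerXn2r; rewrite ?nnegrE ?w0// lerD2l lerN2.
      by rewrite ler_pM2r ?invr_gt0// far.
    rewrite sumr_const -[leLHS]mulr_natl ler_wpM2r ?exprn_ge0// ler_nat; exact: max_card.
  lra.
have alN : 0 < al ^+ N by rewrite exprn_gt0.
have far t : t \notin N1 -> forall chi, @is_character R A chi ->
    char_dist a chi (rep t) <= r -> forall t', t' \in N1 ->
    4 * r <= char_dist a chi (rep t').
  rewrite inE => nt chi cchi dr t'; rewrite inE => ct'.
  have : ~~ edge t' t by apply: contra nt => /connect1; exact: connect_trans.
  rewrite /edge -ltNge => h.
  have := char_dist_tri a (rep t') chi (rep t); rewrite (char_distC a (rep t') chi).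
  lra.
have k0 : 0 < al ^+ N / 4 by rewrite divr_gt0.
have [| |] := sign_dichotomy noproj sy k0.
- move=> chi cchi; have [t dt] := net cchi.
  have [tN|tN] := boolP (t \in N1).
    by have := hi chi t cchi tN dt; rewrite ler_normr => h; apply/orP; left; lra.
  have := lo chi cchi (far t tN chi cchi dt).
  by rewrite ler_normr => h; apply/orP; right; lra.
- have t1N : t1 \notin N1 by rewrite inE.
  have d0 : char_dist a (rep t1) (rep t1) <= r.
    rewrite /char_dist big1 ?(ltW r0)// => i _.
    by rewrite subrr Normc.normc0 expr0n.
  move=> /(_ _ (crep t1)); have := lo _ (crep t1) (far t1 t1N _ (crep t1) d0); lra.
- have t0N : t0 \in N1 by rewrite inE connect0.
  have d0 : char_dist a (rep t0) (rep t0) <= r.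
    rewrite /char_dist big1 ?(ltW r0)// => i _.
    by rewrite subrr Normc.normc0 expr0n.
  move=> /(_ _ (crep t0)); have := hi _ _ (crep t0) t0N d0; lra.
Qed.

Lemma covering_path t0 : exists2 s, path edge t0 s & forall t, t \in t0 :: s.
Proof.
suff [s ps hs] : exists2 s, path edge t0 s & forall t, t \in enum T -> t \in t0 :: s.
  by exists s => // t; apply: hs; rewrite mem_enum.
elim: (enum T) => [|t l [s ps hs]]; first by exists [::].
have /connectP[p pp tE] := net_connected (last t0 s) t.
exists (s ++ p); first by rewrite cat_path ps.
move=> t'; rewrite inE => /predU1P[->|/hs].
  by rewrite tE -last_cat mem_last.
by rewrite !inE mem_cat => /orP[->//|->]; rewrite orbT.
Qed.
End Walk.

Lemma character_walk n (a : 'I_n -> A) (d : R) : is_projectionless A -> 0 < d ->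
  exists L (c : nat -> A -> R[i]), [/\ forall j, is_character (c j),
    forall i j, (j < L)%N -> Normc.normc (c j (a i) - c j.+1 (a i)) <= d &
    forall chi, is_character chi -> exists2 j, (j <= L)%N &
      forall i, Normc.normc (chi (a i) - c j (a i)) <= d].
Proof.
(* An edge then means squared distance at most [d ^+ 2], hence at most [d] in each coordinate. *)
move=> noproj d0; pose r := d ^+ 2 / 10.
have r0 : 0 < r by rewrite divr_gt0 ?exprn_gt0.
have dist_le f g : char_dist a f g <= d ^+ 2 -> forall i, Normc.normc (f (a i) - g (a i)) <= d.
  move=> h i; rewrite -(@ler_pXn2r _ 2) ?nnegrE ?normc_ge0 ?(ltW d0)//.
  apply: le_trans h; rewrite /char_dist (bigD1 i)//= lerDl sumr_ge0// => *.
  exact: sqr_ge0.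
have [T [rep [code [crep hcode]]]] := finite_net a r0.
have net chi : is_character chi -> exists t, char_dist a chi (rep t) <= r.
  by move=> cchi; exists (code chi); exact: hcode.
have [chi0 cchi0 _] := character_attains 1 ltr01.
have [s ps hs] := covering_path noproj r0 crep net (code chi0).
set t0 := code chi0 in ps hs.
exists (size s), (fun j => rep (nth t0 (t0 :: s) j)); split=> //.
- move=> i j js; apply: dist_le.
  have := (pathP t0 ps) j js; rewrite /r mulrC divfK ?pnatr_eq0//.
- move=> chi cchi; have [t dt] := net chi cchi.
  exists (index t (t0 :: s)); first by rewrite -ltnS -[(size s).+1]/(size (t0 :: s)) index_mem.
  apply: dist_le; rewrite nth_index//; apply: le_trans dt _.
  by rewrite /r ler_pdivrMr// ler_peMr ?exprn_ge0 ?(ltW d0)// ler1n.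
Qed.
End Gelfand.

(** * Lifting along hereditarily indecomposable continua *)

Section Clamp.
Variable R : realType.
Implicit Types a b t : R.

Definition clamp a b t : R := Num.max a (Num.min b t).

Lemma clamp_bounds a b t : a <= b -> a <= clamp a b t <= b.
Proof. by move=> ab; rewrite /clamp le_max lexx/= ge_max ab ge_min lexx. Qed.

Lemma clamp_id a b t : a <= t -> t <= b -> clamp a b t = t.
Proof. by move=> at_ tb; rewrite /clamp min_r// max_r. Qed.

Lemma clamp_low a b t : a <= b -> t <= a -> clamp a b t = a.
Proof. by move=> ab ta; rewrite /clamp min_r ?(le_trans ta ab)// max_l. Qed.

Lemma clamp_high a b t : a <= b -> b <= t -> clamp a b t = b.
Proof. by move=> ab bt; rewrite /clamp min_l// max_r. Qed.

Lemma clamp_nonexpansive a b s t : a <= b ->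
  `|clamp a b s - clamp a b t| <= `|s - t|.
Proof.
move=> ab; wlog st : s t / s <= t.
  by move=> H; have [/H//|/ltW/H] := leP s t; rewrite distrC [X in _ <= X]distrC.
have mono : clamp a b s <= clamp a b t.
  by rewrite /clamp ge_max !le_max lexx/= le_min !ge_min lexx st/= !orbT.
rewrite distrC ger0_norm ?subr_ge0// distrC ger0_norm ?subr_ge0//.
have [sa|sa] := leP s a; have [tb|tb] := leP b t.
- by rewrite (clamp_low ab sa) (clamp_high ab tb); lra.
- have [ta|ta] := leP t a; first by rewrite !clamp_low//; lra.
  by rewrite (clamp_low ab sa) (clamp_id (ltW ta) (ltW tb)); lra.
- have [sb|sb] := leP b s; first by rewrite !clamp_high//; lra.
  by rewrite (clamp_high ab tb) (clamp_id (ltW sa) (ltW sb)); lra.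
- by rewrite !clamp_id; lra.
Qed.

Lemma continuous_clamp (X : topologicalType) a b (u : X -> R) :
  continuous u -> continuous (fun x => clamp a b (u x)).
Proof.
move=> cu x.
apply: (@continuous_max R X (fun=> a) (fun y => Num.min b (u y))).
  exact: cvg_cst.
by apply: (@continuous_min R X (fun=> b) u) => //; [exact: cvg_cst|exact: cu].
Qed.

(** Linear interpolation of [z j] at [j], written as a sum of clamped ramps: continuity follows by
    induction, and the function is a limit of terms as soon as [clamp] is. *)
Definition pl (z : nat -> R) (L : nat) (t : R) : R :=
  z 0%N + \sum_(j < L) clamp 0 1 (t - j%:R) * (z j.+1 - z j).

Lemma pl_continuous z L : continuous (pl z L).
Proof.
elim: L => [|L IH].
  rewrite (_ : pl z 0 = fun=> z 0%N); first by move=> t; exact: cvg_cst.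
  by apply/funext => t; rewrite /pl big_ord0 addr0.
rewrite (_ : pl z L.+1 = fun t => pl z L t + clamp 0 1 (t - L%:R) * (z L.+1 - z L)).
  move=> t; apply: cvgD; first exact: IH.
  apply: cvgM; last exact: cvg_cst.
  apply: (@continuous_clamp R 0 1 (fun s : R => s - L%:R)) => s.
  by apply: cvgB; [exact: cvg_id|exact: cvg_cst].
by apply/funext => t; rewrite /pl big_ord_recr/= addrA.
Qed.

Lemma plS z L t : pl z L.+1 t = pl z L t + clamp 0 1 (t - L%:R) * (z L.+1 - z L).
Proof. by rewrite /pl big_ord_recr/= addrA. Qed.

Lemma pl_high z L t : L%:R <= t -> pl z L t = z L.
Proof.
elim: L => [|L IH] Lt; first by rewrite /pl big_ord0 addr0.
rewrite plS IH; last by apply: le_trans Lt; rewrite ler_nat.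
rewrite clamp_high ?ler01//; first by ring.
by rewrite lerBrDl; move: Lt; rewrite -natr1.
Qed.

Lemma pl_nat z L j : (j <= L)%N -> pl z L j%:R = z j.
Proof.
elim: L => [|L IH]; first by rewrite leqn0 => /eqP ->; rewrite /pl big_ord0 addr0.
rewrite leq_eqVlt => /predU1P[->|]; first by rewrite pl_high.
rewrite ltnS => jL; rewrite plS IH// clamp_low ?ler01 ?mul0r ?addr0//.
by rewrite subr_le0 ler_nat.
Qed.

(** Nodes and weight do not depend on [z], so that several interpolations at the same [t], such as
    real and imaginary parts, are the same convex combination. *)
Lemma plP L t : 0 <= t -> t <= L%:R -> exists j j' (a : R),
  [/\ (j <= L)%N, (j' <= L)%N, (j <= j' <= j.+1)%N, 0 <= a <= 1 &
   [/\ `|t - j%:R| <= 1, `|t - j'%:R| <= 1 &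
     forall z, pl z L t = (1 - a) * z j + a * z j']].
Proof.
elim: L => [|L IH] t0 tL.
  have -> : t = 0 by lra.
  exists 0%N, 0%N, 0; split; rewrite ?lexx ?ler01//.
  split; rewrite ?subrr ?normr0// => z.
  by rewrite /pl big_ord0; ring.
have [tl|tl] := leP t L%:R.
  have [j [j' [a [h1 h2 h3 h4 [h5 h6 h7]]]]] := IH t0 tl.
  exists j, j', a; split=> //; [exact: leqW|exact: leqW|split=> // z].
  by rewrite plS clamp_low ?mul0r ?addr0 ?h7// subr_le0.
move: tL; rewrite -natr1 => tL.
exists L, L.+1, (t - L%:R); split=> //; first by rewrite leqnn leqnSn.
  by apply/andP; split; lra.
split; [by rewrite ler_norml; apply/andP; split; lra|
  by rewrite -natr1 ler_norml; apply/andP; split; lra|move=> z].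
by rewrite plS pl_high ?(ltW tl)// clamp_id//; [ring|lra|lra].
Qed.

Lemma pl_bound z L t (lo hi : R) : (forall j, (j <= L)%N -> lo <= z j <= hi) ->
  0 <= t -> t <= L%:R -> lo <= pl z L t <= hi.
Proof.
move=> H t0 tL; have [j [j' [a [/H/andP[h1 h2] /H/andP[h3 h4] _ /andP[a0 a1] [_ _ ->]]]]] := plP t0 tL.
by apply/andP; split; nra.
Qed.

Lemma uniform_on_segment (f : R -> R) (a b h : R) : continuous f -> 0 < h ->
  exists2 r : R, 0 < r & forall s t, a <= s <= b -> `|s - t| < r -> `|f s - f t| < h.
Proof.
move=> cf h0.
have cK := @segment_compact R a b.
have /compact_near_coveringP/(_ R (0 : R)^'+ (fun r s => forall t, `|s - t| < r -> `|f s - f t| < h)) := cK.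
case.
  move=> s _; have h20 : 0 < h / 2 by rewrite divr_gt0.
  have /cvgrPdist_lt/(_ _ h20)/nbhs_ballP[d /= d0 hd] := cf s.
  have d20 : 0 < d / 2 by rewrite divr_gt0.
  exists (ball s (d / 2), [set r | 0 < r < d / 2]).
    split; first exact: nbhsx_ballx.
    have H : (0 : R)^'+ ([set r | 0 < r] `&` [set r | r < d / 2]).
      by apply: filterI; [exact: nbhs_right_gt|exact: nbhs_right_lt].
    by apply: filterS H => r' [/= -> ->].
  move=> [s' r] [/= bs' /andP[r0 rd]] t str.
  have b1 : ball s d s' by apply: le_ball bs'; lra.
  have b2 : ball s d t.
    rewrite /ball/=; have := ler_distD s' s t; rewrite /ball/= in bs'; lra.
  have := hd _ b1; have := hd _ b2.
  have := ler_distD (f s) (f s') (f t); rewrite (distrC (f s') (f s)); lra.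
move=> r /= r0 H.
have := H (r / 2); rewrite /ball/= sub0r normrN ger0_norm ?divr_ge0 ?(ltW r0)//.
have r2 : r / 2 < r by lra.
move=> /(_ r2 (divr_gt0 r0 (ltr0n _ 2))) hr.
exists (r / 2); first by rewrite divr_gt0.
by move=> s t st; apply: hr; rewrite /= in_itv.
Qed.

End Clamp.

Section Connected.
Variables (R : realType) (X : topologicalType).
Hypothesis conX : connected [set: X].

Lemma connected_ivt (f : X -> R) x y c : continuous f -> f x <= c -> c <= f y ->
  exists z, f z = c.
Proof.
move=> cf fx fy.
have : connected (f @` [set: X]).
  by apply: connected_continuous_connected => //; exact: continuous_subspaceT.
move/connected_intervalP => iv.
have [|||z _ <-] := iv (f x) (f y) _ _ c; [by exists x|by exists y| |by exists z].
by rewrite fx fy.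
Qed.
End Connected.

(** * Quasi-components, folds and zigzags over a compact space *)

Section Compactness.
Variables (R : realType) (X : topologicalType).
Hypothesis cX : compact [set: X].

Lemma compact_directed (I : Type) (D : set I) (S : I -> set X) :
  D !=set0 -> (forall i, D i -> closed (S i)) ->
  (forall i j, D i -> D j -> exists2 k, D k & S k `<=` S i `&` S j) ->
  (forall i, D i -> S i !=set0) -> exists p, forall i, D i -> S i p.
Proof.
move=> [i0 Di0] clS dir ne.
have FF : Filter (filter_from D S).
  by apply: filter_from_filter => //; exists i0.
have PF : ProperFilter (filter_from D S) by exact: filter_from_proper.
have FT : filter_from D S [set: X] by exists i0.
have [p [_ hp]] := cX PF FT; exists p => i Di.
by move: hp; rewrite clusterE => hp; apply: (clS _ Di); apply: hp; exists i.
Qed.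

Lemma compact_directed_sub (I : Type) (D : set I) (S : I -> set X) (W : set X) :
  D !=set0 -> (forall i, D i -> closed (S i)) ->
  (forall i j, D i -> D j -> exists2 k, D k & S k `<=` S i `&` S j) ->
  open W -> (forall p, (forall i, D i -> S i p) -> W p) ->
  exists2 i, D i & S i `<=` W.
Proof.
move=> D0 clS dir oW sub; apply: contrapT => nex.
have [|||p hp] := @compact_directed I D (fun i => S i `\` W) D0.
- move=> i Di; rewrite setDE; apply: closedI; first exact: clS.
  exact: open_closedC.
- move=> i j Di Dj; have [k Dk ks] := dir _ _ Di Dj; exists k => // x [Sx nW].
  by have [? ?] := ks _ Sx.
- move=> i Di; apply/set0P/eqP => e; apply: nex; exists i => // x Sx.
  by apply: contrapT => nW; have : (S i `\` W) x by []; rewrite e.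
- have [i Di] := D0; have [_] := hp _ Di; apply; apply: sub => j Dj.
  by have [] := hp _ Dj.
Qed.

Definition clopen_in (Z S : set X) : Prop :=
  [/\ S `<=` Z, closed S & closed (Z `\` S)].

Lemma clopen_inI Z S T : clopen_in Z S -> clopen_in Z T -> clopen_in Z (S `&` T).
Proof.
move=> [SZ cS cS'] [TZ cT cT']; split; first by move=> x [/SZ].
  exact: closedI.
by rewrite setDIr; exact: closedU.
Qed.

Lemma clopen_inC Z S : clopen_in Z S -> clopen_in Z (Z `\` S).
Proof.
move=> [SZ cS cS']; split=> //.
by rewrite setDD (setIidr SZ).
Qed.

Lemma clopen_in_id Z : closed Z -> clopen_in Z Z.
Proof. by move=> cZ; split=> //; rewrite setDv; exact: closed0. Qed.

Definition quasi_component (Z : set X) (x : X) : set X :=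
  \bigcap_(S in [set S | clopen_in Z S /\ S x]) S.

Hypothesis hX : hausdorff_space X.

Section QuasiComponent.
Variables (Z : set X) (x : X).
Hypotheses (cZ : closed Z) (Zx : Z x).

Lemma quasi_component_id : quasi_component Z x x.
Proof. by move=> S []. Qed.

Lemma quasi_component_sub : quasi_component Z x `<=` Z.
Proof. by move=> y; apply; split=> //; exact: clopen_in_id. Qed.

Lemma quasi_component_closed : closed (quasi_component Z x).
Proof. by apply: closed_bigI => S [[]]. Qed.

Lemma quasi_component_open_nbhs W : open W -> quasi_component Z x `<=` W ->
  exists S, [/\ clopen_in Z S, S x & S `<=` W].
Proof.
move=> oW sub.
have [|||||S [h1 h2] h3] :=
    @compact_directed_sub _ [set S | clopen_in Z S /\ S x] id W.
- by exists Z; split=> //; exact: clopen_in_id.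
- by move=> S [[]].
- move=> S T [cS Sx] [cT Tx]; exists (S `&` T) => //; split=> //.
  exact: clopen_inI.
- by [].
- by move=> p hp; apply: sub => S hS; exact: hp.
by exists S.
Qed.

(** The classical proof that quasi-components of compact Hausdorff spaces are components. The two
    parts of a splitting are enclosed in disjoint open sets [U] and [V]; by compactness some
    relatively clopen [S] around [x] lies in their union, and the trace of [S] on the open set
    containing [x] is again clopen, so it contains the whole quasi-component. *)
Lemma quasi_component_connected : connected (quasi_component Z x).
Proof.
move=> B B0 [C oC BC] [D cD BD].
have clB : closed B by rewrite BD; apply: closedI => //; exact: quasi_component_closed.
pose B' := quasi_component Z x `&` ~` C.
have clB' : closed B'.
  by apply: closedI; [exact: quasi_component_closed|exact: open_closedC].
have BB' : B `&` B' = set0.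
  by rewrite BC -subset0 => y [[_ Cy] [_]].
have cov : quasi_component Z x `<=` B `|` B'.
  by move=> y Qy; have [Cy|Cy] := pselect (C y); [left; rewrite BC|right].
have [U [V [oU oV BU BV UV]]] :=
  (@normal_openP R X).1 (compact_normal hX cX) B B' clB clB' BB'.
have oUV : open (U `|` V) by exact: openU.
have [|S [[SZ cS cS'] Sx SUV]] := quasi_component_open_nbhs oUV.
  by move=> y /cov[/BU ?|/BV ?]; [left|right].
have part P P' : open P -> open P' -> P `&` P' = set0 -> S `<=` P `|` P' ->
    P x -> quasi_component Z x `<=` P.
  move=> oP oP' PP' SPP' Px y Qy.
  have SP : S `&` P = S `\` P'.
    apply/seteqP; split=> z [Sz].
      by move=> Pz; split=> // P'z; have : (P `&` P') z by []; rewrite PP'.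
    by case: (SPP' _ Sz).
  have [] : (S `&` P) y; last by [].
  apply: Qy; split=> //; split; first by move=> z [/SZ].
    by rewrite SP; apply: closedI => //; exact: open_closedC.
  have -> : Z `\` (S `&` P) = (Z `\` S) `|` (S `\` P).
    apply/seteqP; split=> z.
      move=> [Zz nz]; have [Sz|nS] := pselect (S z); last by left.
      by right; split=> // Pz; apply: nz.
    by move=> [[Zz nS]|[Sz nP]]; split=> //; [case|exact: SZ|case].
  by apply: closedU => //; apply: closedI => //; exact: open_closedC.
have [Bx|B'x] := cov _ quasi_component_id.
  have QU := part U V oU oV UV SUV (BU _ Bx).
  apply/seteqP; split=> y; first by rewrite BC => -[].
  move=> Qy; have [//|/BV Vy] := cov _ Qy.
  by have : (U `&` V) y by [split; [exact: QU|]]; rewrite UV.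
have QV : quasi_component Z x `<=` V.
  by apply: (part V U) => //; [rewrite setIC|rewrite setUC|exact: BV].
have [y By] := B0.
have Qy : quasi_component Z x y by move: By; rewrite BC => -[].
by have : (U `&` V) y by [split; [exact: BU|exact: QV]]; rewrite UV.
Qed.
End QuasiComponent.

Lemma level_le (u : X -> R) (r : R) : continuous u -> closed [set x | u x <= r].
Proof. by move=> /continuous_closedP /(_ [set y | y <= r]); apply; exact: closed_le. Qed.

Lemma level_ge (u : X -> R) (r : R) : continuous u -> closed [set x | r <= u x].
Proof. by move=> /continuous_closedP /(_ [set y | r <= y]); apply; exact: closed_ge. Qed.

Hypothesis indec : hereditarily_indecomposable X.

(* A continuum in [{u <= b}] reaching down to [a - d] and one in [{u >= a}]
   reaching up to [b + d] cannot meet, as their union would be decomposable. *)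
Lemma fold_cover (u : X -> R) (a b d : R) : continuous u -> a <= b -> 0 < d ->
  exists X0 X1 X2 : set X, [/\ closed X0, closed X1, closed X2,
    X0 `|` X1 `|` X2 = [set: X] &
    [/\ X0 `&` X2 = set0,
      forall x, X0 x -> u x <= b, forall x, X2 x -> a <= u x,
      forall x, X1 x -> a - d <= u x <= b + d &
      (forall x, X0 x -> X1 x -> u x = b) /\
      (forall x, X1 x -> X2 x -> u x = a)]].
Proof.
move=> cu ab d0.
pose Zb := [set x | u x <= b]; pose Za := [set x | a <= u x].
pose A := [set x | u x <= a - d]; pose B := [set x | b + d <= u x].
have cZb : closed Zb by exact: level_le.
have cZa : closed Za by exact: level_ge.
have cA : closed A by exact: level_le.
have cB : closed B by exact: level_ge.
have AZ : A `<=` Zb by move=> x; rewrite /A /Zb/=; lra.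
have BZ : B `<=` Za by move=> x; rewrite /B /Za/=; lra.
(* Pairs of relatively clopen sets containing the low part [A] and the high part [B]. If no pair
   were disjoint, compactness would give a point [p] common to all of them. *)
pose D := [set ST : set X * set X | [/\ clopen_in Zb ST.1, clopen_in Za ST.2,
  A `<=` ST.1 & B `<=` ST.2]].
have DZ : D (Zb, Za) by split=> //; exact: clopen_in_id.
have [[S T] [/= cS cT AS BT] ST] :
    exists2 ST, D ST & ST.1 `&` ST.2 = set0.
  apply: contrapT => nex.
  have [||||p hp] := @compact_directed _ D (fun ST => ST.1 `&` ST.2).
  - by exists (Zb, Za).
  - by move=> [S T] [/= [_ cS _] [_ cT _] _ _]; exact: closedI.
  - move=> [S T] [S' T'] [/= c1 c2 s1 s2] [/= c1' c2' s1' s2'].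
    exists (S `&` S', T `&` T'); last by rewrite /= setIACA.
    split=> /=; [exact: clopen_inI|exact: clopen_inI| |].
      by move=> x Ax; split; [exact: s1|exact: s1'].
    by move=> x Ax; split; [exact: s2|exact: s2'].
  - move=> ST DST; apply/set0P/eqP => e; apply: nex; by exists ST.
  have [Zbp Zap] : Zb p /\ Za p by have [] := hp _ DZ.
  pose K := quasi_component Zb p; pose L := quasi_component Za p.
  have cK : closed K by exact: quasi_component_closed.
  have cL : closed L by exact: quasi_component_closed.
  have KZ : K `<=` Zb by exact: quasi_component_sub.
  have LZ : L `<=` Za by exact: quasi_component_sub.
  have Kp : K p by exact: quasi_component_id.
  have Lp : L p by exact: quasi_component_id.
  have cmp (Z : set X) : closed Z -> compact Z by move=> cZ; apply: (subclosed_compact cZ cX).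
  (* If [K] missed [A], so would some relatively clopen [S] around [p], and the complement of [S] in
     [Zb], paired with [Za], would be a member of [D] without [p]. *)
  have [y [Ky Ay]] : K `&` A !=set0.
    apply: contrapT => n0.
    have [||S [cS Sp SA]] := @quasi_component_open_nbhs Zb p cZb Zbp (~` A).
    - exact: closed_openC.
    - by move=> y Ky Ay; apply: n0; exists y.
    - have [] : ((Zb `\` S) `&` Za) p; last by case.
      apply: (hp (Zb `\` S, Za)); split=> //=; [exact: clopen_inC|exact: clopen_in_id|].
      by move=> x Ax; split; [exact: AZ|move=> /SA].
  have [z [Lz Bz]] : L `&` B !=set0.
    apply: contrapT => n0.
    have [||S [cS Sp SA]] := @quasi_component_open_nbhs Za p cZa Zap (~` B).
    - exact: closed_openC.
    - by move=> y' Ky' Ay'; apply: n0; exists y'.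
    - have [] : (Zb `&` (Za `\` S)) p; last by move=> _ [].
      apply: (hp (Zb, Za `\` S)); split=> //=; [exact: clopen_in_id|exact: clopen_inC|].
      by move=> x Ax; split; [exact: BZ|move=> /SA].
  apply: (indec (K := K `|` L)).
    split; first by exists p; left.
      by apply: cmp; exact: closedU.
    by apply: connectedU; [exists p|exact: quasi_component_connected|
      exact: quasi_component_connected].
  exists K, L; split=> //.
  - by split; [exists p|exact: cmp|exact: quasi_component_connected].
  - by split; [exists p|exact: cmp|exact: quasi_component_connected].
  - split=> [x Kx|h]; first by left.
    by have := KZ _ (h z (or_intror Lz)); move: Bz; rewrite /B /Zb /=; lra.
  - split=> [x Kx|h]; first by right.
    by have := LZ _ (h y (or_introl Ky)); move: Ay; rewrite /A /Za /=; lra.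
have [SZ clS clS'] := cS; have [TZ clT clT'] := cT.
(* As [S] is relatively clopen in [Zb], the closure of what is left over can touch [S] only where
   [u] is [b]; likewise it touches [T] only where [u] is [a]. *)
exists S, (closure (~` (S `|` T))), T; split=> //.
- exact: closed_closure.
- apply/seteqP; split=> // x _.
  have [?|nS] := pselect (S x); first by left; left.
  have [?|nT] := pselect (T x); first by right.
  by left; right; apply: subset_closure; case.
split=> //.
- have cI : closed [set x | a - d <= u x <= b + d].
    rewrite (_ : mkset _ = [set x | a - d <= u x] `&` [set x | u x <= b + d]).
      by apply: closedI; [exact: level_ge|exact: level_le].
    by apply/seteqP; split=> x /=; [move=> /andP|move=> [-> ->]].
  move=> x Hx; apply: (cI x); apply: closureS Hx => y /= ny.
  have nA : ~ A y by move=> /AS ?; apply: ny; left.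
  have nB : ~ B y by move=> /BT ?; apply: ny; right.
  move: nA nB; rewrite /A /B /= => /negP nA /negP nB.
  by move: nA nB; rewrite -!ltNge => /ltW -> /ltW ->.
- split=> x.
    move=> Sx cx; have ub := SZ _ Sx; apply/eqP; rewrite eq_le; apply/andP; split=> //.
    rewrite leNgt; apply/negP => ux.
    have oW : open (~` (Zb `\` S) `&` ~` [set y | b <= u y]).
      by apply: openI; apply: closed_openC => //; exact: level_ge.
    have [|y [ny [h1 h2]]] := cx _ (open_nbhs_nbhs (conj oW _)).
      by split; [move=> []|move=> /=; rewrite leNgt ux].
    apply: ny; left; apply: contrapT => nS; apply: h1; split=> //.
    by move/negP: h2; rewrite /= -ltNge => /ltW.
move=> cx Tx; have ub := TZ _ Tx; apply/eqP; rewrite eq_le; apply/andP; split=> //.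
rewrite leNgt; apply/negP => ux.
have oW : open (~` (Za `\` T) `&` ~` [set y | u y <= a]).
  by apply: openI; apply: closed_openC => //; exact: level_le.
have [|y [ny [h1 h2]]] := cx _ (open_nbhs_nbhs (conj oW _)).
  by split; [move=> []|move=> /=; rewrite leNgt ux].
apply: ny; right; apply: contrapT => nS; apply: h1; split=> //.
by move/negP: h2; rewrite /= -ltNge => /ltW.
Qed.

Definition fold (b m t : R) : R :=
  if t <= b then t else if t <= b + m then 2 * b - t else t - 2 * m.

(** The maps [u], [2 b - u] and [u + 2 m] invert the three branches of [fold] and are used on the
    three pieces of [fold_cover]. They agree on the overlaps because [u] is [b] or [a = b - m]
    there. On [X1] the values of [u] may leave [[a, b]] by [d]; clamping them is the only source of
    error. *)
Lemma fold_lift (u : X -> R) (b m d : R) : continuous u -> 0 <= m -> 0 < d ->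
  exists2 v : X -> R, continuous v & forall x, `|fold b m (v x) - u x| <= d.
Proof.
move=> cu m0 d0; pose a := b - m.
have ab : a <= b by rewrite /a; lra.
have [X0 [X1 [X2 [c0 c1 c2 cov [d02 h0 h2 h1 [e01 e12]]]]]] := fold_cover cu ab d0.
pose w x := 2 * b - clamp a b (u x).
have cw : continuous w.
  move=> x; apply: cvgB; first exact: cvg_cst.
  exact: continuous_clamp.
pose w2 x := u x + 2 * m.
have cw2 : continuous w2 by move=> x; apply: cvgD; [exact: cu|exact: cvg_cst].
pose v x := if pselect (X0 x) then u x else if pselect (X1 x) then w x else w2 x.
have v0 x : X0 x -> v x = u x by rewrite /v; case: (pselect (X0 x)).
have v1 x : X1 x -> v x = w x.
  rewrite /v => X1x; case: (pselect (X0 x)) => [X0x|_] /=; last by case: (pselect (X1 x)).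
  by rewrite /w (e01 _ X0x X1x) clamp_id//; lra.
have v2 x : X2 x -> v x = w2 x.
  move=> X2x; rewrite /v; case: (pselect (X0 x)) => [X0x|_] /=.
    by have : (X0 `&` X2) x by []; rewrite d02.
  case: (pselect (X1 x)) => // X1x /=.
  by rewrite /w /w2 (e12 _ X1x X2x) clamp_id// /a; lra.
have cv : continuous v.
  apply/continuous_closedP => C cC.
  have -> : v @^-1` C = (X0 `&` u @^-1` C) `|` (X1 `&` w @^-1` C) `|` (X2 `&` w2 @^-1` C).
    apply/seteqP; split=> x /=.
      have : (X0 `|` X1 `|` X2) x by rewrite cov.
      by move=> [[h|h]|h]; rewrite ?(v0 _ h) ?(v1 _ h) ?(v2 _ h); [left; left|left; right|right].
    by move=> [[[h]|[h]]|[h]] /=; rewrite ?(v0 _ h) ?(v1 _ h) ?(v2 _ h).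
  have cc f : continuous f -> closed (f @^-1` C) by move=> /continuous_closedP; exact.
  by apply: closedU; [apply: closedU|]; apply: closedI => //; exact: cc.
exists v => // x; have : (X0 `|` X1 `|` X2) x by rewrite cov.
case=> [[h|h]|h].
- by rewrite v0// /fold h0// subrr normr0 ltW.
- rewrite v1// /w; have /andP[l1 l2] := h1 _ h.
  set c := clamp a b (u x).
  have [ac cb cu'] : [/\ a <= c, c <= b & `|c - u x| <= d].
    have /andP[? ?] := clamp_bounds (u x) ab; split=> //; rewrite /c.
    have [bu|ub] := leP b (u x).
      by rewrite clamp_high// ler_norml; apply/andP; split; lra.
    have [au|ua] := leP a (u x); first by rewrite clamp_id ?(ltW ub)// subrr normr0 ltW.
    by rewrite clamp_low ?(ltW ua)// ler_norml; apply/andP; split; lra.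
  rewrite /fold; case: ifP => h3.
    by have -> : 2 * b - c = c by lra.
  by rewrite ifT; [have -> : 2 * b - (2 * b - c) = c by lra|rewrite /a in ac; lra].
- rewrite v2// /w2 /fold; have := h2 _ h; rewrite /a => h3.
  case: ifP => h4; first by rewrite ler_norml; apply/andP; split; lra.
  case: ifP => h5; first by rewrite ler_norml; apply/andP; split; lra.
  by rewrite ler_norml; apply/andP; split; lra.
Qed.

(* Starting from 0 at 0, the graph of [zig l] alternately climbs and descends with
   slopes 1 and -1, the legs having the lengths listed in [l]; the leg after the
   last one is infinite. *)
Fixpoint zig (l : seq R) (t : R) : R :=
  if l is x :: l' then if t <= x then t else x - zig l' (t - x) else t.

Notation positive_seq l := (all (fun x : R => 0 < x) l).

Lemma zig0 l : positive_seq l -> zig l 0 = 0.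
Proof. by case: l => //= x l /andP[x0 _]; rewrite ltW. Qed.

Lemma zig_nonexpansive l s t : positive_seq (behead l) ->
  `|zig l s - zig l t| <= `|s - t|.
Proof.
elim: l s t => [//|x l IH] s t /= pl.
have {}IH s' t' : `|zig l s' - zig l t'| <= `|s' - t'|.
  by apply: IH; case: (l) pl => //= ? ? /andP[].
have zl0 := zig0 pl.
wlog st : s t / s <= t.
  move=> H; have [/H//|/ltW/H] := leP s t.
  by rewrite distrC [X in _ <= X]distrC.
case: ifP => sx; case: ifP => tx //.
- have := IH (t - x) 0; rewrite zl0 !subr0 => h.
  have t0 : 0 <= t - x by move: tx; lra.
  rewrite (ger0_norm t0) in h; have h' := ler_norm (zig l (t - x)).
  have h'' := ler_norm (- zig l (t - x)); rewrite normrN in h''.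
  by rewrite [X in _ <= X]distrC (@ger0_norm _ (t - s)) ?subr_ge0// ler_norml;
    apply/andP; split; lra.
- by move: sx tx; lra.
- rewrite (_ : _ - _ = - (zig l (s - x) - zig l (t - x))); last by ring.
  by rewrite normrN; apply: le_trans (IH _ _) _; rewrite opprB addrA subrK.
Qed.

(** Putting a leg of length [y] in front shifts the fold by [y]; [m <= b] keeps the fold from
    reaching back into the new leg. *)
Lemma zig_fold_cons l l' b m y t : (forall t, zig l t = zig l' (fold b m t)) ->
  0 <= m -> m <= b -> zig l' 0 = 0 ->
  zig (y :: l) t = zig (y :: l') (fold (y + b) m t).
Proof.
move=> H m0 mb z0 /=; have [ty|ty] := leP t y.
  by rewrite /fold (_ : t <= y + b) ?ty//; lra.
have E : fold (y + b) m t = y + fold b m (t - y).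
  rewrite /fold lerBlDl; case: ifP => // _; first by ring.
  by rewrite lerBlDl addrA; case: ifP => _; ring.
rewrite E H.
have f0 : 0 <= fold b m (t - y) by rewrite /fold; case: ifP => ?; last case: ifP => ?; lra.
case: ifP => h; last by rewrite addrAC subrr add0r.
have -> : fold b m (t - y) = 0 by lra.
by rewrite z0; ring.
Qed.

(* A run of the zigzag no longer than its two neighbours can be folded away. *)
Lemma zig_reduce_tail r x m : 0 < m -> positive_seq r ->
  exists l b k, [/\ forall t, zig (x :: m :: r) t = zig l (fold b k t),
    size r = size l, 0 <= k, positive_seq (behead l) &
    m <= x -> k <= b /\ positive_seq l].
Proof.
elim: r x m => [|z r IH] x m m0 /=.
  (* The leg after [m] is infinite and absorbs it. *)
  exists [::], x, m; split=> //; [|exact: ltW].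
  move=> t; rewrite /fold /=; case: ifP => // h1.
  by rewrite lerBlDl; case: ifP => h2; lra.
move=> /andP[z0 pr]; have [mz|zm] := leP m z.
  exists ((x - m + z) :: r), x, m; split=> //; [|exact: ltW|]; last first.
    by move=> mx; split=> //=; rewrite pr andbT; lra.
  move=> t; rewrite /fold /=; case: ifP => h1; first by rewrite ifT//; lra.
  rewrite lerBlDl; case: ifP => h2; first by rewrite ifT; lra.
  have -> : (t - x - m <= z) = (t - 2 * m <= x - m + z).
    by apply/idP/idP; lra.
  case: ifP => h3; first by lra.
  have -> : t - x - m - z = t - 2 * m - (x - m + z) by ring.
  lra.
(* Now [z < m], so the leg to be folded away lies further on; this inequality is what makes the
   recursive call return [k <= b]. *)
have [l [b [k [h1 h2 h3 h4 h5]]]] := IH m z z0 pr.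
have [kb pl] := h5 (ltW zm).
exists (x :: l), (x + b), k; split=> //=; [|by rewrite h2|].
  by move=> t; exact: (zig_fold_cons x t h1 h3 kb (zig0 pl)).
by move=> mx; rewrite pl andbT; split; lra.
Qed.

(** Each fold removes one pair of legs. At the end the zigzag is the identity and [e] lifts itself;
    since zigzags do not expand distances, the errors of the single lifts just add up. *)
Lemma zig_lift n l (e : X -> R) (h : R) : size l = n.*2 ->
  positive_seq (behead l) -> continuous e -> 0 < h ->
  exists2 v : X -> R, continuous v & forall x, `|zig l (v x) - e x| <= h.
Proof.
elim: n l h => [|n IH] l h.
  move=> /size0nil -> _ ce h0; exists e => // x.
  by rewrite subrr normr0 ltW.
case: l => [|x [|m r]] //= [] sr /andP[m0 pr] ce h0.
have [l [b [k [h1 h2 h3 h4 h5]]]] := zig_reduce_tail x m0 pr.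
have h20 : 0 < h / 2 by rewrite divr_gt0.
have [u cu hu] : exists2 u : X -> R, continuous u & forall x, `|zig l (u x) - e x| <= h / 2.
  by apply: IH => //; rewrite -h2 sr.
have [v cv hv] := fold_lift b cu h3 h20; exists v => // y.
suff: `|zig (x :: m :: r) (v y) - e y| <= h by [].
rewrite h1.
have := zig_nonexpansive (fold b k (v y)) (u y) h4; have := hv y; have := hu y.
have := ler_distD (zig l (u y)) (zig l (fold b k (v y))) (e y); lra.
Qed.

(* The n pairs of legs, of total length [h] each, whose end points follow
   [z k], [z k.+1], and so on. *)
Fixpoint teeth (h : R) (z : nat -> R) (n k : nat) : seq R :=
  if n is n'.+1 then
    (h + (z k.+1 - z k)) / 2 :: (h - (z k.+1 - z k)) / 2 :: teeth h z n' k.+1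
  else [::].

Lemma size_teeth h z n k : size (teeth h z n k) = n.*2.
Proof. by elim: n k => //= n IH k; rewrite IH. Qed.

Section Teeth.
Variables (h : R) (z : nat -> R) (h0 : 0 < h).
Hypothesis zh : forall j, `|z j.+1 - z j| < h.

Lemma teeth_positive n k : positive_seq (teeth h z n k).
Proof.
elim: n k => //= n IH k; rewrite IH andbT.
by have := zh k; rewrite ltr_norml => /andP[? ?]; apply/andP; split; lra.
Qed.

Lemma zig_teeth_lt0 n k t : t <= 0 -> zig (teeth h z n k) t = t.
Proof.
move=> t0; case: n => //= n; rewrite ifT//.
by have := zh k; rewrite ltr_norml => /andP[? ?]; lra.
Qed.

Lemma zig_teeth_gt n k t : n%:R * h <= t ->
  zig (teeth h z n k) t = z (k + n)%N - z k + (t - n%:R * h).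
Proof.
elim: n k t => [|n IH] k t /=; first by rewrite addn0; lra.
rewrite -natr1 mulrDl mul1r => ht.
have nh : 0 <= n%:R * h by rewrite mulr_ge0// ltW.
have := zh k; rewrite ltr_norml => /andP[l1 l2].
rewrite addnS -addSn.
have [|H] := leP t ((h + (z k.+1 - z k)) / 2); first by lra.
set d := z k.+1 - z k in l1 l2 H *.
have [E|H'] := leP (t - (h + d) / 2) ((h - d) / 2).
  have e1 : t = h by lra.
  have e2 : n%:R * h = 0 by lra.
  have n0 : n = 0%N.
    by move/eqP: e2; rewrite mulf_eq0 (gt_eqF h0) orbF pnatr_eq0 => /eqP.
  by rewrite n0 addn0 mul0r e1 /d; lra.
rewrite IH; last by lra.
by rewrite /d; lra.
Qed.

Lemma zig_teeth n k t : 0 <= t -> t <= n%:R * h ->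
  exists2 j, (j <= n)%N & `|t - j%:R * h| <= h /\
    `|zig (teeth h z n k) t - (z (k + j)%N - z k)| <= h.
Proof.
elim: n k t => [|n IH] k t t0 tn.
  have -> : t = 0 by lra.
  by exists 0%N => //=; rewrite addn0 mul0r !subrr normr0; split; exact: ltW.
have := zh k; rewrite ltr_norml => /andP[l1 l2] /=.
set d := z k.+1 - z k in l1 l2 *.
have [H|H] := leP t ((h + d) / 2).
  by exists 0%N => //; rewrite addn0 mul0r subrr !subr0 ger0_norm//; split; lra.
have [H'|H'] := leP (t - (h + d) / 2) ((h - d) / 2).
  exists 0%N => //; rewrite addn0 mul0r subrr !subr0 ger0_norm//; split; first by lra.
  by rewrite ler_norml; apply/andP; split; lra.
have [||j jn [h1 h2]] := IH k.+1 (t - h); first by lra.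
  by move: tn; rewrite -natr1 mulrDl mul1r; lra.
exists j.+1 => //; rewrite -natr1 mulrDl mul1r addnS -addSn; split.
  by rewrite (_ : _ - _ = t - h - j%:R * h)//; ring.
move: h2; set w := zig _ _; set w' := zig _ _.
have -> : w' = w by congr zig; lra.
rewrite (_ : _ - (z (k.+1 + j)%N - z k) = w - (z (k.+1 + j)%N - z k.+1))//.
by rewrite /d; lra.
Qed.
End Teeth.

Hypothesis conX : connected [set: X].

Lemma arc_lift (e : X -> R) (g : R -> R) (k s0 s1 : R) :
  continuous e -> (forall x, `|e x| <= 1) ->
  (exists x, e x = -1) -> (exists x, e x = 1) ->
  continuous g -> (forall t, `|g t| <= 1) -> 0 < k ->
  -1 <= s0 <= 1 -> -1 <= s1 <= 1 -> g s0 <= -1 + k -> 1 - k <= g s1 ->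
  exists V : X -> R, [/\ continuous V, forall x, `|V x| <= 1,
    exists x, V x = -1, exists x, V x = 1 &
    forall x, `|g (V x) - e x| <= 7 * k].
Proof.
move=> ce e1 [xm em] [xp ep] cg g1 k0 s01 s11 gs0 gs1.
(* Precomposing with [sg] makes [g] start near -1 and end near 1; it is then
   approximated by a zigzag, along which [zig_lift] applies. *)
pose w := nth (0 : R) [:: s0; -1; 1; s1].
pose sg := pl w 3.
have wb j : (j <= 3)%N -> -1 <= w j <= 1.
  by case: j => [|[|[|[|]]]]//= _; rewrite /w/= ?lexx/=; lra.
have sgb t : 0 <= t -> t <= 3 -> -1 <= sg t <= 1 by exact: pl_bound wb.
pose G t := g (sg t).
have csg : continuous sg by exact: pl_continuous.
have cG : continuous G.
  by move=> t; apply: continuous_comp; [exact: csg|exact: cg].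
have [r r0 hr] := uniform_on_segment 0 3 cG k0.
pose N := (Num.truncn (3 / r)).+1.
have N0 : 0 < N%:R :> R by [].
have rN : 3 / N%:R < r.
  by rewrite ltr_pdivrMr// -ltr_pdivrMl// mulrC truncnS_gt.
pose tau j : R := clamp 0 3 (3 * j%:R / N%:R).
have tau_in j : 0 <= tau j <= 3 by exact: clamp_bounds.
pose z j := G (tau j).
have zk j : `|z j.+1 - z j| < k.
  apply: hr => //; apply: le_lt_trans (clamp_nonexpansive _ _ _) _ => //.
  rewrite -natr1 (_ : _ - _ = 3 / N%:R); last by field; rewrite gt_eqF.
  by rewrite ger0_norm// divr_ge0// ltW.
have zb j : -1 <= z j <= 1 by have := g1 (sg (tau j)); rewrite ler_norml.
have z0 : z 0%N <= -1 + k.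
  rewrite /z /G /tau mulr0 mul0r clamp_id// /sg.
  by have := @pl_nat R w 3 0 isT => ->.
have zN : 1 - k <= z N.
  rewrite /z /G /tau mulfK ?gt_eqF// clamp_id// /sg.
  by have := @pl_nat R w 3 3 isT => ->.
(* The factor [1 + 4 * k] stretches [e] beyond the values of the zigzag on [[0, N k]], so that the
   lift [v] leaves this interval below at [xm] and above at [xp]. *)
pose E x := (1 + 4 * k) * e x - z 0%N.
have cE : continuous E.
  move=> x; apply: cvgB; last exact: cvg_cst.
  by apply: cvgM; [exact: cvg_cst|exact: ce].
have pt : positive_seq (behead (teeth k z N 0)).
  by have := teeth_positive zk N 0; case: (teeth _ _ _ _) => //= ? ? /andP[].
have [v cv hv] := zig_lift (size_teeth k z N 0) pt cE k0.
have tl := zig_teeth_lt0 zk N 0.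
have tg t : N%:R * k <= t -> zig (teeth k z N 0) t = z N - z 0%N + (t - N%:R * k).
  by move=> Nt; rewrite zig_teeth_gt.
have tm t : 0 <= t -> t <= N%:R * k -> exists2 j, (j <= N)%N &
    `|t - j%:R * k| <= k /\ `|zig (teeth k z N 0) t - (z j - z 0%N)| <= k.
  by move=> t0 tN; exact: (zig_teeth k0 zk 0 t0 tN).
have zbk j : -1 <= z j <= 1 := zb j.
have /andP[z0l _] := zb 0%N; have /andP[_ zNh] := zb N.
have Nk : 0 <= N%:R * k by rewrite mulr_ge0// ltW.
have vlow : v xm < 0.
  have := hv xm; rewrite /E em ler_norml => /andP[_ h1].
  rewrite ltNge; apply/negP => h2; have [h3|h3] := leP (v xm) (N%:R * k).
    have [j _ [_]] := tm _ h2 h3; rewrite ler_norml => /andP[h4 _].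
    by have /andP[? _] := zbk j; lra.
  by have := tg _ (ltW h3); lra.
have vhigh : N%:R * k < v xp.
  have := hv xp; rewrite /E ep ler_norml => /andP[h1 _].
  rewrite ltNge; apply/negP => h2; have [h3|h3] := leP 0 (v xp).
    have [j _ [_]] := tm _ h3 h2; rewrite ler_norml => /andP[_ h4].
    by have /andP[_ ?] := zbk j; lra.
  by have := tl (v xp) (ltW h3); lra.
have Nk0 : 0 < N%:R * k by rewrite mulr_gt0.
pose c x := clamp 0 (N%:R * k) (v x).
have cc : continuous c by exact: continuous_clamp.
pose S x := 3 / (N%:R * k) * c x.
have cS : continuous S by move=> x; apply: cvgM; [exact: cvg_cst|exact: cc].
have S03 x : 0 <= S x <= 3.
  have /andP[c0 c1] := clamp_bounds (v x) Nk.
  rewrite /S mulr_ge0 ?divr_ge0//= mulrAC ler_pdivrMr//.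
  by rewrite ler_wpM2l.
have Sm : S xm = 0 by rewrite /S /c clamp_low ?mulr0// ltW.
have Sp : S xp = 3 by rewrite /S /c clamp_high ?divfK ?gt_eqF// ltW.
have cV : continuous (fun x => sg (S x)).
  by move=> x; apply: (@continuous_comp _ _ _ S sg x); [exact: cS|exact: csg].
have hit (i : nat) : (i <= 3)%N -> exists x, sg (S x) = w i.
  move=> i3; have [||y Sy] := @connected_ivt R X conX S xm xp i%:R cS.
  - by rewrite Sm.
  - by rewrite Sp ler_nat.
  - by exists y; rewrite Sy /sg pl_nat.
exists (fun x => sg (S x)); split=> //.
- by move=> x; have /andP[a0 a1] := S03 x; rewrite ler_norml; exact: sgb.
- by have [x hx] := hit 1%N isT; exists x.
- by have [x hx] := hit 2%N isT; exists x.
(* The bound [7 * k] consists of [4 * k] for the stretching in [E] and of [k] each for the lift, for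
   the zigzag against the nodes [z j], and for the oscillation of [G] between nodes. *)
move=> x; rewrite -[g _]/(G (S x)).
have := e1 x; rewrite ler_norml => /andP[el eh].
have := hv x; rewrite /E ler_norml => /andP[hl hh].
have kel : - k <= k * e x by nra.
have keh : k * e x <= k by nra.
have tau0 : G 0 = z 0%N by rewrite /z /tau mulr0 mul0r clamp_id.
have tauN : G 3 = z N by rewrite /z /tau mulfK ?gt_eqF// clamp_id.
have [v0|v0] := leP 0 (v x); last first.
  have -> : S x = 0 by rewrite /S /c clamp_low ?mulr0// ltW.
  rewrite tau0; have := tl (v x) (ltW v0) => h1.
  by rewrite ler_norml; apply/andP; split; lra.
have [vN|vN] := leP (v x) (N%:R * k); last first.
  have -> : S x = 3 by rewrite /S /c clamp_high ?divfK ?gt_eqF// ltW.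
  rewrite tauN; have := tg _ (ltW vN) => h1.
  by rewrite ler_norml; apply/andP; split; lra.
have [j jN []] := tm _ v0 vN => h1.
rewrite ler_norml => /andP[h2 h3].
have : `|G (S x) - z j| < k.
  apply: hr => //; rewrite /tau clamp_id; last first.
  - by rewrite ler_pdivrMr// ler_wpM2l// ler_nat.
  - by rewrite divr_ge0// mulr_ge0.
  rewrite /S /c clamp_id// (_ : _ - _ = 3 / (N%:R * k) * (v x - j%:R * k)); last first.
    by field; rewrite !gt_eqF.
  rewrite normrM ger0_norm ?divr_ge0//.
  apply: le_lt_trans rN; rewrite -[leRHS](_ : 3 / (N%:R * k) * k = _).
    by rewrite ler_wpM2l// divr_ge0.
  by field; rewrite !gt_eqF.
rewrite ltr_norml => /andP[h4 h5].
by rewrite ler_norml; apply/andP; split; lra.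
Qed.
End Compactness.

(** * Coordinates on chainable continua *)

Section ComplexValued.
Variable R : realType.

Lemma Re_le_normc (z : R[i]) : `|complex.Re z| <= Normc.normc z.
Proof. by case: z => a b /=; rewrite -sqrtr_sqr ler_wsqrtr// lerDl sqr_ge0. Qed.

Lemma Im_le_normc (z : R[i]) : `|complex.Im z| <= Normc.normc z.
Proof. by case: z => a b /=; rewrite -sqrtr_sqr ler_wsqrtr// lerDr sqr_ge0. Qed.

Lemma normc_le_ReIm (z : R[i]) :
  Normc.normc z <= `|complex.Re z| + `|complex.Im z|.
Proof.
case: z => a b /=; rewrite -(@ler_pXn2r _ 2) ?nnegrE ?sqrtr_ge0 ?addr_ge0//.
rewrite sqr_sqrtr ?addr_ge0 ?sqr_ge0// -(real_normK (num_real a)) -(real_normK (num_real b)).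
by have := normr_ge0 a; have := normr_ge0 b; nra.
Qed.

Lemma continuous_complex (X : topologicalType) (u v : X -> R) :
  continuous u -> continuous v -> continuous (fun x => (u x +i* v x)%C : R[i]^o).
Proof.
move=> cu cv x; apply/cvgrPdist_lt => e' e'0.
have [e e0 ->] : exists2 e : R, 0 < e & e' = e%:C.
  by case: e' e'0 => a b; rewrite ltcE/= => /andP[/eqP-> a0]; exists a.
have e20 : 0 < e / 2 by rewrite divr_gt0.
have /cvgrPdist_lt/(_ _ e20) hu := cu x; have /cvgrPdist_lt/(_ _ e20) hv := cv x.
apply: filterS (filterI hu hv) => y [/= h1 h2].
rewrite [`|_|](_ : _ = (Normc.normc ((u x +i* v x) - (u y +i* v y)))%:C)// ltcR.
by apply: le_lt_trans (normc_le_ReIm _) _ => /=; lra.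
Qed.

Variable X : continuum.
Implicit Types f : cfun R X.

Lemma continuous_Re f : continuous (fun x => complex.Re (f x)).
Proof.
move=> x; apply/cvgrPdist_lt => e e0; apply: filterS (cfun_near f x e0) => y.
by apply: le_lt_trans; rewrite -raddfB Re_le_normc.
Qed.

Lemma continuous_Im f : continuous (fun x => complex.Im (f x)).
Proof.
move=> x; apply/cvgrPdist_lt => e e0; apply: filterS (cfun_near f x e0) => y.
by apply: le_lt_trans; rewrite -raddfB Im_le_normc.
Qed.

Definition cfun_of (u v : X -> R) (cu : continuous u) (cv : continuous v) : cfun R X :=
  CFun (continuous_complex cu cv).
End ComplexValued.

Lemma compact_finite_cover (X : topologicalType) (J : Type) (U : J -> set X) (x0 : X) :
  compact [set: X] -> (forall j, open (U j)) -> (forall x, exists j, U j x) ->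
  exists n (c : 'I_n -> J), open_cover (fun i => U (c i)).
Proof.
move=> cX oU cov.
pose S (nc : nat * (nat -> J)) := [set x | forall i, (i < nc.1)%N -> ~ U (nc.2 i) x].
have [j0 _] := cov x0.
have [[n c] nS] : exists nc, ~ (S nc !=set0).
  apply: contrapT => /forallNP nex.
  have [||||p hp] := @compact_directed _ cX _ setT S.
  - by exists (0%N, fun=> j0).
  - move=> [n c] _; rewrite (_ : S _ = \bigcap_(i in [set i | (i < n)%N]) ~` U (c i)).
      by apply: closed_bigI => i _; exact: open_closedC.
    by apply/seteqP; split=> x /= h i; exact: h.
  - move=> [n c] [n' c'] _ _; exists ((n + n')%N, fun i => if (i < n)%N then c i else c' (i - n)%N) => //.
    move=> x /= h; split=> i /= hi.
      by have := h i (ltn_addr _ hi); rewrite /= hi.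
    have E : (n + i < n)%N = false by lia.
    by have := h (n + i)%N; rewrite /= ltn_add2l addKn E => /(_ hi).
  - by move=> nc _; apply: contrapT; exact: nex.
  have [j Uj] := cov p.
  by apply: (hp (1%N, fun=> j) I 0%N).
exists n, (fun i => c i); split=> [i|]; first exact: oU.
apply/seteqP; split=> // x _; apply: contrapT => nx; apply: nS; exists x => i /= hi Ux.
by apply: nx; exists (Ordinal hi).
Qed.

Lemma sum_indicator (R : realType) L a :
  \sum_(j < L) ((j < a)%N)%:R = (minn L a)%:R :> R.
Proof.
elim: L => [|L IH]; first by rewrite big_ord0 min0n.
rewrite big_ord_recr/= IH -natrD; congr _%:R.
by case: (ltnP L a) => h; lia.
Qed.

Section Chain.
Variables (R : realType) (X : topologicalType).
Hypotheses (cX : compact [set: X]) (hX : hausdorff_space X).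

Lemma separating_function (A B : set X) : closed A -> closed B ->
  A `&` B = set0 -> exists f : X -> R, [/\ continuous f,
    forall x, 0 <= f x <= 1, forall x, A x -> f x = 0 & forall x, B x -> f x = 1].
Proof.
move=> cA cB AB.
have /(@uniform_separatorP _ R)[f [cf f01 fA fB]] :=
  (@normal_separatorP R X).1 (compact_normal hX cX) A B cA cB AB.
exists f; split=> // x.
- by have := f01 (f x); rewrite /= in_itv/=; apply; exists x.
- by move=> Ax; apply: fA; exists x.
- by move=> Bx; apply: fB; exists x.
Qed.

Hypothesis chX : chainable X.

(* [w] is a coordinate along a chain refining [U] whose links contain the points [nd j]. *)
Lemma chain_map (x0 : X) n (U : 'I_n -> set X) : open_cover U ->
  exists L (w : X -> R) (nd : nat -> X), [/\ continuous w,
    forall x, 0 <= w x <= L%:R &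
    forall (d : X -> X -> R) (h : R), 0 <= h ->
      (forall x y, d x y = d y x) -> (forall x y z, d x z <= d x y + d y z) ->
      (forall i x y, U i x -> U i y -> d x y <= h) ->
      forall x j, (j <= L)%N -> `|w x - j%:R| <= 1 -> d x (nd j) <= 3 * h].
Proof.
move=> /chX[m [V [[oV covV] ref chV]]].
have inV x : exists i, V i x.
  by have : (\bigcup_i V i) x by [rewrite covV]; move=> [i _ Vx]; exists i.
case: m V oV covV ref chV inV => [|L] V oV covV ref chV inV.
  by have [[]] := inV x0.
pose Vn j := V (inord j : 'I_L.+1).
have /choice[nd hnd] : forall j, exists x, Vn j x.
  move=> j; have [_] := chV (inord j) (inord j); rewrite leqnSn => /(_ isT)[x [Vx _]].
  by exists x.
have adj i j x : (i <= L)%N -> (j <= L)%N -> Vn i x -> Vn j x -> (i <= j.+1)%N && (j <= i.+1)%N.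
  move=> iL jL Vi Vj; have [] := chV (inord i) (inord j).
  by rewrite !inordK// => + _; apply; exists x.
have meet i j : (i <= L)%N -> (j <= L)%N -> (i <= j.+1)%N -> (j <= i.+1)%N ->
    exists x, Vn i x /\ Vn j x.
  move=> iL jL ij ji; have [_] := chV (inord i) (inord j).
  by rewrite !inordK// ij ji => /(_ isT)[x [? ?]]; exists x.
have inVn x : exists2 k, (k <= L)%N & Vn k x.
  have [i Vx] := inV x; exists i; first by rewrite -ltnS.
  by rewrite /Vn inord_val.
(* [F j] avoids the links after [j] and [G j] those up to [j], so [f j] rises from 0 to 1 between
   link [j] and link [j.+1]. The sum of the [f j] counts, up to 1, the links before [x]. *)
pose F j := ~` (\bigcup_(i in [set i | (j < i <= L)%N]) Vn i).
pose G j := ~` (\bigcup_(i in [set i | (i <= j)%N]) Vn i).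
have clF j : closed (F j).
  by apply: open_closedC; apply: bigcup_open => i _; exact: oV.
have clG j : closed (G j).
  by apply: open_closedC; apply: bigcup_open => i _; exact: oV.
have FG j : F j `&` G j = set0.
  rewrite -subset0 => x [Fx Gx]; have [k kL Vx] := inVn x.
  have [kj|jk] := leqP k j; first by apply: Gx; exists k.
  by apply: Fx; exists k => //=; rewrite jk.
have /choice[f hf] j := separating_function (clF j) (clG j) (FG j).
pose w x := \sum_(j < L) f j x.
have cw : continuous w.
  rewrite /w; elim: (L) => [|l IH].
    rewrite (_ : (fun _ => _) = fun=> 0); first by move=> x; exact: cvg_cst.
    by apply/funext => x; rewrite big_ord0.
  rewrite (_ : (fun _ => _) = fun x => \sum_(j < l) f j x + f l x).
    by move=> x; apply: cvgD; [exact: IH|have [c _ _ _] := hf l; exact: c].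
  by apply/funext => x; rewrite big_ord_recr.
have wk x k : (k <= L)%N -> Vn k x -> k%:R - 1 <= w x <= k%:R + 1.
  move=> kL Vx; apply/andP; split.
    apply: (@le_trans _ _ ((minn L k.-1)%:R)).
      by rewrite lerBlDr natr1 ler_nat; lia.
    rewrite -sum_indicator; apply: ler_sum => j _.
    have [_ f01 _ f1] := hf j; case: ltnP => jk; last by have /andP[] := f01 x.
    rewrite f1// => -[i /= ij Vi]; have := adj i k x _ kL Vi Vx.
    by have := ltn_ord j; lia.
  apply: (@le_trans _ _ ((minn L k.+1)%:R)); last by rewrite natr1 ler_nat; lia.
  rewrite -sum_indicator; apply: ler_sum => j _.
  have [_ f01 f0 _] := hf j; case: ltnP => jk; first by have /andP[] := f01 x.
  rewrite f0// => -[i /= /andP[ji iL] Vi]; have := adj i k x iL kL Vi Vx.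
  lia.
exists L, w, nd; split=> //.
  move=> x; apply/andP; split.
    by apply: sumr_ge0 => j _; have [_ f01 _ _] := hf j; have /andP[] := f01 x.
  rewrite -[L in leRHS]card_ord -sumr_const; apply: ler_sum => j _.
  by have [_ f01 _ _] := hf j; have /andP[] := f01 x.
move=> d h h0 dC dT dU x j jL wj.
have dV i y y' : Vn i y -> Vn i y' -> d y y' <= h.
  move=> Vy Vy'; have [l hl] := ref (inord i).
  by apply: (dU l); apply: hl.
have [k kL Vx] := inVn x; have /andP[w1 w2] := wk x k kL Vx.
(* The link number [k] of [x] and [j] are both within 1 of [w x], so at most one link lies between
   them and three link diameters suffice. *)
have {w1 w2 wj} kj : (k <= j.+2)%N && (j <= k.+2)%N.
  move: wj; rewrite ler_norml => /andP[w3 w4].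
  by apply/andP; split; rewrite -(ler_nat R) -[leRHS]natr1 -[X in _ <= X + _]natr1; lra.
have one i i' y y' : (i <= L)%N -> (i' <= L)%N -> (i <= i'.+1)%N -> (i' <= i.+1)%N ->
    Vn i y -> Vn i' y' -> d y y' <= 2 * h.
  move=> iL i'L ii' i'i Vy Vy'; have [z [Vz Vz']] := meet i i' iL i'L ii' i'i.
  by have := dT y z y'; have := dV _ _ _ Vy Vz; have := dV _ _ _ Vz' Vy'; lra.
have [kj1|] := boolP ((k <= j.+1)%N && (j <= k.+1)%N).
  by have [h1 h2] := andP kj1; have := one k j x (nd j) kL jL h1 h2 Vx (hnd j); lra.
move=> nkj; pose i := if (k < j)%N then k.+1 else j.+1.
have [iL ik ki ij ji] : [/\ (i <= L)%N, (i <= k.+1)%N, (k <= i.+1)%N, (i <= j.+1)%N & (j <= i.+1)%N].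
  by rewrite /i; case: ifP => ?; split; lia.
have [z [Vz Vz']] := meet k i kL iL ki ik.
have h1 := dV _ _ _ Vx Vz.
have h2 := one i j z (nd j) iL jL ij ji Vz' (hnd j).
by have := dT x z (nd j); lra.
Qed.

Lemma pl_approx (f : X -> R) (nd : nat -> X) L t x (h : R) : 0 <= t <= L%:R ->
  (forall j, (j <= L)%N -> `|t - j%:R| <= 1 -> `|f x - f (nd j)| <= h) ->
  `|f x - pl (fun j => f (nd j)) L t| <= h.
Proof.
move=> /andP[t0 tL] H.
have [j [j' [a [jL j'L _ /andP[a0 a1] [h1 h2 ->]]]]] := plP t0 tL.
have := H j jL h1; have := H j' j'L h2; rewrite !ler_norml => /andP[? ?] /andP[? ?].
by apply/andP; split; nra.
Qed.

Lemma oscillation_cover (x0 : X) m (f : 'I_m -> X -> R) (h : R) : 0 < h ->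
  (forall i, continuous (f i)) ->
  exists n (U : 'I_n -> set X), open_cover U /\
    forall i j x y, U i x -> U i y -> `|f j x - f j y| <= h.
Proof.
move=> h0 cf.
pose U x := [set y | forall j, `|f j x - f j y| < h / 2]^°.
have h20 : 0 < h / 2 by rewrite divr_gt0.
have [||n [c hc]] := @compact_finite_cover X X U x0 cX.
- by move=> x; exact: open_interior.
- move=> x; exists x; apply: filter_forall => j.
  by have /cvgrPdist_lt/(_ _ h20) := cf j x.
exists n, (fun i => U (c i)); split=> // i j x y.
move=> /interior_subset/(_ j) h1 /interior_subset/(_ j) h2.
apply: le_trans (ler_distD (f j (c i)) _ _) _.
by move: h1 h2; rewrite (distrC (f j x)); lra.
Qed.

Hypothesis (ndX : Defs.nondegenerate X).

Lemma chain_coordinate m (f : 'I_m -> X -> R) (h : R) : 0 < h ->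
  (forall i, continuous (f i)) ->
  exists (e : X -> R) L (nd : nat -> X) (a b : R),
    [/\ continuous e, forall x, `|e x| <= 1,
        exists x, e x = -1, exists x, e x = 1 &
      (forall t, `|t| <= 1 -> 0 <= a * t + b <= L%:R) /\
      forall i x, `|f i x - pl (fun j => f i (nd j)) L (a * e x + b)| <= h].
Proof.
move=> h0 cf; have [x0 [y0 xy0]] := ndX.
have cl1 (z : X) : closed [set z].
  by apply: accessible_closed_set1; exact: hausdorff_accessible.
have [|||f0 [cf0 _ fx0 fy0]] := @separating_function [set x0] [set y0].
- exact: cl1.
- exact: cl1.
- by apply/seteqP; split=> // z [/= -> /xy0].
(* A function separating two points joins the family, so that the coordinate cannot be constant:
   [w x0 = w y0] would give [1 <= 6 * h'], while [h' <= 1 / 12]. *)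
pose F (i : 'I_m.+1) := if unlift ord0 i is Some j then f j else f0.
have cF i : continuous (F i) by rewrite /F; case: unlift.
pose h' := Num.min (h / 3) (1 / 12).
have h'0 : 0 < h' by rewrite lt_min !divr_gt0.
have h'1 : h' <= h / 3 by rewrite ge_min lexx.
have h'2 : h' <= 1 / 12 by rewrite ge_min lexx orbT.
have [n [U [oU hU]]] := oscillation_cover x0 h'0 cF.
have [L [w [nd [cw w0L near]]]] := chain_map x0 oU.
have approx i x : `|F i x - pl (fun j => F i (nd j)) L (w x)| <= 3 * h'.
  apply: pl_approx => // j jL wj.
  apply: (near (fun x y => `|F i x - F i y|)) => //; first exact: ltW.
  - by move=> *; rewrite distrC.
  - by move=> *; exact: ler_distD.
  - by move=> k y z; exact: hU.
have wc : {within [set: X], continuous w} by exact: continuous_subspaceT.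
have X0 : [set: X] !=set0 by exists x0.
have [xM _ hM] := compact_EVT_max X0 cX wc.
have [xm _ hm] := compact_EVT_min X0 cX wc.
have {}hM x : w x <= w xM by apply: hM; rewrite inE.
have {}hm x : w xm <= w x by apply: hm; rewrite inE.
have mM : w xm < w xM.
  rewrite lt_neqAle (le_trans (hm x0) (hM x0)) andbT; apply/eqP => E.
  have wE : w x0 = w y0.
    by have := hm x0; have := hM x0; have := hm y0; have := hM y0; lra.
  have := approx ord0 x0; have := approx ord0 y0.
  rewrite wE /F unlift_none (fx0 x0 erefl) (fy0 y0 erefl) !ler_norml.
  by move=> /andP[? ?] /andP[? ?]; lra.
pose a := (w xM - w xm) / 2; pose b := (w xM + w xm) / 2.
have a0 : 0 < a by rewrite divr_gt0 ?subr_gt0.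
pose e x := (w x - b) / a.
have ae x : a * e x + b = w x by rewrite /e mulrC divfK ?gt_eqF// subrK.
exists e, L, nd, a, b; split.
- by move=> x; apply: cvgM; [apply: cvgB; [exact: cw|exact: cvg_cst]|exact: cvg_cst].
- move=> x; rewrite /e normrM (@ger0_norm _ a^-1) ?invr_ge0 ?(ltW a0)// ler_pdivrMr// mul1r.
  by have := hm x; have := hM x; rewrite ler_norml /a /b => *; apply/andP; split; lra.
- by exists xm; rewrite /e (_ : w xm - b = - a) ?mulNr ?divff ?gt_eqF// /a /b; lra.
- by exists xM; rewrite /e (_ : w xM - b = a) ?divff ?gt_eqF// /a /b; lra.
split.
  move=> t; rewrite ler_norml => /andP[t1 t2].
  have /andP[? _] := w0L xm; have /andP[_ ?] := w0L xM.
  have at1 : a * t <= a by rewrite ler_piMr// ltW.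
  have at2 : - a <= a * t by rewrite -mulrN1 ler_pM2l.
  by rewrite /a /b in at1 at2 *; apply/andP; split; lra.
move=> i x; rewrite ae; have := approx (lift ord0 i) x; rewrite /F liftK.
by move=> /le_trans; apply; lra.
Qed.
End Chain.

Lemma uniform_on_compact (R : realType) (X : topologicalType) (K : set X)
    (d : X -> X -> R) (f : X -> R) (h : R) : compact K ->
  (forall x y z, d x z <= d x y + d y z) -> (forall x y, d x y = d y x) ->
  (forall x (r : R), 0 < r -> \forall y \near x, d x y < r) ->
  (forall x (r : R), 0 < r -> exists2 s : R, 0 < s & forall y, d x y < s -> `|f x - f y| < r) ->
  0 < h ->
  exists2 r : R, 0 < r & forall x y, K x -> d x y < r -> `|f x - f y| < h.
Proof.
move=> cK dT dC dn df h0.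
have := cK; move=> /compact_near_coveringP/(_ R (0 : R)^'+
  (fun r s => forall t, d s t < r -> `|f s - f t| < h)); case.
  move=> s _; have h20 : 0 < h / 2 by rewrite divr_gt0.
  have [r r0 hr] := df s _ h20.
  have r20 : 0 < r / 2 by rewrite divr_gt0.
  exists ([set y | d s y < r / 2], [set r' | 0 < r' < r / 2]).
    split; first exact: dn.
    have H : (0 : R)^'+ ([set r | 0 < r] `&` [set r' | r' < r / 2]).
      by apply: filterI; [exact: nbhs_right_gt|exact: nbhs_right_lt].
    by apply: filterS H => r' [/= -> ->].
  move=> [s' r'] [/= bs' /andP[r'0 r'r]] t str.
  have b1 : d s s' < r by lra.
  have b2 : d s t < r by have := dT s s' t; lra.
  have := hr _ b1; have := hr _ b2.
  have := ler_distD (f s) (f s') (f t); rewrite (distrC (f s') (f s)); lra.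
move=> r /= r0 H.
have := H (r / 2); rewrite /ball/= sub0r normrN ger0_norm ?divr_ge0 ?(ltW r0)//.
have r2 : r / 2 < r by lra.
move=> /(_ r2 (divr_gt0 r0 (ltr0n _ 2))) hr.
by exists (r / 2); [rewrite divr_gt0|move=> x y Kx; exact: hr].
Qed.

(** * A countable dense set of functions *)

Section Separable.
Variables (R : realType) (P : continuum).
Hypotheses (mP : metrizable R P) (chP : chainable P).

(** The chains are chosen once, with mesh tending to 0; by uniform continuity one of them is fine
    enough for a given pair, which will be the real and imaginary parts of one function. *)
Lemma fine_chains : exists (L : nat -> nat) (w : nat -> P -> R) (nd : nat -> nat -> P),
  [/\ forall n, continuous (w n), forall n x, 0 <= w n x <= (L n)%:R &
    forall (f g : P -> R) (h : R), continuous f -> continuous g -> 0 < h ->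
      exists n, forall x j, (j <= L n)%N -> `|w n x - j%:R| <= 1 ->
        `|f x - f (nd n j)| <= h /\ `|g x - g (nd n j)| <= h].
Proof.
have [M [phi [psi [cphi cpsi psiK phiK]]]] := mP.
pose d x y : R := mdist (phi x) (phi y).
have dC x y : d x y = d y x by exact: metric_sym.
have dT x y z : d x z <= d x y + d y z by exact: metric_triangle.
have dn x (r : R) : 0 < r -> \forall y \near x, d x y < r.
  move=> r0; have H : nbhs x (phi @^-1` ball (phi x) r).
    by apply: cphi; exact: nbhsx_ballx.
  by apply: filterS H => y; rewrite /= ballEmdist.
have [x0 _] := continuum_nonempty P.
pose r n : R := n.+1%:R^-1.
have r0 n : 0 < r n by rewrite invr_gt0.
have cov n : exists L (w : P -> R) (nd : nat -> P), [/\ continuous w,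
    forall x, 0 <= w x <= L%:R &
    forall x j, (j <= L)%N -> `|w x - j%:R| <= 1 -> d x (nd j) <= 6 * r n].
  have [||m [c hc]] := @compact_finite_cover P P (fun x => [set y | d x y < r n]^°) x0
      (@continuum_compact P).
  - by move=> x; exact: open_interior.
  - by move=> x; exists x; exact: dn.
  have [L [w [nd [cw wL H]]]] := chain_map R (@continuum_compact P)
    (@continuum_hausdorff P) chP x0 hc.
  exists L, w, nd; split=> // x j jL wj.
  have := H d (2 * r n); rewrite mulr_ge0 ?(ltW (r0 n))// => /(_ isT dC dT) H'.
  have -> : 6 * r n = 3 * (2 * r n) by ring.
  apply: H' => // i y z /interior_subset/= h1 /interior_subset/= h2.
  by have := dT y (c i) z; rewrite (dC y (c i)); lra.
have /choice[L /choice[w /choice[nd H]]] := cov.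
exists L, w, nd; split; [by move=> n; have [] := H n|by move=> n; have [] := H n|].
have unif (f : P -> R) (h : R) : continuous f -> 0 < h ->
    exists2 s : R, 0 < s & forall x y, d x y < s -> `|f x - f y| < h.
  move=> cf h0.
  have [|s s0 hs] := uniform_on_compact (@continuum_compact P) dT dC dn _ h0 (f := f);
    last by exists s => // x y; exact: hs.
  move=> x t t0.
  have : nbhs (phi x) [set m | `|f x - f (psi m)| < t].
    have cfp : continuous (f \o psi).
      by move=> m; apply: continuous_comp; [exact: cpsi|exact: cf].
    have /cvgrPdist_lt/(_ _ t0) := cfp (phi x).
    by rewrite /= psiK.
  rewrite nbhs_ballP => -[s /= s0 hs]; exists s => // y dy.
  by have := hs (phi y); rewrite /= psiK ballEmdist; apply.
move=> f g h cf cg h0.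
have [s1 s10 hs1] := unif f h cf h0; have [s2 s20 hs2] := unif g h cg h0.
pose s := Num.min s1 s2; have s0 : 0 < s by rewrite lt_min s10.
pose n := Num.truncn (6 / s).
have [_ _ Hn] := H n; exists n => x j jL wj.
have : d x (nd n j) < s.
  apply: le_lt_trans (Hn _ _ jL wj) _.
  by rewrite /r ltr_pdivrMr// -ltr_pdivrMl// mulrC truncnS_gt.
by rewrite /s lt_min => /andP[/hs1/ltW h1 /hs2/ltW h2].
Qed.

Lemma pl_close (z z' : nat -> R) L t (h : R) : 0 <= t <= L%:R ->
  (forall j, (j <= L)%N -> `|z j - z' j| <= h) -> `|pl z L t - pl z' L t| <= h.
Proof.
move=> /andP[t0 tL] H.
have [j [j' [a [jL j'L _ /andP[a0 a1] [_ _ E]]]]] := plP t0 tL.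
rewrite !E; have := H j jL; have := H j' j'L; rewrite !ler_norml => /andP[? ?] /andP[? ?].
by apply/andP; split; nra.
Qed.

Lemma ratr_near (x h : R) : 0 < h -> exists q : rat, `|x - ratr q| <= h.
Proof.
move=> h0; have /rat_in_itvoo[q] : x - h < x + h by lra.
rewrite in_itv/= => /andP[q1 q2]; exists q.
by rewrite ler_norml; apply/andP; split; lra.
Qed.

(** The functions are piecewise linear in a chain coordinate with rational node values.
    Interpolation and rounding cost [h / 4] each, for the real and for the imaginary part. *)
Lemma dense_sequence : exists D : nat -> cfun R P, forall (f : cfun R P) (h : R),
  0 < h -> exists i, supnorm (f - D i) <= h.
Proof.
have [L [w [nd [cw wL H]]]] := fine_chains.
have cpl n (z : nat -> R) : continuous (fun x => pl z (L n) (w n x)).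
  by move=> x; apply: (@continuous_comp _ _ _ (w n) (pl z (L n)) x);
    [exact: cw|exact: pl_continuous].
pose q (s : seq rat) j : R := ratr (nth 0 s j).
pose F (t : nat * (seq rat * seq rat)) : cfun R P :=
  cfun_of (cpl t.1 (q t.2.1)) (cpl t.1 (q t.2.2)).
exists (fun i => if unpickle i is Some t then F t else 0) => f h h0.
have h40 : 0 < h / 4 by rewrite divr_gt0.
have near (u : P -> R) n : (forall x j, (j <= L n)%N -> `|w n x - j%:R| <= 1 ->
      `|u x - u (nd n j)| <= h / 4) ->
    exists s, forall x, `|u x - pl (q s) (L n) (w n x)| <= h / 2.
  move=> hu; have /choice[r hr] j := ratr_near (u (nd n j)) h40.
  exists (mkseq r (L n).+1) => x.
  have h1 := pl_approx (wL n x) (hu x).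
  have h2 : `|pl (fun j => u (nd n j)) (L n) (w n x) -
      pl (q (mkseq r (L n).+1)) (L n) (w n x)| <= h / 4.
    by apply: pl_close => // j jL; rewrite /q nth_mkseq.
  have := ler_distD (pl (fun j => u (nd n j)) (L n) (w n x)) (u x)
    (pl (q (mkseq r (L n).+1)) (L n) (w n x)); lra.
have [n hn] := H _ _ _ (@continuous_Re _ _ f) (@continuous_Im _ _ f) h40.
have [s hs] := near _ n (fun x j jL wj => proj1 (hn x j jL wj)).
have [t ht] := near _ n (fun x j jL wj => proj2 (hn x j jL wj)).
exists (pickle (n, (s, t))); rewrite pickleK; apply: supnorm_le => x.
apply: le_trans (normc_le_ReIm _) _.
have := hs x; have := ht x; rewrite !raddfB/=; lra.
Qed.
End Separable.

(** * Quantifier-free formulas evaluated at points *)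

Lemma nbhs_rowP (R : realType) n (v : 'rV[R]_n) (P : set 'rV[R]_n) : nbhs v P ->
  exists2 e : R, 0 < e &
    forall w : 'rV[R]_n, (forall i, `|v ord0 i - w ord0 i| < e) -> P w.
Proof.
move=> /nbhs_ballP[e /= e0 H]; exists e => // w hw; apply: H.
by split=> // i j; rewrite ord1; exact: hw.
Qed.

Lemma finite_common (R : realType) n (Q : 'I_n -> R -> Prop) :
  (forall i s t, s <= t -> Q i t -> Q i s) ->
  (forall i, exists2 d : R, 0 < d & Q i d) -> exists2 d : R, 0 < d & forall i, Q i d.
Proof.
move=> anti ex.
have /choice[d /all_and2[d0 Qd]] i : exists d : R, 0 < d /\ Q i d.
  by have [d d0 Qd] := ex i; exists d.
exists (\big[Num.min/1]_(i < n) d i).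
  by elim/big_ind: _ => // x y x0 y0; rewrite lt_min x0.
by move=> i; apply: anti (Qd i); exact: bigmin_le_cond.
Qed.

Section PointEvaluation.
Variable R : realType.
Local Notation points := (positive -> nat -> R[i]).
Implicit Types (z : points) (Z : set points).

Fixpoint point_term z k (t : Lterm k) : R[i] :=
  match t with
  | Sym k n => z k n
  | TZero => 0
  | TOne => 1
  | TAdd _ _ t u => point_term z t + point_term z u
  | TMul _ _ t u => point_term z t * point_term z u
  | TStar _ t => conjc (point_term z t)
  | TScale q _ _ _ t => gauss R q * point_term z t
  | TIncl _ _ _ t => point_term z t
  end.

(** The sort is counted in, so that only finitely many symbols have rank at most [N]. *)
Definition symbol_rank (k : positive) (n : nat) : nat := maxn (Pos.to_nat k) n.

Fixpoint term_rank k (t : Lterm k) : nat :=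
  match t with
  | Sym k n => symbol_rank k n
  | TZero => 0
  | TOne => 0
  | TAdd _ _ t u => maxn (term_rank t) (term_rank u)
  | TMul _ _ t u => maxn (term_rank t) (term_rank u)
  | TStar _ t => term_rank t
  | TScale _ _ _ _ t => term_rank t
  | TIncl _ _ _ t => term_rank t
  end.

Fixpoint formula_rank (phi : qfformula R) : nat :=
  match phi with
  | Dist _ t u => maxn (term_rank t) (term_rank u)
  | Conn n _ a => \max_(i < n) formula_rank (a i)
  end.

(** Quotient 0 also falls on sort 1, as [Pos.of_nat 0] is 1: codes may repeat, and what matters is
    that they reach every symbol of rank at most [N]. *)
Definition symbol_code N (i : nat) : positive * nat :=
  (Pos.of_nat (i %/ N.+1), (i %% N.+1)%N).

Arguments symbol_code : simpl never.

Lemma symbol_codeP N k n : (symbol_rank k n <= N)%N ->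
  exists i : 'I_(N.+1 * N.+1), symbol_code N i = (k, n).
Proof.
rewrite /symbol_rank geq_max => /andP[kN nN].
have lt : (Pos.to_nat k * N.+1 + n < N.+1 * N.+1)%N by nia.
exists (Ordinal lt); rewrite /symbol_code /= divnMDl// divn_small ?addn0 ?ltnS//.
by rewrite Pos2Nat.id modnMDl modn_small// ltnS.
Qed.

Definition in_balls z : Prop := forall k n, Normc.normc (z k n) <= radius R k.

Definition close_upto N (d : R) z z' : Prop := forall k n,
  (symbol_rank k n <= N)%N -> Normc.normc (z k n - z' k n) <= d.

Lemma radius_ge0 k : 0 <= radius R k. Proof. exact: ler0n. Qed.

Lemma point_term_bound z k (t : Lterm k) : in_balls z ->
  Normc.normc (point_term z t) <= radius R k.
Proof.
move=> hz; elim: t => /=.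
- by [].
- by rewrite expr0n addr0 sqrtr0 radius_ge0.
- by rewrite expr1n expr0n addr0 sqrtr1 /radius ler1n.
- move=> l m t ht u hu; rewrite /radius Pos2Nat.inj_add natrD.
  exact: le_trans (le_normcD _ _) (lerD ht hu).
- move=> l m t ht u hu; rewrite /radius Pos2Nat.inj_mul natrM Normc.normcM.
  by apply: ler_pM; rewrite ?normc_ge0.
- by move=> l t ht; rewrite normc_conj.
- move=> q l m h t ht; rewrite Normc.normcM.
  rewrite -(@ler_pXn2r _ 2) ?nnegrE ?mulr_ge0 ?normc_ge0 ?radius_ge0// exprMn.
  move: h; rewrite /scale_fits -(ler_rat R) rmorphM rmorphD !rmorphXn/= !ratr_nat.
  apply: le_trans; rewrite /Normc.normc /gauss sqr_sqrtr ?addr_ge0 ?sqr_ge0//.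
  rewrite ler_wpM2l ?addr_ge0 ?sqr_ge0// ler_pXn2r ?nnegrE ?radius_ge0//.
  exact: normc_ge0.
- move=> l m h t ht; apply: le_trans ht _; rewrite ler_nat; apply/ssrnat.leP.
  by apply/Pos2Nat.inj_le/Pos.leb_le.
Qed.

Lemma point_term_lipschitz k (t : Lterm k) : exists2 C : R, 0 <= C &
  forall z z' N d, in_balls z -> in_balls z' -> (term_rank t <= N)%N -> 0 <= d ->
    close_upto N d z z' -> Normc.normc (point_term z t - point_term z' t) <= C * d.
Proof.
elim: t => /=.
- by move=> l n; exists 1 => // z z' N d _ _ hN _; rewrite mul1r; exact.
- by exists 0 => // *; rewrite mul0r !subrr expr0n addr0 sqrtr0.
- by exists 0 => // *; rewrite mul0r !subrr expr0n addr0 sqrtr0.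
- move=> l m t [C C0 hC] u [D D0 hD]; exists (C + D); first exact: addr_ge0.
  move=> z z' N d hz hz'; rewrite geq_max => /andP[tN uN] d0 hcl.
  rewrite opprD addrACA mulrDl; apply: le_trans (le_normcD _ _) (lerD _ _).
    exact: hC hcl.
  exact: hD hcl.
- move=> l m t [C C0 hC] u [D D0 hD].
  exists (radius R m * C + radius R l * D); first by rewrite addr_ge0// mulr_ge0 ?radius_ge0.
  move=> z z' N d hz hz'; rewrite geq_max => /andP[tN uN] d0 hcl.
  set a := point_term z t; set b := point_term z u.
  set a' := point_term z' t; set b' := point_term z' u.
  have -> : a * b - a' * b' = (a - a') * b + a' * (b - b') by ring.
  rewrite [leRHS]mulrDl; apply: le_trans (le_normcD _ _) (lerD _ _); rewrite Normc.normcM.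
    rewrite mulrC -mulrA; apply: ler_pM; rewrite ?normc_ge0//.
      exact: point_term_bound.
    exact: hC hcl.
  rewrite -mulrA; apply: ler_pM; rewrite ?normc_ge0//.
    exact: point_term_bound.
  exact: hD hcl.
- move=> l t [C C0 hC]; exists C => // z z' N d hz hz' tN d0 hcl.
  by rewrite -rmorphB normc_conj; exact: hC hcl.
- move=> q l m h t [C C0 hC]; exists (Normc.normc (gauss R q) * C).
    by rewrite mulr_ge0// normc_ge0.
  move=> z z' N d hz hz' tN d0 hcl; rewrite -mulrBr Normc.normcM -mulrA.
  by rewrite ler_wpM2l ?normc_ge0//; exact: hC hcl.
- by move=> l m h t [C C0 hC]; exists C.
Qed.

(* The atomic formulas are the suprema over [Z] of their pointwise values. *)
Record represented_by (M : Ldata R) (c : valuation M) Z : Prop := RepresentedBy {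
  rep_balls : forall z, Z z -> in_balls z;
  rep_le : forall k (t u : Lterm k) z, Z z ->
    Normc.normc (point_term z t - point_term z u) <=
      Ldist (term_val c t) (term_val c u);
  rep_attain : forall k (t u : Lterm k) (e : R), 0 < e -> exists2 z, Z z &
    Ldist (term_val c t) (term_val c u) - e <=
      Normc.normc (point_term z t - point_term z u)
}.

(** Sets are compared without matching parameters, so a condition on functions survives a change of
    the parameter that nearly keeps the set of joint values. *)
Definition hausdorff_close N (d : R) Z Z' : Prop :=
  (forall z, Z z -> exists2 z', Z' z' & close_upto N d z z') /\
  (forall z', Z' z' -> exists2 z, Z z & close_upto N d z z').

Lemma hausdorff_close_le N N' (d d' : R) Z Z' : (N <= N')%N -> d' <= d ->
  hausdorff_close N' d' Z Z' -> hausdorff_close N d Z Z'.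
Proof.
move=> NN dd [H1 H2]; split=> z Zz.
  have [z' Zz' h] := H1 z Zz; exists z' => // k n kn.
  by apply: le_trans dd; apply: h; exact: leq_trans NN.
have [z' Zz' h] := H2 z Zz; exists z' => // k n kn.
by apply: le_trans dd; apply: h; exact: leq_trans NN.
Qed.

Lemma closeC N d z z' : close_upto N d z z' -> close_upto N d z' z.
Proof. by move=> h k n kn; rewrite -normcN opprB; exact: h. Qed.

Lemma atomic_close k (t u : Lterm k) : exists2 C : R, 0 <= C &
  forall (M M' : Ldata R) (c : valuation M) (c' : valuation M') Z Z' N d,
    represented_by c Z -> represented_by c' Z' ->
    (maxn (term_rank t) (term_rank u) <= N)%N -> 0 <= d ->
    hausdorff_close N d Z Z' ->
    `|Ldist (term_val c t) (term_val c u) - Ldist (term_val c' t) (term_val c' u)|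
       <= C * d.
Proof.
have [C C0 hC] := point_term_lipschitz t; have [D D0 hD] := point_term_lipschitz u.
exists (C + D); first exact: addr_ge0.
have half (M M' : Ldata R) (c : valuation M) (c' : valuation M') Z Z' N d :
    represented_by c Z -> represented_by c' Z' ->
    (maxn (term_rank t) (term_rank u) <= N)%N -> 0 <= d ->
    (forall z, Z z -> exists2 z', Z' z' & close_upto N d z z') ->
    Ldist (term_val c t) (term_val c u) <=
      Ldist (term_val c' t) (term_val c' u) + (C + D) * d.
  move=> rZ rZ'; rewrite geq_max => /andP[tN uN] d0 H.
  apply/ler_addgt0Pr => e e0; rewrite -lerBlDr.
  have [z Zz hz] := rep_attain rZ t u e0; apply: le_trans hz _.
  have [z' Zz' cl] := H z Zz.
  have -> : point_term z t - point_term z u = (point_term z' t - point_term z' u) +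
     ((point_term z t - point_term z' t) - (point_term z u - point_term z' u)) by ring.
  apply: le_trans (le_normcD _ _) (lerD _ _); first exact: (rep_le rZ').
  rewrite mulrDl; apply: le_trans (le_normcD _ _) (lerD _ _).
    by apply: hC cl => //; [exact: rep_balls rZ _ _|exact: rep_balls rZ' _ _].
  rewrite normcN.
  by apply: hD cl => //; [exact: rep_balls rZ _ _|exact: rep_balls rZ' _ _].
move=> M M' c c' Z Z' N d rZ rZ' hN d0 [H1 H2].
have h1 := half _ _ _ _ _ _ _ _ rZ rZ' hN d0 H1.
have h2 : Ldist (term_val c' t) (term_val c' u) <=
      Ldist (term_val c t) (term_val c u) + (C + D) * d.
  apply: (half _ _ _ _ _ _ _ _ rZ' rZ hN d0) => z' /H2[z Zz cl].
  by exists z => //; exact: closeC.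
by rewrite ler_norml; apply/andP; split; lra.
Qed.

Lemma formula_close (M : Ldata R) (c : valuation M) Z (phi : qfformula R) (h : R) :
  represented_by c Z -> built_with (@all_connectives R) phi -> 0 < h ->
  exists2 d : R, 0 < d & forall (M' : Ldata R) (c' : valuation M') Z' N,
    represented_by c' Z' -> (formula_rank phi <= N)%N -> hausdorff_close N d Z Z' ->
    `|formula_val c phi - formula_val c' phi| < h.
Proof.
move=> rZ; elim: phi h => [k t u|n f a IH] h /=.
  move=> _ h0; have [C C0 hC] := atomic_close t u.
  have C10 : 0 < C + 1 by rewrite ltr_wpDl.
  exists (h / (C + 1)); first by rewrite divr_gt0.
  move=> M' c' Z' N rZ' hN cl.
  have d0 : 0 <= h / (C + 1) by rewrite divr_ge0 ?ltW.
  apply: le_lt_trans (hC _ _ _ _ _ _ _ _ rZ rZ' hN d0 cl) _.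
  by rewrite mulrCA gtr_pMr// ltr_pdivrMr// mul1r ltrDl.
move=> [cf ba] h0.
have /cvgrPdist_lt/(_ _ h0)/nbhs_rowP[e e0 he] := cf (\row_i formula_val c (a i)).
have [d d0 hd] : exists2 d : R, 0 < d & forall i,
    forall (M' : Ldata R) (c' : valuation M') Z' N,
    represented_by c' Z' -> (formula_rank (a i) <= N)%N -> hausdorff_close N d Z Z' ->
    `|formula_val c (a i) - formula_val c' (a i)| < e.
  apply: (@finite_common R n (fun i d => forall (M' : Ldata R) (c' : valuation M') Z' N,
    represented_by c' Z' -> (formula_rank (a i) <= N)%N -> hausdorff_close N d Z Z' ->
    `|formula_val c (a i) - formula_val c' (a i)| < e)).
    move=> i s t st H M' c' Z' N r' hN cl; apply: (H _ _ _ _ r' hN).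
    exact: hausdorff_close_le cl.
  by move=> i; exact: IH.
exists d => // M' c' Z' N r' hN cl; apply: he => i; rewrite !mxE.
apply: (hd _ _ _ _ _ r' _ cl); apply: leq_trans hN.
exact: (leq_bigmax i).
Qed.

(** [N] and [d] are fixed before the second structure, which allows comparing solutions in an
    arbitrary algebra with solutions in [C(P)]. *)
Lemma conditions_open (M : Ldata R) (c : valuation M) Z (q : expressions R) :
  represented_by c Z -> finite_set q ->
  (forall phi r, q (phi, r) -> built_with (@all_connectives R) phi) ->
  (forall phi r, q (phi, r) -> formula_val c phi < r) ->
  exists N (d : R), 0 < d /\ forall (M' : Ldata R) (c' : valuation M') Z',
    represented_by c' Z' -> hausdorff_close N d Z Z' ->
    forall phi r, q (phi, r) -> formula_val c' phi < r.
Proof.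
move=> rZ /(@finite_seqP {classic (qfformula R * R)%type})[s qE] bq hq.
have inq i : q (tnth (in_tuple s) i) by rewrite qE /= mem_tnth.
pose F (i : 'I_(size s)) := (tnth (in_tuple s) i : qfformula R * R).
pose N := \max_(i < size s) formula_rank (F i).1.
have [d d0 hd] : exists2 d : R, 0 < d & forall i : 'I_(size s),
    forall (M' : Ldata R) (c' : valuation M') Z',
    represented_by c' Z' -> hausdorff_close N d Z Z' ->
    formula_val c' (F i).1 < (F i).2.
  apply: (@finite_common R (size s) (fun i d => forall (M' : Ldata R) (c' : valuation M') Z',
    represented_by c' Z' -> hausdorff_close N d Z Z' -> formula_val c' (F i).1 < (F i).2)).
    move=> i u t ut H M' c' Z' r' cl; apply: (H _ _ _ r').
    exact: hausdorff_close_le cl.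
  move=> i; have qF : q ((F i).1, (F i).2) by rewrite -surjective_pairing; exact: inq.
  have h0 : 0 < (F i).2 - formula_val c (F i).1 by rewrite subr_gt0; exact: hq.
  have [d d0 hd] := formula_close rZ (bq _ _ qF) h0; exists d => // M' c' Z' r' cl.
  have := hd _ _ _ N r' _ cl; rewrite /N (leq_bigmax i) => /(_ isT).
  by rewrite ltr_norml => /andP[h1 _]; lra.
exists N, d; split=> // M' c' Z' r' cl phi r.
rewrite qE /= => /(tnthP (in_tuple s))[i E].
by have := hd i _ _ _ r' cl; rewrite /F -E.
Qed.
End PointEvaluation.

Section Points.
Variable R : realType.
Local Notation points := (positive -> nat -> R[i]).

Definition algebra_point (A : cstarAlgebra R) (c : valuation (dissection A))
    (chi : A -> R[i]) : points :=
  fun k n => chi (sval (c k n : cball A k)).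

Lemma character_term (A : cstarAlgebra R) (c : valuation (dissection A)) chi k
    (t : Lterm k) : is_character chi ->
  chi (sval (term_val c t : cball A k)) = point_term (algebra_point c chi) t.
Proof.
move=> cchi; have [cD cM c1 cZ cJ] := cchi; elim: t => //=.
- by rewrite -(scale0r (1 : A)) cZ mul0r.
- by move=> l m t <- u <-; exact: cD.
- by move=> l m t <- u <-; exact: cM.
- by move=> l t <-; exact: cJ.
- by move=> q l m h t <-; exact: cZ.
Qed.

(** Any norming set of characters will do: all characters for an abstract algebra, the evaluations
    at points for [C(P)]. *)
Lemma algebra_represented (A : cstarAlgebra R) (c : valuation (dissection A))
    (D : set (A -> R[i])) :
  (forall chi, D chi -> is_character chi) ->
  (forall chi x, D chi -> Normc.normc (chi x) <= cnorm x) ->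
  (forall x (e : R), 0 < e -> exists2 chi, D chi & cnorm x - e <= Normc.normc (chi x)) ->
  represented_by c [set algebra_point c chi | chi in D].
Proof.
move=> cD leD attD; split.
- move=> _ [chi /leD le <-] k n; apply: le_trans (le _) _.
  exact: (svalP (c k n : cball A k)).
- move=> k t u _ [chi Dchi <-]; have cchi := cD _ Dchi.
  rewrite -!character_term// -charB//; exact: leD.
- move=> k t u e e0.
  have [chi Dchi h] := attD (sval (term_val c t : cball A k) - sval (term_val c u : cball A k)) e e0.
  exists (algebra_point c chi); first by exists chi.
  have cchi := cD _ Dchi.
  by rewrite -!character_term// -charB.
Qed.

Lemma abelian_represented (A : cstarAlgebra R) (c : valuation (dissection A)) :
  is_abelian A ->
  represented_by c [set algebra_point c chi | chi in [set chi | is_character chi]].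
Proof.
move=> hA; apply: algebra_represented => //.
- by move=> chi x; exact: (@character_le _ _ hA chi x).
- by move=> x e; exact: (@character_attains _ _ hA x e).
Qed.

Variable P : continuum.
Local Notation CP := (C_algebra R P).

Definition function_points (c : valuation (dissection CP)) : set points :=
  [set algebra_point c (fun f : CP => f x) | x in [set: P]].

Lemma evaluation_character (x : P) : is_character (fun f : CP => (f : cfun R P) x).
Proof. by []. Qed.

Lemma functions_represented (c : valuation (dissection CP)) :
  represented_by c (function_points c).
Proof.
rewrite (_ : function_points c = [set algebra_point c chi | chi in
  [set (fun f : CP => (f : cfun R P) x) | x in [set: P]]]).
  apply: algebra_represented.
  - by move=> _ [x _ <-]; exact: evaluation_character.
  - by move=> _ f [x _ <-]; exact: le_supnorm.
  - move=> f e e0; have [_ [x _ <-] h] := sup_adherent e0 (supnorm_has_sup f).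
    by exists (fun f : CP => (f : cfun R P) x); [exists x|exact: ltW].
by rewrite image_comp.
Qed.

Lemma CP_abelian : is_abelian CP.
Proof. by move=> f g; exact: mulrC. Qed.

Lemma CP_projectionless : is_projectionless CP.
Proof.
move=> p sp pp.
have val x : (p : cfun R P) x = 0 \/ (p : cfun R P) x = 1.
  have : (p : cfun R P) x * (p : cfun R P) x = (p : cfun R P) x.
    by rewrite -[in RHS]pp.
  move/eqP; rewrite -subr_eq0 -{3}[_ x]mulr1 -mulrBr mulf_eq0 subr_eq0.
  by move=> /orP[/eqP|/eqP]; [left|right].
have [x0 _] := continuum_nonempty P.
have con y : (p : cfun R P) y = (p : cfun R P) x0.
  apply: contrapT => ne.
  pose f x := complex.Re ((p : cfun R P) x).
  have fv x : f x = 0 \/ f x = 1 by rewrite /f; case: (val x) => ->; [left|right].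
  have fne : f y <> f x0.
    by move=> e; apply: ne; move: e; rewrite /f; case: (val y) => ->; case: (val x0) => -> //= /eqP;
      rewrite ?oner_eq0 // eq_sym oner_eq0.
  have [z fz] : exists z, f z = 2^-1.
    have cf := @continuous_Re R P p.
    have [] := fv y; have [] := fv x0 => h0 hy.
    - by case: fne; rewrite h0 hy.
    - by apply: (connected_ivt (@continuum_connected P) cf (x := y) (y := x0));
        rewrite -/(f _) ?hy ?h0; lra.
    - by apply: (connected_ivt (@continuum_connected P) cf (x := x0) (y := y));
        rewrite -/(f _) ?hy ?h0; lra.
    - by case: fne; rewrite h0 hy.
  by have [] := fv z; rewrite fz; lra.
have [h|h] := val x0; [left|right]; apply: cfun_ext => y; rewrite con h //.
Qed.

Lemma CP_models : models (T_projectionless_abelian R) (dissection CP).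
Proof.
split; first exact: dissection_structure.
move=> phi r [_ H] v; apply: H; exists CP; split => //.
  exact: CP_abelian.
exact: CP_projectionless.
Qed.
End Points.

(** * Satisfiability in the algebra of the pseudoarc *)

Section Margin.
Variable R : realType.

Lemma continuous_sub_from (T : topologicalType) (a : R) (f : T -> R) :
  continuous f -> continuous (fun x => a - f x).
Proof. by move=> cf x; apply: cvgB; [exact: cvg_cst|exact: cf]. Qed.

(* The margin is positive exactly where all the conditions hold, and being a
   single formula it is what the universal theory can speak about. *)
Fixpoint margin (s : seq (qfformula R * R)) : qfformula R :=
  if s is e :: s' then
    Conn (fun x : 'rV[R]_2 => Num.min (e.2 - x ord0 ord0) (x ord0 ord_max))
      (fun i => if i == ord0 then e.1 else margin s')
  else Conn (fun _ : 'rV[R]_0 => 1) (fun _ => Dist R TOne TOne).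

Lemma margin_gt0 (M : Ldata R) (c : valuation M) s :
  (0 < formula_val c (margin s)) = all (fun e => formula_val c e.1 < e.2) s.
Proof.
elim: s => [|e s IH] /=; first by rewrite ltr01.
by rewrite lt_min !mxE/= subr_gt0 IH.
Qed.

Lemma margin_built s : all (fun e => `[< built_with (@all_connectives R) e.1 >]) s ->
  built_with (@all_connectives R) (margin s).
Proof.
elim: s => [|e s IH] /=.
  move=> _; split=> //.
  have c0 : continuous (fun _ : 'rV[R]_0 => 1 : R) by move=> x; apply: cst_continuous.
  exact: c0.
move=> /andP[/asboolP be /IH bs]; split; last by move=> i; case: ifP.
have cc (i : 'I_2) : continuous (fun x : 'rV[R]_2 => x ord0 i).
  by move=> x; exact: coord_continuous.
move=> x; apply: (@continuous_min R _ (fun x : 'rV[R]_2 => e.2 - x ord0 ord0)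
  (fun x : 'rV[R]_2 => x ord0 ord_max)); last exact: cc.
by apply: continuous_sub_from; exact: cc.
Qed.

Lemma condition_built (F : connectives R) T (q : expressions R) :
  restricted_family F -> condition F T q ->
  forall phi r, q (phi, r) -> built_with (@all_connectives R) phi.
Proof.
move=> hF [_ bq _] phi r /bq; elim: phi => //= n f a IH [Ff ba].
by split; [exact: (restricted_continuous hF Ff)|move=> i; exact: IH].
Qed.

(** If no algebra satisfied [q], the condition that the margin is at most 0 would hold in all of
    them and so belong to [T]; but the margin is positive in the given model. *)
Lemma satisfied_in_algebra (M : Ldata R) (c : valuation M) (q : expressions R) :
  finite_set q -> (forall phi r, q (phi, r) -> built_with (@all_connectives R) phi) ->
  satisfies (T_projectionless_abelian R) q c ->
  exists (A : cstarAlgebra R) (v : valuation (dissection A)),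
    [/\ is_abelian A, is_projectionless A &
      forall phi r, q (phi, r) -> formula_val v phi < r].
Proof.
move=> /(@finite_seqP {classic (qfformula R * R)%type})[s qE] bq [[_ mT] hq].
have inq (e : qfformula R * R) : e \in s -> q e by move=> es; rewrite qE.
apply: contrapT => noA.
have pos : 0 < formula_val c (margin s).
  by rewrite margin_gt0; apply/(@allP {classic (qfformula R * R)%type}) => -[phi r] /inq; exact: hq.
have : formula_val c (margin s) <= 0; last by rewrite leNgt pos.
apply: mT; split.
  apply: margin_built; apply/(@allP {classic (qfformula R * R)%type}) => -[phi r] /inq.
  by move=> /bq h; apply/asboolP.
move=> _ [A [aA pA ->]] v /=; rewrite leNgt; apply/negP; rewrite margin_gt0.
move=> /(@allP {classic (qfformula R * R)%type}) H.
by apply: noA; exists A, v; split=> // phi r; rewrite qE => /H.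
Qed.
End Margin.

Section ComplexPl.
Variable R : realType.

Definition cpl (z : nat -> R[i]) L (t : R) : R[i] :=
  (pl (fun j => complex.Re (z j)) L t +i* pl (fun j => complex.Im (z j)) L t)%C.

Lemma cplP L (t : R) : 0 <= t <= L%:R -> exists j j' (a : R),
  [/\ (j <= L)%N, (j' <= L)%N, (j <= j' <= j.+1)%N, 0 <= a <= 1 &
   [/\ `|t - j%:R| <= 1, `|t - j'%:R| <= 1 &
     forall z, cpl z L t = (1 - a)%:C * z j + a%:C * z j']].
Proof.
move=> /andP[t0 tL]; have [j [j' [a [h1 h2 h3 h4 [h5 h6 E]]]]] := plP t0 tL.
exists j, j', a; split=> //; split=> // z; rewrite /cpl !E.
case: (z j) => x y; case: (z j') => x' y' /=.
by apply/eqP; rewrite eq_complex/=; apply/andP; split; apply/eqP; ring.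
Qed.

Lemma cpl_nat z L j : (j <= L)%N -> cpl z L j%:R = z j.
Proof. by move=> jL; rewrite /cpl !pl_nat//; case: (z j). Qed.

Lemma normc_convex (z z' w : R[i]) (a d : R) : 0 <= a <= 1 ->
  Normc.normc (z - w) <= d -> Normc.normc (z' - w) <= d ->
  Normc.normc ((1 - a)%:C * z + a%:C * z' - w) <= d.
Proof.
move=> /andP[a0 a1] hz hz'.
have -> : (1 - a)%:C * z + a%:C * z' - w = (1 - a)%:C * (z - w) + a%:C * (z' - w).
  by rewrite rmorphB rmorph1; ring.
apply: le_trans (le_normcD _ _) _; rewrite !Normc.normcM !normc_real.
by rewrite (ger0_norm a0) ger0_norm ?subr_ge0//; nra.
Qed.

Lemma cpl_near z L (t : R) w d : 0 <= t <= L%:R ->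
  (forall j, (j <= L)%N -> `|t - j%:R| <= 1 -> Normc.normc (z j - w) <= d) ->
  Normc.normc (cpl z L t - w) <= d.
Proof.
move=> /cplP[j [j' [a [jL j'L _ a01 [hj hj' ->]]]]] H.
by apply: normc_convex => //; apply: H.
Qed.

Lemma cpl_bound z L (t d : R) : 0 <= t <= L%:R ->
  (forall j, (j <= L)%N -> Normc.normc (z j) <= d) -> Normc.normc (cpl z L t) <= d.
Proof.
move=> tL H; rewrite -[cpl _ _ _]subr0; apply: cpl_near => // j jL _.
by rewrite subr0; exact: H.
Qed.

Lemma continuous_pl (X : topologicalType) z L (t : X -> R) : continuous t ->
  continuous (fun x => pl z L (t x)).
Proof. by move=> ct x; exact: (continuous_comp (ct x) (@pl_continuous R z L (t x))). Qed.

Definition cpl_fun (P : continuum) z L (t : P -> R) (ct : continuous t) : cfun R P :=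
  cfun_of (@continuous_pl _ (fun j => complex.Re (z j)) L t ct)
    (@continuous_pl _ (fun j => complex.Im (z j)) L t ct).

Lemma cpl_funE (P : continuum) z L (t : P -> R) (ct : continuous t) x :
  cpl_fun z L ct x = cpl z L (t x).
Proof. by []. Qed.
End ComplexPl.

Section InPseudoarc.
Variables (R : realType) (P : continuum).
Hypotheses (chP : chainable P) (ndP : Defs.nondegenerate P).
Local Notation CP := (C_algebra R P).

Definition valuation_of (G : positive -> nat -> cfun R P)
    (hG : forall k n, supnorm (G k n) <= radius R k) : valuation (dissection CP) :=
  fun k n => exist (fun f : CP => cnorm f <= radius R k) (G k n) (hG k n).

(** The coordinate of the empty family of functions, rescaled; connectedness provides the
    intermediate integers. *)
Lemma onto_segment L : exists t : P -> R, [/\ continuous t,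
  forall x, 0 <= t x <= L%:R & forall j, (j <= L)%N -> exists x, t x = j%:R].
Proof.
have [e [_ [_ [_ [_ [ce e1 [x em] [y ep] _]]]]]] :=
  @chain_coordinate R P (@continuum_compact P) (@continuum_hausdorff P) chP
    ndP 0 (fun _ _ => 0) 1 ltr01 (fun _ _ => cvg_cst _).
have L0 : 0 <= L%:R :> R by [].
have ct : continuous (fun x => (e x + 1) * (L%:R / 2)).
  by move=> z; apply: cvgM; [apply: cvgD; [exact: ce|exact: cvg_cst]|exact: cvg_cst].
exists (fun x => (e x + 1) * (L%:R / 2)); split=> //.
  by move=> z; have := e1 z; rewrite ler_norml => /andP[h1 h2]; apply/andP; split; nra.
move=> j jL; have jL' : j%:R <= L%:R :> R by rewrite ler_nat.
have j0 : 0 <= j%:R :> R by [].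
apply: (connected_ivt (@continuum_connected P) ct (x := x) (y := y)).
  by rewrite em; lra.
by rewrite ep; lra.
Qed.

(** The symbols become interpolations, along a map of [P] onto [[0, L]], of their values at the
    characters of the walk. At integers the point belongs to a character of the walk, and these come
    near all characters; in between it is within [d] of such a point, because consecutive characters
    differ by at most [d]. *)
Lemma satisfied_in_CP (A : cstarAlgebra R) (v : valuation (dissection A))
    (q : expressions R) : is_abelian A -> is_projectionless A -> finite_set q ->
  (forall phi r, q (phi, r) -> built_with (@all_connectives R) phi) ->
  (forall phi r, q (phi, r) -> formula_val v phi < r) ->
  exists c : valuation (dissection CP), forall phi r, q (phi, r) -> formula_val c phi < r.
Proof.
move=> aA pA fq bq hq.
have [N [d [d0 H]]] := conditions_open (abelian_represented v aA) fq bq hq.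
pose a (i : 'I_(N.+1 * N.+1)) :=
  sval (v (symbol_code N i).1 (symbol_code N i).2 : cball A _).
have [L [c [cc step net]]] := character_walk aA a pA d0.
have coded k n : (symbol_rank k n <= N)%N -> exists i, a i = sval (v k n : cball A k).
  by move=> /symbol_codeP[i Ei]; exists i; rewrite /a Ei.
have [t [ct tL tonto]] := onto_segment L.
pose G k n : cfun R P := if (symbol_rank k n <= N)%N then
  cpl_fun (fun j => c j (sval (v k n : cball A k))) L ct else 0.
have Gle k n : supnorm (G k n) <= radius R k.
  apply: supnorm_le => x; rewrite /G; case: ifP => _; last first.
    by rewrite [Normc.normc _]Normc.normc0 radius_ge0.
  rewrite cpl_funE; apply: cpl_bound => // j jL.
  apply: le_trans (svalP (v k n : cball A k)).
  exact: (@character_le _ _ aA _ (sval (v k n : cball A k)) (cc j)).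
exists (valuation_of Gle).
apply: (H _ _ _ (functions_represented (valuation_of Gle))); split.
  move=> _ [chi cchi <-]; have [j jL hj] := net chi cchi.
  have [x tx] := tonto j jL.
  exists (algebra_point (valuation_of Gle) (fun f : CP => (f : cfun R P) x)).
    by exists x.
  move=> k n kn; rewrite /algebra_point /= /G kn cpl_funE tx cpl_nat//.
  by have [i <-] := coded k n kn; exact: hj.
move=> _ [x _ <-].
have [j [j' [u [jL j'L jj' u01 [_ _ E]]]]] := cplP (tL x).
exists (algebra_point v (c j)); first by exists (c j) => //; exact: cc.
move=> k n kn; rewrite /algebra_point /= /G kn cpl_funE E.
have [i <-] := coded k n kn.
rewrite -normcN opprB; apply: normc_convex => //.
  by rewrite subrr Normc.normc0 ltW.
move: jj'; have [->|] := eqVneq j' j; first by rewrite subrr Normc.normc0 ltW.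
move=> ne jj'; have E' : j' = j.+1 by apply/eqP; move: jj' ne; rewrite eqn_leq; lia.
by rewrite E' -normcN opprB; apply: step; rewrite -E'.
Qed.

Lemma condition_in_CP (F : connectives R) (q : expressions R) :
  restricted_family F -> condition F (T_projectionless_abelian R) q ->
  exists c : valuation (dissection CP), forall phi r, q (phi, r) -> formula_val c phi < r.
Proof.
move=> hF qc; have bq := condition_built hF qc; have [fq _ [M [c sat]]] := qc.
have [A [v [aA pA hv]]] := satisfied_in_algebra fq bq sat.
exact: satisfied_in_CP hv.
Qed.
End InPseudoarc.

(** * Functions on an arc as terms in one symbol *)

Section TermLimits.
Variables (R : realType) (n0 : nat).
Local Notation points := (positive -> nat -> R[i]).
Implicit Types (z : points) (h : R -> R[i]).

Definition univariate k (t : Lterm k) : Prop :=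
  forall z z', z 1%positive n0 = z' 1%positive n0 -> point_term z t = point_term z' t.

Definition one_point (s : R[i]) : points :=
  fun k n => if Pos.eqb k 1 && (n == n0) then s else 0.

Lemma one_point_balls s : Normc.normc s <= 1 -> in_balls (one_point s).
Proof.
move=> s1 k n; rewrite /one_point; case: ifP => [/andP[/Pos.eqb_eq -> _]|_].
  exact: s1.
by rewrite Normc.normc0 radius_ge0.
Qed.

Lemma univariateE k (t : Lterm k) z : univariate t ->
  point_term z t = point_term (one_point (z 1%positive n0)) t.
Proof. by apply; rewrite /one_point Pos.eqb_refl eqxx. Qed.

Lemma univariate_lipschitz k (t : Lterm k) : univariate t -> exists2 C : R, 0 <= C &
  forall z z', in_balls z -> in_balls z' -> Normc.normc (point_term z t - point_term z' t)
    <= C * Normc.normc (z 1%positive n0 - z' 1%positive n0).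
Proof.
move=> ut; have [C C0 H] := point_term_lipschitz R t; exists C => // z z' bz bz'.
rewrite (univariateE z ut) (univariateE z' ut).
have r1 (w : points) : in_balls w -> Normc.normc (w 1%positive n0) <= 1.
  by move=> /(_ 1%positive n0).
apply: (H _ _ (term_rank t)); rewrite ?normc_ge0//; try by apply: one_point_balls; exact: r1.
move=> l n _; rewrite /one_point; case: ifP => // _.
by rewrite subrr Normc.normc0 normc_ge0.
Qed.

(** Terms offer no continuous functional calculus, only polynomials over [Q(i)]. The uniform limits
    form an algebra closed under absolute values, and this yields the piecewise linear functions. *)
Definition term_limit h : Prop := forall e : R, 0 < e ->
  exists k (t : Lterm k), univariate t /\ forall z s, -1 <= s <= 1 ->
    z 1%positive n0 = s%:C -> Normc.normc (point_term z t - h s) <= e.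

Lemma term_limit_ext h g : (forall s, -1 <= s <= 1 -> h s = g s) -> term_limit h ->
  term_limit g.
Proof.
move=> E H e /H[k [t [ut ht]]]; exists k, t; split=> // z s s1 zs.
by rewrite -E//; exact: ht.
Qed.

Lemma term_limit_bounded h : term_limit h -> exists2 B : R, 1 <= B &
  forall s, -1 <= s <= 1 -> Normc.normc (h s) <= B.
Proof.
move=> /(_ 1 ltr01)[k [t [ut H]]]; exists (1 + radius R k).
  by rewrite lerDl radius_ge0.
move=> s s1; have E : one_point (s%:C) 1%positive n0 = s%:C by rewrite /one_point Pos.eqb_refl eqxx.
have := H _ _ s1 E; rewrite -normcN opprB => h1.
have -> : h s = (h s - point_term (one_point s%:C) t) + point_term (one_point s%:C) t.
  by rewrite subrK.
apply: le_trans (le_normcD _ _) (lerD h1 _).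
apply: point_term_bound; apply: one_point_balls; rewrite normc_real ler_norml.
by move: s1 => /andP[-> ->].
Qed.

Lemma term_limit_closure h : (forall e : R, 0 < e -> exists2 g, term_limit g &
  forall s, -1 <= s <= 1 -> Normc.normc (g s - h s) <= e) -> term_limit h.
Proof.
move=> H e e0; have e20 : 0 < e / 2 by rewrite divr_gt0.
have [g lg hg] := H _ e20; have [k [t [ut ht]]] := lg _ e20.
exists k, t; split=> // z s s1 zs.
have -> : point_term z t - h s = (point_term z t - g s) + (g s - h s) by rewrite addrA subrK.
rewrite (splitr e); apply: le_trans (le_normcD _ _) (lerD _ _); first exact: ht.
exact: hg.
Qed.

Lemma term_limit_id : term_limit (fun s => s%:C).
Proof.
move=> e e0; exists 1%positive, (Sym 1%positive n0); split=> // z s _ /= ->.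
by rewrite subrr Normc.normc0 ltW.
Qed.

Lemma term_limit_cst (a : R[i]) : term_limit (fun=> a).
Proof.
move=> e e0; have e20 : 0 < e / 2 by rewrite divr_gt0.
have [q hq] := ratr_near (complex.Re a) e20; have [r hr] := ratr_near (complex.Im a) e20.
pose z : rat[i] := (q +i* r)%C.
have [l hl] : exists l, scale_fits z 1%positive l.
  pose m := Num.truncn (q ^+ 2 + r ^+ 2).
  exists (Pos.of_nat m.+1); rewrite /scale_fits Nat2Pos.id// /z /= expr1n mulr1.
  have h : q ^+ 2 + r ^+ 2 < m.+1%:R by exact: truncnS_gt.
  by apply: le_trans (ltW h) _; rewrite expr2 -natrM ler_nat; nia.
exists l, (TScale hl TOne); split=> // w s _ _ /=; rewrite mulr1.
apply: le_trans (normc_le_ReIm _) _; rewrite (splitr e).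
by case: (a) hq hr => a1 a2 /= hq hr; rewrite -normrN opprB lerD// -normrN opprB.
Qed.

Lemma term_limitD h g : term_limit h -> term_limit g -> term_limit (fun s => h s + g s).
Proof.
move=> H G e e0; have e20 : 0 < e / 2 by rewrite divr_gt0.
have [k [t [ut ht]]] := H _ e20; have [l [u [uu hu]]] := G _ e20.
exists (k + l)%positive, (TAdd t u); split=> [z z' E /=|z s s1 zs /=].
  by rewrite (ut _ _ E) (uu _ _ E).
rewrite opprD addrACA (splitr e).
by apply: le_trans (le_normcD _ _) (lerD _ _); [exact: ht|exact: hu].
Qed.

Lemma term_limitM h g : term_limit h -> term_limit g -> term_limit (fun s => h s * g s).
Proof.
move=> H G e e0; have [A A1 hA] := term_limit_bounded H; have [B B1 hB] := term_limit_bounded G.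
(* The three errors of a product are at most [d * B], [d] (one factor being at most 1) and
   [A * d]. *)
have d0 : 0 < e / (A + B + 1) by rewrite divr_gt0//; lra.
set d := e / (A + B + 1) in d0.
have Ed : d * (A + B + 1) = e by rewrite divfK//; apply: lt0r_neq0; lra.
have d'0 : 0 < Num.min 1 d by rewrite lt_min ltr01.
have [k [t [ut ht]]] := H _ d'0; have [l [u [uu hu]]] := G _ d'0.
exists (k * l)%positive, (TMul t u); split=> [z z' E /=|z s s1 zs /=].
  by rewrite (ut _ _ E) (uu _ _ E).
have {ht} := ht z s s1 zs; rewrite le_min => /andP[_ h1].
have {hu} := hu z s s1 zs; rewrite le_min => /andP[h3 h4].
have := hA s s1; have := hB s s1.
move: (point_term z t) (point_term z u) (h s) (g s) h1 h3 h4 => t' u' a b h1 h3 h4 hb ha.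
have -> : t' * u' - a * b = (t' - a) * b + (t' - a) * (u' - b) + a * (u' - b) by ring.
apply: le_trans (le_normcD _ _) _.
apply: le_trans (lerD (le_normcD _ _) (lexx _)) _; rewrite !Normc.normcM.
have := normc_ge0 (t' - a); have := normc_ge0 (u' - b); have := normc_ge0 a; have := normc_ge0 b.
by move=> b0 a0 u0 t0; nra.
Qed.

Lemma term_limit_sum L (h : nat -> R -> R[i]) : (forall j, term_limit (h j)) ->
  term_limit (fun s => \sum_(j < L) h j s).
Proof.
move=> H; elim: L => [|L IH].
  by apply: term_limit_ext (term_limit_cst 0) => s _; rewrite big_ord0.
by apply: term_limit_ext (term_limitD IH (H L)) => s _; rewrite big_ord_recr.
Qed.

(* The iteration p' = p + (x^2 - p^2) / 2 converges to |x| uniformly on [-1, 1]. *)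
Fixpoint abs_iter (n : nat) (x : R) : R :=
  if n is n'.+1 then abs_iter n' x + (x ^+ 2 - abs_iter n' x ^+ 2) / 2 else 0.

(** The third bound yields the uniform rate [2 / n] while avoiding division by [x]. It is inherited
    because [(1 - y / 2) (1 + (m + 1) y / 2) <= 1 + m y / 2]. *)
Lemma abs_iter_bounds n x : `|x| <= 1 ->
  [/\ 0 <= abs_iter n x, abs_iter n x <= `|x| &
      (`|x| - abs_iter n x) * (1 + n%:R * `|x| / 2) <= `|x|].
Proof.
move=> x1; have x0 := normr_ge0 x.
elim: n => [|n [IH1 IH2 IH3]] /=; first by rewrite mul0r mul0r addr0 mulr1 subr0.
rewrite -(real_normK (num_real x)) -[n.+1%:R]natr1; move: (abs_iter n x) IH1 IH2 IH3 => p p0 px.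
move: (`|x|) x0 x1 px => y y0 y1 py; have n0' : 0 <= n%:R :> R by [].
move: (n%:R) n0' => m m0 H.
have h1 : 0 <= y - (p + (y ^+ 2 - p ^+ 2) / 2) by nra.
split; [by nra|by lra|].
apply: le_trans H.
have -> : y - (p + (y ^+ 2 - p ^+ 2) / 2) = (y - p) * (1 - (y + p) / 2) by field.
rewrite -mulrA ler_wpM2l ?subr_ge0//.
apply: (@le_trans _ _ ((1 - y / 2) * (1 + (m + 1) * y / 2))).
  apply: ler_wpM2r; last by lra.
  by rewrite addr_ge0// divr_ge0// mulr_ge0// addr_ge0.
by nra.
Qed.

Lemma term_limit_abs (h : R -> R) : term_limit (fun s => (h s)%:C) ->
  term_limit (fun s => `|h s|%:C).
Proof.
move=> H; have [B B1 hB] := term_limit_bounded H.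
have B0 : 0 < B by apply: lt_le_trans B1.
have lim n : term_limit (fun s => (abs_iter n (h s / B))%:C).
  elim: n => [|n IH] /=; first exact: term_limit_cst.
  have L := term_limitM H (term_limit_cst (B^-1)%:C).
  have := term_limitD IH (term_limitM (term_limitD (term_limitM L L)
    (term_limitM (term_limit_cst (-1)) (term_limitM IH IH))) (term_limit_cst (2^-1)%:C)).
  apply: term_limit_ext => s _; rewrite !(rmorphD, rmorphN, rmorphM, rmorphXn)/=; ring.
apply: term_limit_closure => e e0.
have key (p y m : R) : 0 <= m -> 0 <= p -> p <= y -> (y - p) * (1 + m * y / 2) <= y ->
    2 * B <= m * e -> B * (y - p) <= e.
  move=> m0 p0 py hp hm; have d0 : 0 <= y - p by rewrite subr_ge0.
  have [y00|yp] := leP y 0; first by (have -> : y - p = 0 by lra); rewrite mulr0 ltW.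
  have h2 : (y - p) * m <= 2 by rewrite -(ler_pM2r yp); nra.
  have : (y - p) * (2 * B) <= (y - p) * (m * e) by rewrite ler_wpM2l.
  by rewrite mulrA; nra.
have [n hn] : exists n : nat, 2 * B / e <= n%:R :> R.
  by exists (Num.truncn (2 * B / e)).+1; apply/ltW/truncnS_gt.
exists (fun s => B%:C * (abs_iter n (h s / B))%:C); first exact: term_limitM (term_limit_cst _) _.
move=> s s1; rewrite -rmorphM -rmorphB normc_real.
have y1 : `|h s / B| <= 1.
  by rewrite normrM normfV (gtr0_norm B0) ler_pdivrMr// mul1r -normc_real; exact: hB.
have [p0 py hp] := abs_iter_bounds n y1.
have -> : B * abs_iter n (h s / B) - `|h s| = - (B * (`|h s / B| - abs_iter n (h s / B))).
  by rewrite normrM normfV (gtr0_norm B0); field; exact: lt0r_neq0.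
rewrite normrN ger0_norm; last by rewrite mulr_ge0 ?(ltW B0)// subr_ge0.
move: hn; rewrite ler_pdivrMr// => hn.
by apply: key hn.
Qed.

Lemma clamp01E (t : R) : clamp 0 1 t = (`|t| - `|t - 1| + 1) / 2.
Proof.
have [t0|t0] := leP t 0.
  by rewrite clamp_low// ?ler01// (ler0_norm t0) ler0_norm; lra.
have [t1|t1] := leP t 1.
  by rewrite clamp_id// ?(ltW t0)// (gtr0_norm t0) ler0_norm; lra.
by rewrite clamp_high// ?ler01// ?(ltW t1)// (gtr0_norm t0) gtr0_norm; lra.
Qed.

Lemma term_limit_clamp (h : R -> R) : term_limit (fun s => (h s)%:C) ->
  term_limit (fun s => (clamp 0 1 (h s))%:C).
Proof.
move=> H.
have H1 : term_limit (fun s => (h s - 1)%:C).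
  apply: term_limit_ext (term_limitD H (term_limit_cst (-1))) => s _.
  by rewrite rmorphB.
have := term_limitM (term_limitD (term_limitD (term_limit_abs H)
  (term_limitM (term_limit_cst (-1)) (term_limit_abs H1)))
  (term_limit_cst 1)) (term_limit_cst (2^-1)%:C).
apply: term_limit_ext => s _; rewrite clamp01E.
by rewrite rmorphM rmorphD rmorphB rmorph1 mulN1r.
Qed.

Lemma term_limit_pl (z : nat -> R) L (a b : R) :
  term_limit (fun s => (pl z L (a * s + b))%:C).
Proof.
have A c : term_limit (fun s => (a * s + b - c)%:C).
  have := term_limitD (term_limitM (term_limit_cst a%:C) term_limit_id) (term_limit_cst (b - c)%:C).
  by apply: term_limit_ext => s _; rewrite -rmorphM -rmorphD addrA.
have := term_limitD (term_limit_cst (z 0%N)%:C) (term_limit_sum L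
  (fun j => term_limitM (term_limit_clamp (A j%:R)) (term_limit_cst (z j.+1 - z j)%:C))).
apply: term_limit_ext => s _; rewrite /pl rmorphD rmorph_sum/=.
by congr (_ + _); apply: eq_bigr => j _; rewrite rmorphM.
Qed.

Lemma term_limit_cpl (z : nat -> R[i]) L (a b : R) :
  term_limit (fun s => cpl z L (a * s + b)).
Proof.
have := term_limitD (term_limit_pl (fun j => complex.Re (z j)) L a b)
  (term_limitM (term_limit_cst 'i%C) (term_limit_pl (fun j => complex.Im (z j)) L a b)).
apply: term_limit_ext => s _; rewrite /cpl.
by apply/eqP; rewrite eq_complex/=; apply/andP; split; apply/eqP; ring.
Qed.
End TermLimits.

Section TermCoordinate.
Variables (R : realType) (P : continuum).
Hypotheses (chP : chainable P) (ndP : Defs.nondegenerate P).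

Lemma continuous_affine_from (e : P -> R) (a b : R) : continuous e ->
  continuous (fun x => a * e x + b).
Proof.
by move=> ce x; apply: cvgD; [apply: cvgM; [exact: cvg_cst|exact: ce]|exact: cvg_cst].
Qed.

Lemma complex_coordinate m (f : 'I_m -> cfun R P) (h : R) : 0 < h ->
  exists (e : P -> R) L (nd : nat -> P) (a b : R),
    [/\ continuous e, forall x, `|e x| <= 1, exists x, e x = -1, exists x, e x = 1 &
      (forall t, `|t| <= 1 -> 0 <= a * t + b <= L%:R) /\
      forall i x, Normc.normc (f i x - cpl (fun j => f i (nd j)) L (a * e x + b)) <= h].
Proof.
move=> h0; have h20 : 0 < h / 2 by rewrite divr_gt0.
pose g (i : 'I_(m + m)) : P -> R := match fintype.split i with
  | inl i => fun x => complex.Re (f i x) | inr i => fun x => complex.Im (f i x) end.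
have cg i : continuous (g i).
  by rewrite /g; case: fintype.split => j; [exact: continuous_Re|exact: continuous_Im].
have [e [L [nd [a [b [ce e1 em ep [ab H]]]]]]] :=
  @chain_coordinate R P (@continuum_compact P) (@continuum_hausdorff P) chP
    ndP _ g _ h20 cg.
exists e, L, nd, a, b; split=> //; split=> // i x.
have := H (lshift m i) x; have := H (rshift m i) x.
have gl : g (lshift m i) = fun x => complex.Re (f i x).
  by rewrite /g -[lshift m i]/(unsplit (inl i)) unsplitK.
have gr : g (rshift m i) = fun x => complex.Im (f i x).
  by rewrite /g -[rshift m i]/(unsplit (inr i)) unsplitK.
rewrite gl gr => hi hr; apply: le_trans (normc_le_ReIm _) _.
rewrite (splitr h); case E : (f i x) hr hi => [u v] /= hr hi.
exact: lerD.
Qed.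

(** A single Lipschitz constant serves all the terms, so that the tolerance of the pins can be
    chosen after it. *)
Lemma term_coordinate n0 m (f : 'I_m -> cfun R P) (h : R) : 0 < h ->
  exists (e : P -> R), [/\ continuous e, forall x, `|e x| <= 1,
    exists x, e x = -1, exists x, e x = 1 &
    exists2 C : R, 0 <= C & forall i, exists k (t : Lterm k),
      [/\ forall x (z : positive -> nat -> R[i]), z 1%positive n0 = (e x)%:C ->
          Normc.normc (point_term z t - f i x) <= h,
        univariate R n0 t &
        forall z z', in_balls z -> in_balls z' ->
          Normc.normc (point_term z t - point_term z' t)
            <= C * Normc.normc (z 1%positive n0 - z' 1%positive n0)]].
Proof.
move=> h0; have h20 : 0 < h / 2 by rewrite divr_gt0.
have [e [L [nd [a [b [ce e1 em ep [ab H]]]]]]] := complex_coordinate f h20.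
exists e; split=> //.
pose Q i (C : R) := 0 <= C /\ exists k (t : Lterm k),
      [/\ forall x (z : positive -> nat -> R[i]), z 1%positive n0 = (e x)%:C ->
          Normc.normc (point_term z t - f i x) <= h,
        univariate R n0 t &
        forall z z', in_balls z -> in_balls z' ->
          Normc.normc (point_term z t - point_term z' t)
            <= C * Normc.normc (z 1%positive n0 - z' 1%positive n0)].
have /choice[C hC] i : exists C, Q i C.
  have [k [t [ut ht]]] := term_limit_cpl n0 (fun j => f i (nd j)) L a b h20.
  have [C C0 lC] := univariate_lipschitz ut.
  exists C; split=> //; exists k, t; split=> // x z zx.
  have -> : point_term z t - f i x = (point_term z t - cpl (fun j => f i (nd j)) L (a * e x + b))
     + (cpl (fun j => f i (nd j)) L (a * e x + b) - f i x) by rewrite addrA subrK.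
  rewrite (splitr h); apply: le_trans (le_normcD _ _) (lerD _ _).
    by apply: ht => //; move: (e1 x); rewrite ler_norml.
  by rewrite -normcN opprB; exact: H.
exists (\sum_i C i); first by apply: sumr_ge0 => i _; case: (hC i).
move=> i; have [C0 [k [t [h1 ut h2]]]] := hC i; exists k, t; split=> // z z' bz bz'.
apply: le_trans (h2 z z' bz bz') _; rewrite ler_wpM2r ?normc_ge0//.
rewrite (bigD1 i)//= lerDl; apply: sumr_ge0 => j _; case: (hC j) => //.
Qed.
End TermCoordinate.

(** * Enumeration of pairs of terms and pinning of distances *)

Definition term_pair : Type := {k : positive & (Lterm k * Lterm k)%type}.

Definition pair_dist (R : realType) (M : Ldata R) (c : valuation M) (a : term_pair) : R :=
  Ldist (term_val c (projT2 a).1) (term_val c (projT2 a).2).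

(** Terms are indexed by sorts and carry proofs, so they are counted through untyped trees. A
    decidable side condition is recovered by [pselect], and ill-formed trees decode to [TZero]. *)
Fixpoint term_of_tree (s : GenTree.tree (nat * nat)) : {k : positive & Lterm k} :=
  match s with
  | GenTree.Leaf (k, n) => existT _ (Pos.of_nat k) (Sym _ n)
  | GenTree.Node 1 _ => existT _ _ TOne
  | GenTree.Node 2 [:: a; b] =>
      existT _ _ (TAdd (projT2 (term_of_tree a)) (projT2 (term_of_tree b)))
  | GenTree.Node 3 [:: a; b] =>
      existT _ _ (TMul (projT2 (term_of_tree a)) (projT2 (term_of_tree b)))
  | GenTree.Node 4 [:: a] => existT _ _ (TStar (projT2 (term_of_tree a)))
  | GenTree.Node 5 [:: GenTree.Leaf (l, m); a] =>
      if unpickle m is Some (x, y) then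
        let t := term_of_tree a in
        match pselect (scale_fits (x +i* y)%C (projT1 t) (Pos.of_nat l)) with
        | left h => existT _ _ (TScale h (projT2 t))
        | right _ => existT _ _ TZero
        end
      else existT _ _ TZero
  | GenTree.Node 6 [:: GenTree.Leaf (l, _); a] =>
      let t := term_of_tree a in
      match pselect (Pos.leb (projT1 t) (Pos.of_nat l)) with
      | left h => existT _ _ (TIncl h (projT2 t))
      | right _ => existT _ _ TZero
      end
  | _ => existT _ _ TZero
  end.

Lemma term_of_tree_onto k (t : Lterm k) : exists s, term_of_tree s = existT _ k t.
Proof.
elim: t => {k} [k n|||k l t [a ha] u [b hb]|k l t [a ha] u [b hb]|k t [a ha]
  |z k l h t [a ha]|k l h t [a ha]].
- by exists (GenTree.Leaf (Pos.to_nat k, n)); rewrite /= Pos2Nat.id.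
- by exists (GenTree.Node 0 [::]).
- by exists (GenTree.Node 1 [::]).
- by exists (GenTree.Node 2 [:: a; b]); rewrite /= ha hb.
- by exists (GenTree.Node 3 [:: a; b]); rewrite /= ha hb.
- by exists (GenTree.Node 4 [:: a]); rewrite /= ha.
- case: z h => x y h; have [m mK] : exists m, unpickle m = Some (x, y).
    by exists (pickle (x, y)); exact: pickleK.
  exists (GenTree.Node 5 [:: GenTree.Leaf (Pos.to_nat l, m); a]).
  rewrite /= mK Pos2Nat.id ha /=.
  by case: pselect => // h'; rewrite (Prop_irrelevance h' h).
- exists (GenTree.Node 6 [:: GenTree.Leaf (Pos.to_nat l, 0%N); a]).
  rewrite /= Pos2Nat.id ha /=.
  by case: pselect => // h'; rewrite (Prop_irrelevance h' h).
Qed.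

Lemma term_pair_enumeration : exists E : nat -> term_pair, forall a, exists n, E n = a.
Proof.
pose mk (s s' : {k : positive & Lterm k}) : term_pair :=
  match Pos.eq_dec (projT1 s') (projT1 s) with
  | left e => existT _ (projT1 s) (projT2 s, eq_rect _ Lterm (projT2 s') _ e)
  | right _ => existT _ _ (TZero, TZero)
  end.
exists (fun n => if unpickle n is Some (a, b) then mk (term_of_tree a) (term_of_tree b)
  else existT _ _ (TZero, TZero)).
move=> [k [t u]]; have [a ha] := term_of_tree_onto t; have [b hb] := term_of_tree_onto u.
exists (pickle (a, b)); rewrite pickleK ha hb /mk /=; case: Pos.eq_dec => // e.
by rewrite (Prop_irrelevance e erefl).
Qed.

Section Pins.
Variables (R : realType) (F : connectives R).
Hypothesis hF : restricted_family F.

Lemma composition_formula n (f : 'rV[R]_n -> R) (phi : 'I_n -> qfformula R) :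
  composition F f -> (forall i, built_with F (phi i)) ->
  exists2 psi, built_with F psi & forall (M : Ldata R) (c : valuation M),
    formula_val c psi = f (\row_i formula_val c (phi i)).
Proof.
move=> cf bphi; elim: cf => [i|m g h Fg _ IH].
  by exists (phi i) => // M c; rewrite mxE.
have /choice[psi H] i : exists psi, built_with F psi /\
    forall (M : Ldata R) (c : valuation M),
      formula_val c psi = h i (\row_i formula_val c (phi i)).
  by have [psi h1 h2] := IH i; exists psi.
exists (Conn g psi) => [|M c /=]; first by split=> // i; case: (H i).
by congr g; apply/rowP => i; rewrite !mxE; case: (H i).
Qed.

Lemma Ldist_ge0 (M : Ldata R) k (x y : M k) : is_prestructure M -> 0 <= Ldist x y.
Proof.
move=> pM; have := Ldist_triangle pM x y x; rewrite (Ldist_refl pM) (Ldist_sym pM y x).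
by move=> h; lra.
Qed.

(* The connectives are only dense, so [- d(t, u)] is available up to [e]. *)
Lemma negated_distance (a : term_pair) (e : R) : 0 < e ->
  exists2 psi, built_with F psi & forall (M : Ldata R) (c : valuation M),
    is_prestructure M -> `|formula_val c psi + pair_dist c a| < e.
Proof.
case: a => k [t u] e0.
have cg : continuous (fun x : 'rV[R]_1 => - x ord0 ord0).
  by move=> x; apply: continuousN; exact: coord_continuous.
have [f cf hf] := restricted_dense hF cg (2 * radius R k) e0.
have [psi bpsi hpsi] := composition_formula (phi := fun _ => Dist R t u) cf (fun _ => I).
exists psi => // M c pM; rewrite hpsi /pair_dist /=.
have /hf : forall i, `|(\row_(i < 1) Ldist (term_val c t) (term_val c u)) ord0 i|
    <= 2 * radius R k.
  by move=> i; rewrite mxE ger0_norm ?Ldist_ge0//; exact: Ldist_bound.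
by rewrite mxE opprK.
Qed.

(** Conditions are strict upper bounds, so the bound from below goes through [negated_distance]:
    half of [e] covers its inaccuracy and half is left as slack. *)
Lemma pins (M0 : Ldata R) (c0 : valuation M0) n (a : nat -> term_pair) (e : R) :
  is_prestructure M0 -> 0 < e -> exists p : expressions R,
  [/\ finite_set p, forall phi r, p (phi, r) -> built_with F phi,
    forall phi r, p (phi, r) -> formula_val c0 phi < r &
    forall (M : Ldata R) (c : valuation M), is_prestructure M ->
      (forall phi r, p (phi, r) -> formula_val c phi < r) ->
      forall i, (i < n)%N -> `|pair_dist c (a i) - pair_dist c0 (a i)| < e].
Proof.
move=> pM0 e0; elim: n => [|n [p [fp bp h0 H]]].
  by exists set0; split=> //.
have e20 : 0 < e / 2 by rewrite divr_gt0.
have [psi bpsi hpsi] := negated_distance (a n) e20.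
pose v := pair_dist c0 (a n).
pose phi := Dist R (projT2 (a n)).1 (projT2 (a n)).2.
exists (p `|` [set (phi, v + e)] `|` [set (psi, - v + e / 2)]); split.
- by rewrite !finite_setU; split; [split=> //|]; exact: finite_set1.
- by move=> ph r [[/bp//|[-> _]]|[-> _]].
- move=> ph r [[/h0//|[-> ->]]|[-> ->]]; first by rewrite /= ltrDl.
  by have := hpsi _ c0 pM0; rewrite -/v ltr_norml => /andP[_ h]; lra.
move=> M c pM sat i; rewrite ltnS leq_eqVlt => /predU1P[->|].
  have h1 : pair_dist c (a n) < v + e.
    by have := sat phi (v + e); apply; left; right.
  have h2 : formula_val c psi < - v + e / 2 by apply: sat; right.
  have := hpsi _ c pM; rewrite ltr_norml => /andP[h3 _].
  by rewrite -/v ltr_norml; apply/andP; split; lra.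
by apply: H => // ph r hr; apply: sat; left; left.
Qed.
End Pins.

(** * Extending conditions *)

Section Pseudoarc.
Variables (R : realType) (P : continuum).
Local Notation CP := (C_algebra R P).
Local Notation points := (positive -> nat -> R[i]).
Implicit Types (c : valuation (dissection CP)) (q : expressions R).

Definition value c (x : P) : points := fun k n => (sval (c k n : cball CP k) : cfun R P) x.

Definition near_valuation N (d : R) c c' : Prop :=
  forall x, close_upto N d (value c x) (value c' x).

Definition agree N c c' : Prop := forall x k n, (symbol_rank k n <= N)%N ->
  value c' x k n = value c x k n.

Lemma agree_near N c c' : agree N c c' -> near_valuation N 0 c c'.
Proof. by move=> H x k n kn; rewrite H// subrr Normc.normc0. Qed.

Definition holds q c : Prop := forall phi r, q (phi, r) -> formula_val c phi < r.

Lemma value_balls c x : in_balls (value c x).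
Proof.
by move=> k n; apply: le_trans (svalP (c k n : cball CP k)); exact: le_supnorm.
Qed.

Definition point_gap (z : points) (a : term_pair) : R :=
  Normc.normc (point_term z (projT2 a).1 - point_term z (projT2 a).2).

Lemma pair_dist_ge c (a : term_pair) x : point_gap (value c x) a <= pair_dist c a.
Proof. by apply: (rep_le (functions_represented c)); exists x. Qed.

Lemma pair_dist_attained c (a : term_pair) (e : R) : 0 < e -> exists x,
  pair_dist c a - e <= point_gap (value c x) a.
Proof.
move=> e0; have [_ [x _ <-] h] :=
  rep_attain (functions_represented c) (projT2 a).1 (projT2 a).2 e0.
by exists x.
Qed.

Lemma pair_dist_le c (a : term_pair) (d : R) :
  (forall x, point_gap (value c x) a <= d) -> pair_dist c a <= d.
Proof.
move=> H; apply/ler_addgt0Pr => e e0; have [x hx] := pair_dist_attained c a e0.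
by rewrite -lerBlDr; apply: le_trans hx (H x).
Qed.

Lemma holds_open q c : finite_set q ->
  (forall phi r, q (phi, r) -> built_with (@all_connectives R) phi) -> holds q c ->
  exists N (d : R), 0 < d /\ forall c',
    hausdorff_close N d (function_points c) (function_points c') -> holds q c'.
Proof.
move=> fq bq hq.
have [N [d [d0 H]]] := conditions_open (functions_represented c) fq bq hq.
by exists N, d; split=> // c' cl; exact: H (functions_represented c') cl.
Qed.

Lemma near_hausdorff N d c c' : near_valuation N d c c' ->
  hausdorff_close N d (function_points c) (function_points c').
Proof.
move=> H; split=> _ [x _ <-].
  by exists (value c' x); [exists x|exact: H].
by exists (value c x); [exists x|exact: H].
Qed.

Definition update_fun c (k0 : positive) (n0 : nat) (f : cfun R P) k n : cfun R P :=
  if Pos.eqb k k0 && (n == n0) then f else sval (c k n : cball CP k).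

Lemma update_bound c k0 n0 (f : cfun R P) : supnorm f <= radius R k0 ->
  forall k n, supnorm (update_fun c k0 n0 f k n) <= radius R k.
Proof.
move=> hf k n; rewrite /update_fun; case: ifP => [/andP[/Pos.eqb_eq -> _]//|_].
exact: (svalP (c k n : cball CP k)).
Qed.

Lemma update_exists c k0 n0 (f : cfun R P) : supnorm f <= radius R k0 ->
  exists c', [/\ sval (c' k0 n0 : cball CP k0) = f &
    forall N, (N < symbol_rank k0 n0)%N -> agree N c c'].
Proof.
move=> hf; exists (valuation_of (update_bound c n0 hf)); split.
  by rewrite /= /update_fun Pos.eqb_refl eqxx.
move=> N hN x k n kn; rewrite /value /= /update_fun; case: ifP => [/andP[/Pos.eqb_eq E /eqP E']|_].
  by move: kn hN; rewrite E E' => h1 h2; have := leq_ltn_trans h1 h2; rewrite ltnn.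
by [].
Qed.

Lemma near_trans N d d' c c' c'' : near_valuation N d c c' -> near_valuation N d' c' c'' ->
  near_valuation N (d + d') c c''.
Proof.
move=> h h' x k n kn.
have -> : value c x k n - value c'' x k n =
  (value c x k n - value c' x k n) + (value c' x k n - value c'' x k n) by ring.
by apply: le_trans (le_normcD _ _) (lerD _ _); [exact: h|exact: h'].
Qed.

Lemma near_le N N' (d d' : R) c c' : (N <= N')%N -> d' <= d ->
  near_valuation N' d' c c' -> near_valuation N d c c'.
Proof.
by move=> NN dd H x k n kn; apply: le_trans dd; apply: H; exact: leq_trans NN.
Qed.

Definition symbol_fun c (s : positive * nat) : cfun R P := sval (c s.1 s.2 : cball CP s.1).

Lemma symbol_rank1 N : symbol_rank 1 N.+2 = N.+2.
Proof. by []. Qed.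

Hypotheses (chP : chainable P) (ndP : Defs.nondegenerate P)
  (indec : hereditarily_indecomposable P).
Variable F : connectives R.
Hypothesis hF : restricted_family F.
Local Notation T := (T_projectionless_abelian R).

(** The invariant of the strategy: however the play continues from [q], the condition reached still
    has a solution in [C(P)] close to [c] on the symbols already settled. *)
Definition good q c N (e : R) : Prop := forall q', condition F T q' -> q `<=` q' ->
  exists c', holds q' c' /\ near_valuation N e c c'.

Lemma CP_prestructure : is_prestructure (dissection CP).
Proof. exact: structure_pre (dissection_structure CP). Qed.

Lemma leb_addl k l : Pos.leb k (k + l).
Proof. by apply/Pos.leb_le; lia. Qed.

Lemma leb_addr k l : Pos.leb l (k + l).
Proof. by apply/Pos.leb_le; lia. Qed.

(* A valuation factoring through an arc can be recovered by [arc_lift] from any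
   model in which the coordinate [d = Sym 1 n0] still runs over the whole arc and
   the other symbols are still the same functions of [d]. *)
Lemma good_extension c N (e : R) : 0 < e -> exists c' p,
  [/\ agree N c c', finite_set p,
      forall phi r, p (phi, r) -> built_with F phi, holds p c' & good p c' N e].
Proof.
(* The final comparison adds four estimates, by [h], [h], [2 * h] and [h]. *)
move=> e0; pose h := e / 5; have h0 : 0 < h by rewrite divr_gt0.
(* The coordinate is put on a symbol of rank above [N], which leaves the settled symbols alone. *)
pose n0 := N.+2; pose m := (N.+1 * N.+1)%N.
pose f (i : 'I_m) := symbol_fun c (symbol_code N i).
have [E [cE E1 [xm Em] [xp Ep] [C C0 H]]] := term_coordinate chP ndP n0 f h0.
have /choice[tau Htau] i : exists s : {k : positive & Lterm k},
    [/\ forall x (z : positive -> nat -> R[i]), z 1%positive n0 = (E x)%:C ->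
          Normc.normc (point_term z (projT2 s) - f i x) <= h,
        univariate R n0 (projT2 s) &
        forall z z', in_balls z -> in_balls z' ->
          Normc.normc (point_term z (projT2 s) - point_term z' (projT2 s))
            <= C * Normc.normc (z 1%positive n0 - z' 1%positive n0)].
  by have [k [t ht]] := H i; exists (existT _ k t).
have c0 : continuous (fun _ : P => 0 : R) by move=> x; exact: cvg_cst.
pose Ef : cfun R P := cfun_of cE c0.
have Ef1 : supnorm Ef <= radius R 1.
  by apply: supnorm_le => x; rewrite -[Ef x]/((E x)%:C) normc_real; exact: E1.
have [c' [c'd c'near]] := update_exists c n0 Ef1.
have c'E x : value c' x 1%positive n0 = (E x)%:C by rewrite /value c'd.
have c'N : agree N c c' by apply: c'near; rewrite symbol_rank1 ltnS leqnSn.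
(* At corresponding points the two values of [d] will differ by at most [30 * k]: [7 * (4 * k)] from
   [arc_lift], [h3 <= k] from the approximation of [mu], and [k] for the imaginary part. The
   Lipschitz constant [C] turns this into at most [h]. *)
pose k := h / (30 * (C + 1)).
have C1 : 0 < C + 1 by rewrite ltr_wpDl.
have k0 : 0 < k by rewrite divr_gt0// mulr_gt0.
have kE : k * (30 * (C + 1)) = h by rewrite divfK// lt0r_neq0// mulr_gt0.
have kh : k <= h by nra.
pose d := Sym 1%positive n0.
(* Pinned are each symbol against its term in [d], both included into a common sort, then [d]
   against its adjoint, against 1 and, as [d + 1] against [0 + 0], against -1. *)
pose a j : term_pair := if insub j is Some i then
    let s := symbol_code N (i : 'I_m) in
    existT _ (s.1 + projT1 (tau i))%positive
      (TIncl (leb_addl _ _) (Sym s.1 s.2), TIncl (leb_addr _ _) (projT2 (tau i)))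
  else if j == m then existT _ 1%positive (d, TStar d)
  else if j == m.+1 then existT _ 1%positive (d, TOne)
  else existT _ (1 + 1)%positive (TAdd d TOne, TAdd TZero TZero).
have am (y : points) : point_gap y (a m) =
    Normc.normc (y 1%positive n0 - conjc (y 1%positive n0)).
  by rewrite /a insubN ?ltnn// eqxx.
have am1 (y : points) : point_gap y (a m.+1) = Normc.normc (y 1%positive n0 - 1).
  by rewrite /a insubN ?ltnNge ?leqnSn// eqxx; case: eqP => // ?; lia.
have am2 (y : points) : point_gap y (a m.+2) = Normc.normc (y 1%positive n0 + 1).
  rewrite /a insubN; last by lia.
  case: eqP => [?|_]; [lia|case: eqP => [?|_]; [lia|]].
  by rewrite /point_gap /= addr0 subr0.
have ai (i : 'I_m) (y : points) : point_gap y (a i) =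
    Normc.normc (y (symbol_code N i).1 (symbol_code N i).2 - point_term y (projT2 (tau i))).
  by rewrite /a valK.
have [p [fp bp hp Hp]] := pins hF c' m.+3 a CP_prestructure k0.
exists c', p; split=> // q qcond pq.
have [mu hmu] := condition_in_CP chP ndP hF qcond.
have fq : finite_set q by case: qcond.
have [N3 [dl [dl0 opn]]] := holds_open fq (condition_built hF qcond) hmu.
have pin j : (j < m.+3)%N -> `|pair_dist mu (a j) - pair_dist c' (a j)| < k.
  by apply: Hp CP_prestructure _ j => phi r /pq; exact: hmu.
pose z y : R[i] := value mu y 1%positive n0.
have z1 y : Normc.normc (z y) <= 1 by exact: (value_balls mu y 1%positive n0).
have zIm y : `|complex.Im (z y)| <= k.
  have := pin m (leqW (leqW (leqnn _))); rewrite ltr_norml => /andP[_ h1].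
  have h2 := pair_dist_ge mu (a m) y.
  have h3 : pair_dist c' (a m) <= 0.
    apply: pair_dist_le => x; rewrite am c'E.
    by rewrite conjc_real subrr Normc.normc0.
  move: h2; rewrite am -/(z y) => h2.
  move: (pair_dist mu (a m)) (pair_dist c' (a m)) h1 h2 h3 => B B' h1 h2 h3.
  have := le_trans (Im_le_normc _) h2; case: (z y) => u v /= h4.
  have : `|v - - v| < k by apply: le_lt_trans h4 _; lra.
  by rewrite opprK -mulr2n normrMn mulr2n; have := normr_ge0 v; lra.
have zRe y : `|complex.Re (z y)| <= 1 by apply: le_trans (Re_le_normc _) (z1 y).
(* The distance of [d] from 1 is at least 2 under [c'], hence more than [2 - k] under [mu], where it
   is attained up to [k]; the imaginary part costs the third [k]. *)
have [ym hym] : exists y, complex.Re (z y) <= -1 + 3 * k.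
  have := pin m.+1 (leqW (leqnn _)); rewrite ltr_norml => /andP[h1 _].
  have h3 : 2 <= pair_dist c' (a m.+1).
    apply: le_trans (pair_dist_ge c' (a m.+1) xm); rewrite am1 c'E Em -rmorphB normc_real.
    by rewrite -opprD normrN ger0_norm.
  have [y hy] := pair_dist_attained mu (a m.+1) k0; exists y.
  move: hy; rewrite am1 -/(z y) => hy.
  move: (pair_dist mu _) (pair_dist c' _) h1 h3 hy => B B' h1 h3 hy.
  have := le_trans hy (normc_le_ReIm _); have := zIm y; have := zRe y.
  case: (z y) => u v /=; rewrite oppr0 addr0 ler_norml => /andP[u1 u2] hv.
  by rewrite (ler0_norm (_ : u - 1 <= 0)); lra.
have [yp hyp] : exists y, 1 - 3 * k <= complex.Re (z y).
  have := pin m.+2 (leqnn _); rewrite ltr_norml => /andP[h1 _].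
  have h3 : 2 <= pair_dist c' (a m.+2).
    apply: le_trans (pair_dist_ge c' (a m.+2) xp); rewrite am2 c'E Ep.
    by rewrite -rmorphD normc_real ger0_norm.
  have [y hy] := pair_dist_attained mu (a m.+2) k0; exists y.
  move: hy; rewrite am2 -/(z y) => hy.
  move: (pair_dist mu _) (pair_dist c' _) h1 h3 hy => B B' h1 h3 hy.
  have := le_trans hy (normc_le_ReIm _); have := zIm y; have := zRe y.
  case: (z y) => u v /=; rewrite addr0 ler_norml => /andP[u1 u2] hv.
  by rewrite (ger0_norm (_ : 0 <= u + 1)); lra.
pose N4 := maxn N3 n0; pose h3 := Num.min dl k.
have h30 : 0 < h3 by rewrite lt_min dl0.
have h3dl : h3 <= dl by rewrite ge_min lexx.
have h3k : h3 <= k by rewrite ge_min lexx orbT.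
have [w [L [nd [a' [b' [cw w1 [wm wmE] [wp wpE] [wab Hw]]]]]]] :=
  complex_coordinate chP ndP (fun i : 'I_(N4.+1 * N4.+1) =>
    symbol_fun mu (symbol_code N4 i)) h30.
pose D l n t := cpl (fun j => value mu (nd j) l n) L (a' * t + b').
have hD l n y : (symbol_rank l n <= N4)%N -> Normc.normc (value mu y l n - D l n (w y)) <= h3.
  by move=> /symbol_codeP[i Ei]; have := Hw i y; rewrite Ei.
have caff : continuous (fun t => a' * t + b').
  by move=> t; apply: cvgD; [apply: cvgM; [exact: cvg_cst|exact: cvg_id]|exact: cvg_cst].
pose g t := clamp (-1) 1 (complex.Re (D 1%positive n0 t)).
have cg : continuous g.
  apply: continuous_clamp => t.
  exact: (@continuous_pl R R (fun j => complex.Re (value mu (nd j) 1%positive n0)) L _ caff t).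
have m11 : -1 <= 1 :> R by lra.
have g1 t : `|g t| <= 1 by rewrite ler_norml; exact: clamp_bounds.
have rank0 : (symbol_rank 1 n0 <= N4)%N by rewrite symbol_rank1 leq_maxr.
have gw y : `|complex.Re (z y) - g (w y)| <= h3.
  have E2 : clamp (-1) 1 (complex.Re (z y)) = complex.Re (z y).
    by move: (zRe y); rewrite ler_norml => /andP[? ?]; exact: clamp_id.
  rewrite -[X in `|X - _|]E2; apply: le_trans (clamp_nonexpansive _ _ m11) _.
  rewrite -raddfB; apply: le_trans (Re_le_normc _) _; exact: hD.
have onto (v : P -> R) x0 x1 t : continuous v -> v x0 = -1 -> v x1 = 1 -> `|t| <= 1 ->
    exists y, v y = t.
  move=> cv v0 v1; rewrite ler_norml => /andP[t0 t1].
  by apply: (connected_ivt (@continuum_connected P) cv (x := x0) (y := x1)); rewrite ?v0 ?v1.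
(* The end values are missed by [3 * k] at [ym] and [yp], and by [h3 <= k] more in passing to
   [g]. *)
have k40 : 0 < 4 * k by rewrite mulr_gt0.
have [||||V [cV V1 [vm vmE] [vp vpE] HV]] := @arc_lift R P (@continuum_compact P)
    (@continuum_hausdorff P) indec (@continuum_connected P) E g (4 * k) (w ym) (w yp)
    cE E1 (ex_intro _ xm Em) (ex_intro _ xp Ep) cg g1 k40.
- by rewrite -ler_norml.
- by rewrite -ler_norml.
- by have := gw ym; rewrite ler_norml => /andP[? ?]; lra.
- by have := gw yp; rewrite ler_norml => /andP[? ?]; lra.
have caV : continuous (fun x => a' * V x + b') by exact: continuous_affine_from.
pose G l n : cfun R P := if (symbol_rank l n <= N4)%N then
  cpl_fun (fun j => value mu (nd j) l n) L caV else 0.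
have Gle l n : supnorm (G l n) <= radius R l.
  apply: supnorm_le => x; rewrite /G; case: ifP => _; last first.
    by rewrite [Normc.normc _]Normc.normc0 radius_ge0.
  rewrite cpl_funE; apply: cpl_bound => [|j jL]; [exact: wab|exact: value_balls].
pose c2 := valuation_of Gle.
have c2E x l n : (symbol_rank l n <= N4)%N -> value c2 x l n = D l n (V x).
  by move=> ln; rewrite /value /= /G ln cpl_funE.
exists c2; split.
  (* Since [w] and [V] are both onto [[-1, 1]], every point of [mu] has a counterpart among those of
     [c2], and conversely. *)
  apply: opn; apply: (@hausdorff_close_le R N3 N4 dl h3) => //; first exact: leq_maxl.
  split=> _ [x _ <-].
    have [x' hx'] := onto V vm vp (w x) cV vmE vpE (w1 x).
    exists (value c2 x'); first by exists x'.
    by move=> l n ln; rewrite c2E// hx'; exact: hD.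
  have [x' hx'] := onto w wm wp (V x) cw wmE wpE (V1 x).
  exists (value mu x'); first by exists x'.
  by move=> l n ln; have := hD l n x' ln; rewrite hx' -c2E.
move=> x l n ln.
have ln4 : (symbol_rank l n <= N4)%N by apply: leq_trans ln (leq_trans _ (leq_maxr _ _)); rewrite /n0 -addn2 leq_addr.
(* At this [y] the valuation [mu] nearly has the values of [c2] at [x]. *)
have [y hy] := onto w wm wp (V x) cw wmE wpE (V1 x).
have [i Ei] := symbol_codeP ln.
have [t1 ut t2] := Htau i.
have zE : Normc.normc (z y - (E x)%:C) <= 30 * k.
  apply: le_trans (normc_le_ReIm _) _.
  have h4 := gw y; have h5 := HV x; have h6 := zIm y; rewrite -hy in h5.
  have h7 : `|complex.Re (z y) - E x| <= h3 + 7 * (4 * k).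
    have -> : complex.Re (z y) - E x = (complex.Re (z y) - g (w y)) + (g (w y) - E x) by ring.
    by apply: le_trans (ler_normD _ _) (lerD _ _).
  by case: (z y) h6 h7 => u v /= h6 h7; rewrite oppr0 addr0; lra.
have b1 : Normc.normc (value c' x l n - point_term (value c' x) (projT2 (tau i))) <= h.
  by rewrite -normcN opprB c'N//; have := t1 x _ (c'E x); rewrite /f Ei.
have b2 : Normc.normc (point_term (value c' x) (projT2 (tau i)) -
    point_term (value mu y) (projT2 (tau i))) <= h.
  apply: le_trans (t2 _ _ (value_balls c' x) (value_balls mu y)) _.
  by rewrite c'E -normcN opprB -/(z y); have := normc_ge0 (z y - (E x)%:C); nra.
have b3 : Normc.normc (point_term (value mu y) (projT2 (tau i)) - value mu y l n) <= 2 * h.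
  have := pin i (leq_trans (ltn_ord i) (leqW (leqW (leqnSn _)))).
  rewrite ltr_norml => /andP[_ h4].
  have h5 : pair_dist c' (a i) <= h.
    apply: pair_dist_le => x'; rewrite ai Ei -normcN opprB c'N//.
    by have := t1 x' _ (c'E x'); rewrite /f Ei.
  have := pair_dist_ge mu (a i) y; rewrite ai Ei => h6.
  by rewrite -normcN opprB; apply: le_trans h6 _; lra.
have b4 : Normc.normc (value mu y l n - value c2 x l n) <= h.
  by rewrite c2E// -hy; apply: le_trans (hD _ _ _ ln4) _; lra.
have -> : value c' x l n - value c2 x l n =
  (value c' x l n - point_term (value c' x) (projT2 (tau i))) +
  (point_term (value c' x) (projT2 (tau i)) - point_term (value mu y) (projT2 (tau i))) +
  (point_term (value mu y) (projT2 (tau i)) - value mu y l n) +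
  (value mu y l n - value c2 x l n) by ring.
have -> : e = h + h + 2 * h + h by rewrite /h; field.
apply: le_trans (le_normcD _ _) (lerD _ b4).
apply: le_trans (le_normcD _ _) (lerD _ b3).
exact: le_trans (le_normcD _ _) (lerD b1 b2).
Qed.
End Pseudoarc.

(** * The strategy *)

Lemma close_via (R : realType) (x y z d e : R) : `|x - z| < d -> `|y - z| < d ->
  d <= e / 2 -> `|x - y| <= e.
Proof.
rewrite !ltr_norml => /andP[? ?] /andP[? ?] ?.
by rewrite ler_norml; apply/andP; split; lra.
Qed.

Section Game.
Variables (R : realType) (F : connectives R) (P : continuum).
Hypotheses (hF : restricted_family F) (hP : is_pseudoarc R P).
Local Notation CP := (C_algebra R P).
Local Notation T := (T_projectionless_abelian R).

Let chP : chainable P. Proof. by case: hP. Qed.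
Let ndP : Defs.nondegenerate P. Proof. by case: hP. Qed.
Let indec : hereditarily_indecomposable P. Proof. by case: hP. Qed.
Let metP : metrizable R P. Proof. by case: hP. Qed.

(** A dense sequence of [C(P)] need not lie in a given ball, so for each sort, index and precision a
    nearby element of the ball is chosen when there is one. Each choice recurs at arbitrarily late
    stages, when the precision of the play is good enough to use it. *)
Lemma dense_tasks : exists task : nat -> {k : positive & cball CP k},
  forall k (y : cball CP k) (e : R) m, 0 < e -> exists i (y' : cball CP k),
    [/\ (m <= i)%N, task i = existT _ k y' & cnorm (sval y' - sval y) <= e].
Proof.
have [D hD] := dense_sequence metP chP.
pose K (s : nat * nat * nat) := Pos.of_nat s.1.1.
pose close (s : nat * nat * nat) (y : cball CP (K s)) :=
  supnorm ((sval y : cfun R P) - D s.1.2) <= s.2.+1%:R^-1.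
have /choice[E hE] s : exists Y : {k : positive & cball CP k}, forall y', close s y' ->
    exists y, Y = existT _ (K s) y /\ close s y.
  have [[y cy]|no] := pselect (exists y, close s y).
    by exists (existT _ (K s) y) => _ _; exists y.
  by exists (existT _ 1%positive (Lzero (dissection CP))) => y' cy'; case: no; exists y'.
exists (fun i => E (odflt (0, 0, 0)%N (unpickle (logn 2 i)))) => k y e m e0.
have e20 : 0 < e / 2 by rewrite divr_gt0.
pose b := Num.truncn (2 / e).
have hb : b.+1%:R^-1 <= e / 2.
  rewrite -[e / 2]invrK lef_pV2 ?posrE ?invr_gt0// invf_div.
  exact/ltW/truncnS_gt.
have b0 : 0 < b.+1%:R^-1 :> R by rewrite invr_gt0.
have [l hl] := hD (sval y) _ b0.
pose s := (Pos.to_nat k, l, b).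
have Ks : K s = k by rewrite /K /= Pos2Nat.id.
have [y' [Ey cy']] : exists y' : cball CP k, E s = existT _ k y' /\
    supnorm ((sval y' : cfun R P) - D l) <= b.+1%:R^-1.
  have := hE s; rewrite /close; move: (E s); rewrite /= Ks => Y HY.
  by have [y' [h1 h2]] := HY y hl; exists y'.
(* The odd factor makes the index large without changing the exponent of 2, which encodes [s]. *)
exists (2 ^ pickle s * m.*2.+1)%N, y'; split.
- apply: leq_trans (leq_pmull _ _); last by rewrite expn_gt0.
  by rewrite -addnn; lia.
- rewrite lognM ?expn_gt0// pfactorK// [logn 2 m.*2.+1](_ : _ = 0)%N ?addn0 ?pickleK//.
  by apply/eqP; rewrite -leqn0 leqNgt logn_gt0 mem_primes dvdn2 /= odd_double.
have -> : sval y' - sval y = (sval y' - D l) - (sval y - D l) :> CP by rewrite opprB addrA subrK.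
rewrite (splitr e); apply: le_trans (cnormD _ _) (lerD _ _).
  exact: le_trans cy' hb.
by rewrite cnormN; apply: le_trans hl hb.
Qed.

(* The condition reached so far, a valuation in [CP] realizing it, and the
   precision [st_e] to which the symbols of rank at most [st_N] are settled. *)
Record state := State {
  st_p : expressions R; st_c : valuation (dissection CP); st_N : nat; st_e : R
}.

Definition alive (s : state) (q : expressions R) : Prop :=
  [/\ 0 < st_e s, good F (st_p s) (st_c s) (st_N s) (st_e s), condition F T q & st_p s `<=` q].

(** [y] is the element to be named at stage [j]. The factor 2 in [ans_open] covers all later changes
    together, as the precision at least halves at each stage. *)
Record is_answer (a : nat -> term_pair) (j : nat) (y : {k : positive & cball CP k})
    (s : state) (q : expressions R) (s' : state) : Prop := IsAnswer {
  ans_cond : condition F T (st_p s');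
  ans_sub : q `<=` st_p s';
  ans_pos : 0 < st_e s';
  ans_good : good F (st_p s') (st_c s') (st_N s') (st_e s');
  ans_N : (st_N s <= st_N s')%N;
  ans_j : (j <= st_N s')%N;
  ans_near : near_valuation (st_N s) (st_e s) (st_c s) (st_c s');
  ans_half : st_e s' <= st_e s / 2;
  ans_small : st_e s' <= j.+1%:R^-1;
  ans_open : forall c, near_valuation (st_N s') (2 * st_e s') (st_c s') c -> holds q c;
  ans_task : exists n, (symbol_rank (projT1 y) n <= st_N s')%N /\
    sval (st_c s' (projT1 y) n : cball CP _) = sval (projT2 y);
  ans_pins : forall (M : Ldata R) (c : valuation M), is_prestructure M ->
    (forall phi r, st_p s' (phi, r) -> formula_val c phi < r) ->
    forall i, (i < j)%N -> `|pair_dist c (a i) - pair_dist (st_c s') (a i)| < j.+1%:R^-1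
}.

Lemma answer_exists a j y s q : alive s q -> exists s', is_answer a j y s q s'.
Proof.
move=> [e0 gs qcond pq]; have [c0 [qc0 near0]] := gs q qcond pq.
have [fq bq _] := qcond.
have [N1 [d [d0 opn]]] := holds_open fq (condition_built hF qcond) qc0.
case: y => k y; pose r := maxn (st_N s) N1.
(* The rank of this symbol exceeds [r], so naming the element disturbs neither the settled symbols
   nor the symbols that matter for [q]. *)
have [c1 [c1y agree1]] := update_exists c0 r.+1 (svalP y).
pose N' := maxn (symbol_rank k r.+1) j.
have rk : (r < symbol_rank k r.+1)%N by exact: leq_maxr.
have rN' : (r <= N')%N by apply: leq_trans (ltnW rk) (leq_maxl _ _).
have j0 : 0 < j.+1%:R^-1 :> R by rewrite invr_gt0.
(* The bound [d / 2] makes deviations of [2 * e'] harmless for [q]. *)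
pose e' := Num.min (Num.min (st_e s / 2) j.+1%:R^-1) (d / 2).
have e'0 : 0 < e' by rewrite !lt_min j0 !divr_gt0.
have e'1 : e' <= st_e s / 2 by rewrite !ge_min lexx.
have e'2 : e' <= j.+1%:R^-1 by rewrite !ge_min lexx orbT.
have e'3 : e' <= d / 2 by rewrite !ge_min lexx orbT.
have [c' [p0 [agree2 fp0 bp0 hp0 gp0]]] := good_extension chP ndP indec hF c1 N' e'0.
have [p1 [fp1 bp1 hp1 pin]] := pins hF c' j a (CP_prestructure R P) j0.
have agree0 : agree r c0 c'.
  move=> x l n ln; rewrite agree2 ?(leq_trans ln)//.
  exact: agree1 rk _ _ _ ln.
have hopn c : near_valuation N' (2 * e') c' c -> holds q c.
  move=> nc; apply: opn; apply: near_hausdorff.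
  have -> : d = 0 + d by rewrite add0r.
  apply: (@near_trans _ _ _ _ _ _ c').
    by apply: (near_le (leq_maxr (st_N s) N1) (lexx 0)); exact: agree_near.
  apply: near_le nc; last by lra.
  exact: leq_trans (leq_maxr _ _) rN'.
have qc' : holds q c'.
  by apply: hopn => x l n _; rewrite subrr Normc.normc0 mulr_ge0 ?(ltW e'0).
exists (State (q `|` p0 `|` p1) c' N' e'); split => //=.
- split; first by rewrite !finite_setU.
    by move=> phi r' [[/bq//|/bp0//]|/bp1].
  exists (dissection CP), c'; split; first exact: CP_models.
  by move=> phi r' [[/qc'//|/hp0//]|/hp1].
- by move=> x; left; left.
- by move=> q' q'c sub; apply: gp0 => // x xp; apply: sub; left; right.
- exact: leq_trans (leq_maxl _ _) rN'.
- exact: leq_maxr.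
- have -> : st_e s = st_e s + 0 by rewrite addr0.
  apply: near_trans near0 _.
  by apply: (near_le (leq_maxl (st_N s) N1) (lexx 0)); exact: agree_near.
- exists r.+1; split; first exact: leq_maxl.
  apply: cfun_ext => x; rewrite -c1y.
  exact: (agree2 x k r.+1 (leq_maxl _ _)).
- by move=> M c pM hc; apply: pin => // phi r' h; apply: hc; right.
Qed.

(** * A play against the strategy and its limit *)

Section Play.
Variables (a : nat -> term_pair) (task : nat -> {k : positive & cball CP k}).
Hypothesis aP : forall b, exists n, a n = b.
Hypothesis taskP : forall k (y : cball CP k) (e : R) m, 0 < e ->
  exists i (y' : cball CP k),
    [/\ (m <= i)%N, task i = existT _ k y' & cnorm (sval y' - sval y) <= e].
Variable nxt : nat -> state -> expressions R -> state.
Hypothesis nxtP : forall j s q, alive s q -> is_answer a j (task j) s q (nxt j s q).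

Lemma one_leb k : Pos.leb 1 k.
Proof. by apply/Pos.leb_le; lia. Qed.

Definition start : state :=
  State set0 (fun k _ => Lincl (one_leb k) (Lzero (dissection CP))) 0 1.

(** A strategy sees moves only; the states are recomputed from the opponent's moves, which have even
    index. *)
Fixpoint states (Q : nat -> expressions R) (i : nat) : state :=
  if i is i'.+1 then nxt i' (states Q i') (Q i'.*2) else start.

Lemma states_ext Q Q' i : (forall m, (m < i.*2)%N -> Q m = Q' m) -> states Q i = states Q' i.
Proof.
elim: i => //= i IH H; rewrite IH ?H//.
by move=> m hm; apply: H; apply: leq_trans hm _; rewrite leq_double.
Qed.

(** Legality is demanded on all histories, so a history whose state does not fit is answered by
    repeating its last move. *)
Definition answer (s : seq (expressions R)) : expressions R :=
  let i := (size s).-1./2 in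
  let st := states (nth set0 s) i in
  if `[< alive st (last set0 s) >] then st_p (nxt i st (last set0 s)) else last set0 s.

Lemma answer_legal : legal_strategy F T answer.
Proof.
move=> s p cp; rewrite /answer last_rcons; case: asboolP => [al|_]; last by split.
by have [c1 c2 *] := nxtP (size (rcons s p)).-1./2 al.
Qed.

Lemma start_good : good F (st_p start) (st_c start) (st_N start) (st_e start).
Proof.
move=> q qc _; have [c hc] := condition_in_CP chP ndP hF qc; exists c; split=> //.
(* Sorts start at 1, so no symbol has rank 0 and nearness up to rank 0 is vacuous. *)
move=> x k n; rewrite /symbol_rank geq_max leqn0 => /andP[/eqP k0 _].
by have := Pos2Nat.is_pos k; lia.
Qed.

Variable Q : nat -> expressions R.
Hypotheses (playQ : play F T Q) (folQ : follows answer Q).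
Local Notation st i := (states Q i).

Lemma play_condition n : condition F T (Q n).
Proof. by have [c0 H] := playQ; case: n => // n; have [] := H n. Qed.

Lemma play_mono m n : (m <= n)%N -> Q m `<=` Q n.
Proof.
have [_ H] := playQ; elim: n => [|n IH]; first by rewrite leqn0 => /eqP ->.
rewrite leq_eqVlt => /predU1P[->//|/IH h]; apply: subset_trans h _.
by have [_] := H n.
Qed.

Lemma odd_move i : alive (st i) (Q i.*2) -> Q i.*2.+1 = st_p (st i.+1).
Proof.
move=> al; rewrite folQ; last by rewrite /= odd_double.
rewrite /answer size_mkseq [i.*2.+1.-1]/= doubleK.
have E : last set0 (mkseq Q i.*2.+1) = Q i.*2.
  by rewrite -nth_last size_mkseq nth_mkseq.
have E' : states (nth set0 (mkseq Q i.*2.+1)) i = st i.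
  by apply: states_ext => m hm; rewrite nth_mkseq// ltnW.
by rewrite E E'; case: asboolP.
Qed.

Lemma play_alive i : alive (st i) (Q i.*2).
Proof.
elim: i => [|i IH]; first by split; [exact: ltr01|exact: start_good|exact: play_condition|].
have [c1 c2 c3 c4 *] := nxtP i IH; split=> //; first exact: play_condition.
by rewrite -[st_p _](odd_move IH); apply: play_mono; rewrite doubleS.
Qed.

Lemma play_answer i : is_answer a i (task i) (st i) (Q i.*2) (st i.+1).
Proof. exact: nxtP (play_alive i). Qed.

Lemma answer_below i : st_p (st i.+1) `<=` \bigcup_n Q n.
Proof. by rewrite -(odd_move (play_alive i)) => x hx; exists i.*2.+1. Qed.

(** As the precision at least halves, the change at a stage, at most [st_e], is bounded by the
    decrease of [2 * st_e]; the bounds telescope. *)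
Lemma states_near i m : (i <= m)%N ->
  near_valuation (st_N (st i)) (2 * st_e (st i) - 2 * st_e (st m)) (st_c (st i)) (st_c (st m)).
Proof.
have mono m' : (i <= m')%N -> (st_N (st i) <= st_N (st m'))%N.
  elim: m' => [|m' IH]; first by rewrite leqn0 => /eqP ->.
  rewrite leq_eqVlt => /predU1P[->//|/IH h]; apply: leq_trans h _.
  exact: ans_N (play_answer m').
elim: m => [|m IH].
  by rewrite leqn0 => /eqP -> x k n _; rewrite !subrr Normc.normc0.
rewrite leq_eqVlt => /predU1P[<-|im] => [x k n _|]; first by rewrite !subrr Normc.normc0.
have h := near_le (mono m im) (lexx _) (ans_near (play_answer m)).
have half := ans_half (play_answer m).
by apply: near_le (near_trans (IH im) h) => //; lra.
Qed.

Lemma states_near_tail i m : (i <= m)%N ->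
  near_valuation (st_N (st i)) (2 * st_e (st i)) (st_c (st i)) (st_c (st m)).
Proof.
move=> im; apply: near_le (states_near im) => //.
by have [e0 _ _ _] := play_alive m; lra.
Qed.

Lemma states_small (e : R) : 0 < e -> exists i0, forall i, (i0 <= i)%N -> 2 * st_e (st i.+1) <= e.
Proof.
move=> e0; exists (Num.truncn (2 / e)) => i hi.
have small := ans_small (play_answer i).
have h : 2 / e < i.+1%:R by apply: lt_le_trans (truncnS_gt _) _; rewrite ler_nat ltnS.
have h2 : st_e (st i.+1) <= e / 2.
  apply: le_trans small _.
  by rewrite -[e / 2]invrK lef_pV2 ?posrE ?invr_gt0 ?divr_gt0// invf_div ltW.
by lra.
Qed.

Lemma limit_exists : exists c : valuation (dissection CP), forall i,
  near_valuation (st_N (st i)) (2 * st_e (st i)) (st_c (st i)) c.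
Proof.
have lim k n : exists l : cball CP k, forall e : R, 0 < e -> exists i0, forall i, (i0 <= i)%N ->
    cnorm (sval (st_c (st i) k n : cball CP k) - sval l) < e.
  apply: (@Ldist_complete R (dissection CP) (dissection_structure CP) k
    (fun i => st_c (st i) k n)) => e e0.
  have e30 : 0 < e / 3 by rewrite divr_gt0.
  have [i0 hi0] := states_small e30; pose i := maxn i0 (symbol_rank k n).
  exists i.+1 => m m' im im'.
  have kn : (symbol_rank k n <= st_N (st i.+1))%N.
    exact: leq_trans (leq_maxr _ _) (ans_j (play_answer i)).
  have hs := hi0 i (leq_maxl _ _).
  apply: (@le_lt_trans _ _ (e / 3 + e / 3)); last by lra.
  apply: supnorm_le => x.
  have h1 := states_near_tail im x kn; have h2 := states_near_tail im' x kn.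
  rewrite -[Normc.normc _]/(Normc.normc (value (st_c (st m)) x k n - value (st_c (st m')) x k n)).
  have -> : value (st_c (st m)) x k n - value (st_c (st m')) x k n =
    - (value (st_c (st i.+1)) x k n - value (st_c (st m)) x k n) +
    (value (st_c (st i.+1)) x k n - value (st_c (st m')) x k n) by ring.
  apply: le_trans (le_normcD _ _) (lerD _ _); rewrite ?normcN.
    exact: le_trans h1 hs.
  exact: le_trans h2 hs.
exists (fun k n => projT1 (cid (lim k n))) => i x k n kn.
apply/ler_addgt0Pr => e e0; rewrite {2}/value; case: cid => l /= /(_ e e0)[i0 hi0].
pose m := maxn i i0.
have h1 := states_near_tail (leq_maxl i i0) x kn.
have h2 := hi0 m (leq_maxr _ _).
have h3 : Normc.normc (value (st_c (st m)) x k n - (sval l : cfun R P) x) <= e.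
  exact: le_trans (le_supnorm (sval (st_c (st m) k n : cball CP k) - sval l) x) (ltW h2).
have -> : value (st_c (st i)) x k n - (sval l : cfun R P) x =
  (value (st_c (st i)) x k n - value (st_c (st m)) x k n) +
  (value (st_c (st m)) x k n - (sval l : cfun R P) x) by ring.
exact: le_trans (le_normcD _ _) (lerD h1 h3).
Qed.

Section Limit.
Variable c : valuation (dissection CP).
Hypothesis cnear : forall i,
  near_valuation (st_N (st i)) (2 * st_e (st i)) (st_c (st i)) c.

Lemma limit_satisfies : satisfies T (\bigcup_n Q n) c.
Proof.
split; first exact: CP_models.
move=> phi r [n _ hn]; have hold := ans_open (play_answer n) (@cnear n.+1).
apply: hold.
by apply: play_mono hn; rewrite -addnn leq_addr.
Qed.

(** From some stage on, the pins determine the distance in every model of the whole play up to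
    [i.+1%:R^-1], and [c] is one of these models. *)
Lemma limit_entails k (t u : Lterm k) :
  entails_eq T (\bigcup_n Q n) (Dist R t u) (Ldist (term_val c t) (term_val c u)).
Proof.
have [n hn] := aP (existT _ k (t, u)).
have near (M : Ldata R) (c' : valuation M) i : satisfies T (\bigcup_n Q n) c' -> (n < i)%N ->
    `|Ldist (term_val c' t) (term_val c' u) - pair_dist (st_c (st i.+1)) (a n)| < i.+1%:R^-1.
  move=> [[sM _] hc'] ni; have := ans_pins (play_answer i) (structure_pre sM) (c := c') _ ni.
  by rewrite {1}hn; apply => phi r /answer_below; exact: hc'.
move=> M c' sat; rewrite [formula_val _ _]/(Ldist (term_val c' t) (term_val c' u)).
apply/eqP; rewrite -subr_eq0 -normr_le0; apply/ler_addgt0Pr => e e0.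
rewrite add0r; pose i := maxn n.+1 (Num.truncn (2 / e)).
have h1 := near _ _ i sat (leq_maxl _ _).
have h2 := near _ _ i limit_satisfies (leq_maxl _ _).
have h3 : i.+1%:R^-1 <= e / 2.
  rewrite -[e / 2]invrK lef_pV2 ?posrE ?invr_gt0 ?divr_gt0// invf_div ltW//.
  by apply: lt_le_trans (truncnS_gt _) _; rewrite ler_nat ltnS leq_maxr.
exact: close_via h1 h2 h3.
Qed.

Lemma limit_entails_unique k (t u : Lterm k) r :
  entails_eq T (\bigcup_n Q n) (Dist R t u) r -> r = Ldist (term_val c t) (term_val c u).
Proof. by move=> /(_ _ _ limit_satisfies). Qed.

Lemma limit_definitive : definitive T (\bigcup_n Q n).
Proof.
move=> k t u; exists (Ldist (term_val c t) (term_val c u)); split.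
  exact: limit_entails.
by move=> r /limit_entails_unique.
Qed.

(** Interpreting terms at [c] gives the embedding. It has dense image because at a late stage some
    symbol is set to an element near [y] and moves by at most [2 * st_e] afterwards. *)
Lemma limit_compiled : is_compiled T (\bigcup_n Q n) c.
Proof.
split; first exact: dissection_structure.
exists (fun k t => term_val c t); split=> //; last first.
  move=> k y e e0; have e30 : 0 < e / 3 by rewrite divr_gt0.
  have [i0 hi0] := states_small e30.
  have [i [y' [im Ei yy]]] := taskP y i0 e30.
  have [n] := ans_task (play_answer i); rewrite Ei /= => -[rn En].
  exists (Sym k n); rewrite -[ltLHS]/(cnorm (sval (c k n : cball CP k) - sval y)).
  have -> : sval (c k n : cball CP k) - sval y = - (sval y' - sval (c k n : cball CP k))
     + (sval y' - sval y) :> CP by rewrite opprB addrA subrK.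
  apply: le_lt_trans (cnormD _ _) _; rewrite cnormN.
  have h : cnorm (sval y' - sval (c k n : cball CP k)) <= e / 3.
    apply: supnorm_le => x; apply: le_trans _ (hi0 i im).
    by have := @cnear i.+1 x k n rn; rewrite /value En.
  by apply: le_lt_trans (lerD h yy) _; lra.
split=> // k t u /=.
have /(@getPex R) := ex_intro (fun r => entails_eq T (\bigcup_n Q n) (Dist R t u) r) _
  (@limit_entails k t u).
by move=> /limit_entails_unique ->.
Qed.
End Limit.
End Play.
End Game.

Lemma Lisomorphic_refl (R : realType) (M : Ldata R) : Lisomorphic M M.
Proof.
exists (fun k x => x); split=> // k y; exists y; split=> //.
Qed.

Theorem corollary4p3 (R : realType) (F : connectives R)
    (hF : restricted_family F) (P : continuum) (hP : is_pseudoarc R P) :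
  enforceable_structure F (T_projectionless_abelian R)
    (dissection (C_algebra R P)).
Proof.
have [a aP] := term_pair_enumeration.
have [task taskP] := dense_tasks hP.
have /choice[nxt nxtP] (x : nat * state R P * expressions R) : exists s',
    alive F x.1.2 x.2 -> is_answer F a x.1.1 (task x.1.1) x.1.2 x.2 s'.
  have [al|no] := pselect (alive F x.1.2 x.2); last by exists x.1.2.
  by have [s' h] := answer_exists hF hP a x.1.1 (task x.1.1) al; exists s'.
pose reply j s q := nxt (j, s, q).
have replyP j s q : alive F s q -> is_answer F a j (task j) s q (reply j s q) := nxtP (j, s, q).
exists (answer F reply); split; first exact: answer_legal replyP.
move=> Q playQ folQ.
have [c cnear] := limit_exists hF hP replyP playQ folQ.
split; first exact: (limit_definitive hF hP aP replyP playQ folQ cnear).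
exists (dissection (C_algebra R P)), c; split; last exact: Lisomorphic_refl.
exact: (limit_compiled hF hP aP taskP replyP playQ folQ cnear).
Qed.
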